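(* Let $p$ be a prime with $p \equiv 1 \pmod{12}$, let $b,c$ be positive integers with $p=b^{2}+bc+c^{2}$, let $m\geq 2$ be an integer with $3\nmid m$, and let $\mathcal Q$ be a finite self-dual regular $4$-polytope of type $\{\{6,3\}_{(m,0)},\{3,6\}_{(m,0)}\}$ such that $p(p^{2}-1)$ does not divide $|\Gamma(\mathcal{Q})|$. Then there exists a properly self-dual chiral $4$-polytope, whose automorphism group is isomorphic to $L_{2}(p)\times \Gamma^{+}(\mathcal{Q})$, of type $\{\{6,3\}_{(m,0)},\{3,6\}_{(m,0)}\}$ if $p\mid m$, and of type $\{\{6,3\}_{(mb,mc)},\{3,6\}_{(mb,mc)}\}$ if $p\nmid m$.
   Context: An abstract $n$-polytope is a ranked poset (ranks $-1,\dots,n$) with a least and a greatest face, all flags of size $n+2$, strongly flag-connected, and satisfying the diamond condition; $\Gamma(\mathcal P)$ is its automorphism group. $\mathcal P$ is regular if $\Gamma(\mathcal P)$ is flag-transitive, and chiral if $\Gamma(\mathcal P)$ has exactly two flag orbits with adjacent flags always in distinct orbits. For regular $\mathcal P$, $\Gamma(\mathcal P)$ is generated by involutions $\rho_0,\dots,\rho_{n-1}$; the rotation subgroup $\Gamma^+(\mathcal P)$ is generated by $\sigma_i=\rho_{i-1}\rho_i$ and has index at most $2$. A polytope is of type $\{\mathcal P_1,\mathcal P_2\}$ if its facets are isomorphic to $\mathcal P_1$ and its vertex-figures to $\mathcal P_2$. A polytope is self-dual if it admits a duality (incidence-reversing bijection onto itself); a chiral polytope is properly self-dual if it admits a duality mapping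 each of the two flag orbits of $\Gamma(\mathcal P)$ onto itself. $\{6,3\}_{(b,c)}$ and $\{3,6\}_{(b,c)}$ denote the toroidal maps obtained from the hexagonal, respectively triangular, tessellation of the plane by factoring out the translation lattice generated by the vector $(b,c)$ (in the usual hexagonal-lattice coordinates) and its image under rotation by $60^\circ$; they are regular if $bc=0$ or $b=c$ and chiral otherwise. $L_2(p)=PSL_2(p)$. *)

(* Defs.v *)
From HB Require Import structures.
From mathcomp Require Import all_boot all_order all_algebra all_fingroup all_solvable.
Set Implicit Arguments.
Unset Strict Implicit.
Unset Printing Implicit Defensive.
Import Order.TTheory GRing.Theory.

(* Only finite polytopes are considered: a polytope with finite automorphism
   group and finitely many flag orbits has finitely many flags, hence finitely
   many faces. The least face is \bot, the greatest face is \top. *)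

Definition chain d (P : finTBPOrderType d) (A : {set P}) : bool :=
  [forall x in A, forall y in A, (x >=< y)%O].

Definition flag d (P : finTBPOrderType d) (A : {set P}) : bool :=
  maxset (@chain d P) A.

Definition flags d (P : finTBPOrderType d) : {set {set P}} := [set A | flag A].

(* One less than the size of a longest chain strictly below x, so that
   \bot has rank -1. *)
Definition face_rank d (P : finTBPOrderType d) (x : P) : int :=
  ((\max_(A : {set P} | chain A && [forall y in A, (y < x)%O]) #|A|)%:Z - 1)%R.

Definition adjacent d (P : finTBPOrderType d) (A B : {set P}) : bool :=
  [&& flag A, flag B, #|A :\: B| == 1 & #|B :\: A| == 1].

Definition rank_adjacent d (P : finTBPOrderType d) (i : int) (A B : {set P}) : bool :=
  adjacent A B && [forall x in A :\: B, face_rank x == i].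

Definition strongly_flag_connected d (P : finTBPOrderType d) : Prop :=
  forall A B : {set P}, flag A -> flag B ->
    connect [rel C D : {set P} |
      [&& adjacent C D, A :&: B \subset C & A :&: B \subset D]] A B.

Definition diamond d (P : finTBPOrderType d) : Prop :=
  forall x y : P, (x < y)%O -> face_rank y = (face_rank x + 2)%R ->
    #|[set z : P | (x < z < y)%O]| = 2.

Definition polytope (n : nat) d (P : finTBPOrderType d) : Prop :=
  [/\ forall A : {set P}, flag A -> #|A| = n.+2,
      strongly_flag_connected P
    & diamond P].

Definition Gamma d (P : finTBPOrderType d) : {set {perm P}} :=
  [set s : {perm P} | [forall x, forall y, (s x <= s y)%O == (x <= y)%O]].

Lemma Gamma_group_set d (P : finTBPOrderType d) : group_set (Gamma P).
Proof.
apply/group_setP; split=> [|s t].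
  by rewrite inE; apply/forallP=> x; apply/forallP=> y; rewrite !perm1.
rewrite !inE => /forallP hs /forallP ht.
apply/forallP=> x; apply/forallP=> y; rewrite !permM.
by rewrite (eqP (forallP (ht _) _)) (eqP (forallP (hs _) _)).
Qed.

Canonical Gamma_group d (P : finTBPOrderType d) := Group (Gamma_group_set P).

(* 'P^* is the action of permutations of faces on sets of faces. *)
Definition flag_orbits d (P : finTBPOrderType d) : {set {set {set P}}} :=
  orbit ('P^*)%act (Gamma P) @: flags P.

Definition regular d (P : finTBPOrderType d) : Prop :=
  [transitive Gamma P, on flags P | ('P^*)%act].

Definition chiral d (P : finTBPOrderType d) : Prop :=
  #|flag_orbits P| = 2 /\
  forall A B : {set P}, adjacent A B -> B \notin orbit ('P^*)%act (Gamma P) A.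

(* For a regular polytope with base flag A, the unique automorphism mapping A
   to its i-adjacent flag. *)
Definition rho d (P : finTBPOrderType d) (A : {set P}) (i : nat) : {perm P} :=
  odflt 1%g [pick s in Gamma P | rank_adjacent i A (s @: A)].

Definition sigma d (P : finTBPOrderType d) (A : {set P}) (i : nat) : {perm P} :=
  (rho A i.-1 * rho A i)%g.

(* The subgroup of a regular n-polytope generated by sigma_1, ..., sigma_(n-1)
   relative to the base flag A. Base flags being conjugate, and this subgroup
   being normal in Gamma P, it does not depend on A. *)
Definition rotation_subgroup (n : nat) d (P : finTBPOrderType d) (A : {set P}) :
    {set {perm P}} :=
  <<[set sigma A i | i : 'I_n & 0 < i]>>%g.

Definition duality d (P : finTBPOrderType d) (f : {perm P}) : Prop :=
  forall x y : P, (f x <= f y)%O = (y <= x)%O.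

Definition self_dual d (P : finTBPOrderType d) : Prop :=
  exists f : {perm P}, duality f.

Definition properly_self_dual d (P : finTBPOrderType d) : Prop :=
  exists2 f : {perm P}, duality f &
    forall O : {set {set P}}, O \in flag_orbits P ->
      [set f @: A | A : {set P} in O] = O.

Definition SL2 (p : nat) : {set {'GL_2(p)}} :=
  [set u : {'GL_2(p)} | (\det (GLval u) == 1)%R].

Lemma SL2_group_set (p : nat) : group_set (SL2 p).
Proof.
apply/group_setP; split=> [|u v]; first by rewrite inE GL_1E det1.
by rewrite !inE GL_ME det_mulmx => /eqP-> /eqP->; rewrite mulr1.
Qed.

Canonical SL2_group (p : nat) := Group (SL2_group_set p).

Definition L2 (p : nat) : {set coset_of 'Z(SL2 p)%g} := (SL2 p / 'Z(SL2 p))%g.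

From mathcomp Require Import boolp classical_sets functions.
Local Open Scope ring_scope.
Local Open Scope classical_set_scope.

(* Coordinates with respect to two unit vectors at an angle of 60 degrees, so
   (x, y) has squared length x^2 + xy + y^2. *)
Definition point : Type := (int * int)%type.

Definition rot60 (v : point) : point := (- v.2, v.1 + v.2).

(* The faces of a tessellation are given by their vertex sets, ordered by
   inclusion; the improper faces are set0 and setT. *)
Inductive tri_face : set point -> Prop :=
| TriNull : tri_face set0
| TriVertex (w : point) : tri_face [set w]
| TriEdge (w : point) (k : nat) :
    tri_face [set w; w + iter k rot60 (1, 0)]
| TriTriangle (w : point) (k : nat) :
    tri_face [set w; w + iter k rot60 (1, 0); w + iter k.+1 rot60 (1, 0)]
| TriFull : tri_face setT.

(* The hexagons are centred at the vertices of the triangular tessellation and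
   their vertices are the centres of its triangles. To keep coordinates
   integral they are multiplied by 3: the centre of the triangle (0,0), (1,0),
   (0,1) becomes (1,1), and hexagon centres are the points 3w. *)
Definition hex_corner (w : point) (k : nat) : point :=
  w *+ 3 + iter k rot60 (1, 1).

Inductive hex_face : set point -> Prop :=
| HexNull : hex_face set0
| HexVertex (w : point) (k : nat) : hex_face [set hex_corner w k]
| HexEdge (w : point) (k : nat) :
    hex_face [set hex_corner w k; hex_corner w k.+1]
| HexHexagon (w : point) : hex_face (range (hex_corner w))
| HexFull : hex_face setT.

Definition lattice (v : point) : set point :=
  [set t | exists i j : int, t = v *~ i + rot60 v *~ j].

Definition translate (t : point) (A : set point) : set point :=
  [set x + t | x in A].

(* The faces of the quotient are the orbits of faces under the lattice. *)
Definition torus_quotient (F : set (set point)) (v : point) :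
    set (set (set point)) :=
  [set [set translate t A | t in lattice v] | A in F].

Definition torus_le (O1 O2 : set (set point)) : Prop :=
  exists A B : set point, [/\ O1 A, O2 B & A `<=` B].

(* {3,6}_(b,c) *)
Definition map36 (b c : nat) : set (set (set point)) :=
  torus_quotient tri_face (b%:Z, c%:Z).

(* {6,3}_(b,c), with the factor 3 of the scaled coordinates *)
Definition map63 (b c : nat) : set (set (set point)) :=
  torus_quotient hex_face ((b%:Z, c%:Z) *+ 3).

Definition section_iso d (P : finTBPOrderType d) (x y : P)
    (M : set (set (set point))) : Prop :=
  exists2 f : P -> set (set point),
    set_bij [set z : P | (x <= z <= y)%O] M f
  & forall z t : P, (x <= z <= y)%O -> (x <= t <= y)%O ->
      ((z <= t)%O <-> torus_le (f z) (f t)).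

Definition of_type (n : nat) d (P : finTBPOrderType d)
    (M1 M2 : set (set (set point))) : Prop :=
  (forall x : P, face_rank x = n%:Z - 1 -> section_iso \bot%O x M1) /\
  (forall x : P, face_rank x = 0 -> section_iso x \top%O M2).

(* Main.v *)
Require Import Defs.
From HB Require Import structures.
From mathcomp Require Import all_boot all_order all_algebra all_fingroup all_solvable.
From mathcomp Require Import zify ring.
From mathcomp Require boolp classical_sets functions finfield.
Set Implicit Arguments.
Unset Strict Implicit.
Unset Printing Implicit Defensive.

(** The condition modulo 12 comes from writing affine maps as matrices of determinant 1: the
    diagonal entry must be a square root of a power of [zeta], so F_p has to contain a primitive
    twelfth root of unity [alpha]. The third generator is then scaled so that [s1 * s2 * s3] has
    trace 0, that is, order 2 modulo scalars. No presentation of the rotation group of the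
    tessellation is used. The relation [walk] pairs the value of a word in a group with the motion
    spelled by the same word, and [exact_walks] says which motions have value 1; this serves for the
    matrices, for Q and for the mix alike. Only facets are analysed; vertex-figures are carried to
    facets by the duality. The obstacle is that the rotations of Q may form all of Gamma(Q), and
    then the order hypothesis does not exclude that |L2(p)| = p(p^2-1)/2 divides their number. In
    that case [rho 2] is itself a rotation and realizes the reflection there; a homomorphism onto
    L2(p) matching the generators would transport it to L2(p), where the lattice of (b,c) forbids
    it. *)

(** Generators a, b, c of a group G with (ab)^2 = (bc)^2 = (abc)^2 = 1 and a
suitable intersection property yield a rank 4 polytope whose faces are cosets
of <b,c>, <ab,c>, <a,bc> and <a,b>. It is chiral with automorphism group G as
soon as no endomorphism of G fixes ab and inverts b and c, it is properly
self-dual when some conjugation maps (a,b,c) to (c^-1,b^-1,a^-1), and its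
facets are determined by the kernel of the natural map from the rotation group
of the hexagonal tessellation onto <a,b>.

In L2(p) there is such a triple of generators s1, s2, s3: here s1 and s2
generate affine maps z |-> zeta^k z + t over F_p with zeta = -b/c a primitive
sixth root of unity, so the translation part of the kernel is the lattice of
(b,c), while for s2 and s3 one takes the transposed affine group. The theorem
comes from the mix with the rotations sigma_i of Q, that is from the triple
(s_i, sigma_i) in L2(p) x Gamma^+(Q), whose lattice is the intersection of those
of (b,c) and (m,0). By simplicity of L2(p), a failure of generation, or a
mirror of the mix, would give either a homomorphism of Gamma^+(Q) onto L2(p)
while |Gamma(Q)| = 2 |Gamma^+(Q)|, which contradicts the order hypothesis, or an
automorphism of L2(p) realizing a reflection that does not preserve the lattice
of (b,c). *)

(** * Flags, automorphisms and rotations of polytopes *)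

Section ChainTheory.
Import Order.TTheory.
Local Open Scope order_scope.
Variables (d : Order.disp_t) (P : finTBPOrderType d).
Implicit Types (x y z : P) (A B C : {set P}).

Lemma chainP A :
  reflect {in A &, forall x y, x >=< y} (chain A).
Proof.
apply: (iffP 'forall_in_'forall_in_idP) => [h x y xA yA|h x xA y yA];
  exact: h.
Qed.

Lemma chainS A B : A \subset B -> chain B -> chain A.
Proof.
by move=> /subsetP sAB /chainP cB; apply/chainP => x y /sAB xB /sAB; apply: cB.
Qed.

Lemma chainU1 x A : chain A -> {in A, forall y, x >=< y} -> chain (x |: A).
Proof.
move=> /chainP cA xA; apply/chainP => y z; rewrite !inE.
move=> /predU1P[->|yA] /predU1P[->|zA].
- exact: comparablexx.
- exact: xA.
- by rewrite comparable_sym xA.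
- exact: cA.
Qed.

Lemma flag_sup A : chain A -> exists2 B, flag B & A \subset B.
Proof. by move=> cA; have [B fB sAB] := maxset_exists cA; exists B. Qed.

Lemma flag_chain A : flag A -> chain A.
Proof. exact: maxsetp. Qed.

Lemma flag_mem A x : flag A -> {in A, forall y, x >=< y} -> x \in A.
Proof.
move=> fA xA; rewrite -(maxsetsup fA (chainU1 (flag_chain fA) xA)) ?setU11 //.
exact: subsetUr.
Qed.

Lemma flag_bot A : flag A -> \bot \in A.
Proof. by move=> fA; apply: flag_mem => // y _; rewrite /Order.comparable le0x. Qed.

Lemma flag_top A : flag A -> \top \in A.
Proof.
by move=> fA; apply: flag_mem => // y _; rewrite /Order.comparable lex1 orbT.
Qed.

(** The rank plus one, kept in [nat]: the faces of a flag of an n-polytope have heights 0 to n+1,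
    the improper ones included. *)
Definition height x : nat :=
  \max_(A : {set P} | chain A && [forall y in A, y < x]) #|A|.

Lemma face_rankE x : face_rank x = ((height x)%:Z - 1)%R.
Proof. by []. Qed.

Lemma height_ge A x : chain A -> {in A, forall y, y < x} -> (#|A| <= height x)%N.
Proof.
move=> cA Ax; apply: leq_bigmax_cond; rewrite cA; exact/forall_inP.
Qed.

Lemma height_witness x :
  exists A, [/\ chain A, {in A, forall y, y < x} & #|A| = height x].
Proof.
have := @eq_bigmax_cond {set P}
  [pred A : {set P} | chain A && [forall y in A, y < x]] (fun A => #|A|).
case=> [|A /andP[cA /forall_inP Ax] eqA]; last by exists A.
apply/card_gt0P; exists set0; rewrite inE /=; apply/andP; split.
  by apply/chainP => y z; rewrite inE.
by apply/forall_inP => y; rewrite inE.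
Qed.

Lemma height_lt x y : x < y -> (height x < height y)%N.
Proof.
move=> xy; have [A [cA Ax <-]] := height_witness x.
have xNA : x \notin A by apply/negP => /Ax; rewrite ltxx.
have <- : #|x |: A| = #|A|.+1 by rewrite cardsU1 xNA.
apply: height_ge.
  by apply: chainU1 => // z /Ax zx; rewrite /Order.comparable (ltW zx) orbT.
by move=> z /setU1P[->//|/Ax zx]; apply: lt_trans xy.
Qed.

Lemma height_le x y : x <= y -> (height x <= height y)%N.
Proof. by rewrite le_eqVlt => /predU1P[->//|/height_lt/ltnW]. Qed.

Lemma chain_height_inj A : chain A -> {in A &, injective height}.
Proof.
move=> /chainP cA x y xA yA hxy; have := cA _ _ xA yA.
by case: comparableP => // /height_lt; rewrite hxy ltnn.
Qed.

Lemma chain_height_lt A x y : chain A -> x \in A -> y \in A ->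
  (height x < height y)%N -> x < y.
Proof.
move=> /chainP cA xA yA hxy; have := cA _ _ xA yA.
case: comparableP => // [/height_lt|xy]; last by rewrite xy ltnn in hxy.
by rewrite ltnNge (ltnW hxy).
Qed.

End ChainTheory.

Section PolytopeTheory.
Import Order.TTheory GRing.Theory.
Local Open Scope order_scope.
Variables (n : nat) (d : Order.disp_t) (P : finTBPOrderType d).
Hypothesis P_polytope : polytope n P.
Implicit Types (x y z : P) (A B C : {set P}) (s : {perm P}).

Lemma polytope_height_max x : (height x <= n.+1)%N.
Proof.
have [card_flag _ _] := P_polytope.
have [A [cA Ax <-]] := height_witness x.
have xNA : x \notin A by apply/negP => /Ax; rewrite ltxx.
have cxA : chain (x |: A).
  by apply: chainU1 => // z /Ax zx; rewrite /Order.comparable (ltW zx) orbT.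
have [B fB sB] := flag_sup cxA.
by have := subset_leq_card sB; rewrite cardsU1 xNA (card_flag _ fB).
Qed.

(** Indexed by height, so [face A i.+1] is the face of rank i. The default [\bot] is never reached
    when [A] is a flag and [i < n.+2]. *)
Definition face A i : P := odflt \bot [pick x in A | height x == i].

Lemma face_height A x : flag A -> x \in A -> face A (height x) = x.
Proof.
move=> fA xA; rewrite /face; case: pickP => [y /andP[yA /eqP hy]|/(_ x)] /=.
  exact: (chain_height_inj (flag_chain fA)).
by rewrite xA eqxx.
Qed.

(** Pigeonhole: the n+2 faces of a flag have pairwise distinct heights, all at most n+1, so every
    height occurs. *)
Lemma faceP A i : flag A -> (i < n.+2)%N -> face A i \in A /\ height (face A i) = i.
Proof.
move=> fA lin; suff [x xA hx] : exists2 x, x \in A & height x = i.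
  by rewrite -hx face_height.
have [card_flag _ _] := P_polytope.
pose h (x : {x | x \in A}) : 'I_n.+2 := inord (height (val x)).
have hE u : h u = height (val u) :> nat.
  by rewrite inordK // ltnS polytope_height_max.
have hI : injective h.
  move=> u v exy; apply/val_inj/(chain_height_inj (flag_chain fA)); try exact: valP.
  by rewrite -!hE exy.
have [|g _ hg] := inj_card_bij hI.
  by rewrite card_ord card_sig -(card_flag _ fA); apply: eq_leq; apply: eq_card.
by exists (val (g (Ordinal lin))); [exact: valP | rewrite -hE hg].
Qed.

Lemma face_in A i : flag A -> (i < n.+2)%N -> face A i \in A.
Proof. by move=> fA /(faceP fA)[]. Qed.

Lemma height_face A i : flag A -> (i < n.+2)%N -> height (face A i) = i.
Proof. by move=> fA /(faceP fA)[]. Qed.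

Lemma face_lt A i j : flag A -> (i < j < n.+2)%N -> face A i < face A j.
Proof.
move=> fA /andP[lij ljn]; have lin := ltn_trans lij ljn.
by apply: (chain_height_lt (flag_chain fA)); rewrite ?face_in ?height_face.
Qed.

Lemma face0 A : flag A -> face A 0 = \bot.
Proof.
move=> fA; have := face_lt fA (isT : (0 < 1 < n.+2)%N) => _.
have b0 := flag_bot fA; have [f0A h0] := faceP fA (ltn0Sn _).
apply: (chain_height_inj (flag_chain fA)) => //; rewrite h0.
by apply/esym/eqP; rewrite -leqn0 -h0 height_le // le0x.
Qed.

Lemma face_last A : flag A -> face A n.+1 = \top.
Proof.
move=> fA; have b0 := flag_top fA; have [f0A h0] := faceP fA (ltnSn _).
apply: (chain_height_inj (flag_chain fA)) => //; rewrite h0.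
by apply/eqP; rewrite eqn_leq polytope_height_max -h0 height_le // lex1.
Qed.

Lemma flag_eq A B : flag A -> flag B ->
  (forall i, (i < n.+2)%N -> face A i = face B i) -> A = B.
Proof.
have [card_flag _ _] := P_polytope.
move=> fA fB eAB; apply/eqP; rewrite eqEcard (card_flag _ fA) (card_flag _ fB) leqnn.
rewrite andbT; apply/subsetP => x xA; rewrite -(face_height fA xA) eAB ?face_in //.
all: by rewrite ltnS polytope_height_max.
Qed.

(** A staircase of n+2 elements is a chain with the size of a flag, hence a flag. Counting steps
    from the bottom and from the top pins the height of [a i] to i. *)
Lemma stair_flag (a : nat -> P) : (forall i, (i < n.+1)%N -> a i < a i.+1) ->
  flag [set a i | i : 'I_n.+2] /\
  forall i, (i < n.+2)%N -> face [set a i | i : 'I_n.+2] i = a i.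
Proof.
have [card_flag _ _] := P_polytope.
move=> sa; have lta i j : (i < j)%N -> (j < n.+2)%N -> a i < a j.
  elim: j => // j IHj; rewrite ltnS leq_eqVlt => /predU1P[->|lij] ljn.
    exact: sa.
  by apply: lt_trans (IHj lij (ltnW ljn)) (sa _ _).
have inj : injective (fun i : 'I_n.+2 => a i).
  move=> i j eij; apply/val_inj/eqP; case: ltngtP => // lij.
    by have := lta _ _ lij (ltn_ord j); rewrite eij ltxx.
  by have := lta _ _ lij (ltn_ord i); rewrite eij ltxx.
set A := [set _ | _ in _].
have cA : chain A.
  apply/chainP => x y /imsetP[i _ ->] /imsetP[j _ ->]; rewrite /Order.comparable.
  case: (ltngtP i j) => [lij|lji|/val_inj->]; last by rewrite lexx.
    by rewrite (ltW (lta _ _ lij _)).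
  by rewrite (ltW (lta _ _ lji _)) ?orbT.
have fA : flag A.
  have [B fB sAB] := flag_sup cA.
  suff -> : A = B by [].
  by apply/eqP; rewrite eqEcard sAB (card_flag _ fB) card_imset // card_ord /=.
split=> // i lin.
have hge j : (j < n.+2)%N -> (j <= height (a j))%N.
  elim: j => // j IHj ljn; apply: leq_ltn_trans (IHj (ltnW ljn)) _.
  exact/height_lt/sa.
have hle j : (j <= n.+1)%N -> (height (a (n.+1 - j)) <= n.+1 - j)%N.
  elim: j => [|j IHj] ljn; first by rewrite subn0 polytope_height_max.
  have := IHj (ltnW ljn); rewrite -[in X in _ -> X]ltnS.
  have -> : (n.+1 - j)%N = (n.+1 - j.+1).+1 by rewrite subnSK.
  by apply: leq_trans; apply/height_lt/sa; rewrite ltn_subrL.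
have hi : height (a i) = i.
  apply/eqP; rewrite eqn_leq hge // andbT.
  by have := hle (n.+1 - i)%N; rewrite subKn //; apply; apply: leq_subr.
by rewrite -[in LHS]hi face_height //; apply/imsetP; exists (Ordinal lin).
Qed.

(** Adjacency read level by level; rank i sits at index [i.+1]. Unlike [adjacent], it names the
    level at which the flags differ. *)
Definition nadj i A B : Prop := [/\ flag A, flag B &
  forall j, (j < n.+2)%N -> (face A j == face B j) = (j != i.+1)].

Lemma nadj_sym i A B : nadj i A B -> nadj i B A.
Proof. by case=> fA fB h; split=> // j /h; rewrite eq_sym. Qed.

Lemma face_inE A B i : flag A -> flag B -> (i < n.+2)%N ->
  (face A i \in B) = (face A i == face B i).
Proof.
move=> fA fB lin; apply/idP/eqP => [iB|->]; last exact: face_in.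
by rewrite -[in RHS](height_face fA lin) face_height.
Qed.

Lemma nadj_setD i A B : (i < n)%N -> nadj i A B -> A :\: B = [set face A i.+1].
Proof.
move=> lin [fA fB h]; apply/setP => x; rewrite !inE.
case: (boolP (x \in A)) => xA; last first.
  rewrite andbF; apply/esym/negP => /eqP ex.
  by rewrite ex face_in // in xA; apply: leqW.
have lx : (height x < n.+2)%N by rewrite ltnS polytope_height_max.
rewrite andbT -{1}(face_height fA xA) face_inE // h // negbK.
apply/eqP/eqP => [<-|->]; first by rewrite face_height.
by rewrite height_face //; apply: leqW.
Qed.

Lemma nadj_rank_adjacent i A B : (i < n)%N -> nadj i A B -> rank_adjacent i%:Z A B.
Proof.
move=> lin AB; have BA := nadj_sym AB; have [fA fB _] := AB.
rewrite /rank_adjacent /adjacent fA fB (nadj_setD lin AB) (nadj_setD lin BA).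
rewrite !cards1 !eqxx /=; apply/forall_inP => x; rewrite inE => /eqP->.
rewrite face_rankE height_face //; last by apply: leqW.
by rewrite -addn1 PoszD addrK.
Qed.

Lemma adjacent_nadj A B : adjacent A B -> exists2 i, (i < n)%N & nadj i A B.
Proof.
case/and4P=> fA fB /cards1P[x AB] /cards1P[y BA].
have /setDP[xA xB] : x \in A :\: B by rewrite AB set11.
have hx := polytope_height_max x.
have : height x != 0%N.
  apply: contraNneq xB => hx0; rewrite -(face_height fA xA) hx0 face0 //.
  exact: flag_bot.
have : height x != n.+1.
  apply: contraNneq xB => hx0; rewrite -(face_height fA xA) hx0 face_last //.
  exact: flag_top.
case ex: (height x) hx => [//|i] hi i1 _.
have lin : (i < n)%N by rewrite ltn_neqAle -ltnS hi andbT.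
exists i => //; split=> // j ljn; rewrite -face_inE //; have fj := face_in fA ljn.
have := congr1 (fun D : {set P} => face A j \in D) AB.
rewrite !inE fj andbT => /(canRL negbK) ->; congr (~~ _).
apply/eqP/eqP => [e|->]; last by rewrite -ex face_height.
by rewrite -(height_face fA ljn) e.
Qed.

Lemma rank_adjacent_nadj i A B : rank_adjacent i%:Z A B -> (i < n)%N /\ nadj i A B.
Proof.
case/andP=> /adjacent_nadj[j ljn AB] /forall_inP h.
have [fA fB _] := AB.
have := h (face A j.+1); rewrite (nadj_setD ljn AB) set11 => /(_ isT).
rewrite face_rankE height_face //; last by lia.
by rewrite -addn1 PoszD addrK => /eqP[<-].
Qed.

Lemma diamond_face A i x y z : flag A -> (i < n)%N ->
  face A i < x < face A i.+2 -> face A i < y < face A i.+2 ->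
  face A i < z < face A i.+2 -> x != y -> x != z -> y = z.
Proof.
have [_ _ dia] := P_polytope.
move=> fA lin hx hy hz xy xz; apply/eqP/negP => /negP yz.
have := dia (face A i) (face A i.+2).
rewrite face_lt //; last by lia.
rewrite !face_rankE !height_face //; last by lia.
move=> /(_ isT); have -> : (i.+2%:Z - 1 = i%:Z - 1 + 2)%R.
  by rewrite addrAC -PoszD addn2.
move=> /(_ erefl) c2.
have : [set x; y; z] \subset [set z : P | face A i < z < face A i.+2].
  by apply/subsetP => t; rewrite !inE => /orP[/orP[]|] /eqP->.
move/subset_leq_card; rewrite c2 -setUA cardsU1 cards2 !inE (negPf xy) (negPf xz).
by rewrite yz.
Qed.

Lemma face_between A i : flag A -> (i < n)%N ->
  face A i < face A i.+1 < face A i.+2.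
Proof.
by move=> fA lin; rewrite !face_lt ?leqnn //= ltnS ?(leqW (ltnW lin)) // ltnW.
Qed.

Lemma nadj_between i A B : (i < n)%N -> nadj i A B ->
  face A i < face B i.+1 < face A i.+2.
Proof.
move=> lin [fA fB AB]; have := face_between fB lin.
have /eqP-> : face A i == face B i.
  by rewrite AB; lia.
have /eqP-> // : face A i.+2 == face B i.+2.
by rewrite AB; lia.
Qed.

Lemma nadj_uniq i A B C : (i < n)%N -> nadj i A B -> nadj i A C -> B = C.
Proof.
move=> lin AB AC; have [fA fB hB] := AB; have [_ fC hC] := AC.
apply: flag_eq => // j ljn; have [->|ji] := eqVneq j i.+1; last first.
  have /eqP <- : face A j == face B j by rewrite hB.
  by apply/eqP; rewrite hC.
have li2 : (i.+1 < n.+2)%N by rewrite ltnS leqW.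
have xB : face A i.+1 != face B i.+1 by rewrite hB // eqxx.
have xC : face A i.+1 != face C i.+1 by rewrite hC // eqxx.
exact: (diamond_face fA lin (face_between fA lin) (nadj_between lin AB)
  (nadj_between lin AC)).
Qed.

Lemma flag_upd i A z : flag A -> (i < n)%N -> face A i < z < face A i.+2 ->
  exists2 B, flag B & forall j, (j < n.+2)%N ->
    face B j = if j == i.+1 then z else face A j.
Proof.
move=> fA lin /andP[l1 l2]; pose a j := if j == i.+1 then z else face A j.
have [|fB hB] := @stair_flag a; last by exists [set a i | i : 'I_n.+2].
move=> j ljn; rewrite /a; case: eqVneq => [->|ji]; case: eqVneq => [jS|jSi] //.
- by move/eqP: jS; rewrite eqSS gtn_eqF.
- by move: jS; case=> ->.
- by apply: face_lt => //; rewrite leqnn.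
Qed.

Lemma nadj_ex i A : (i < n)%N -> flag A -> exists B, nadj i A B.
Proof.
move=> lin fA; have [_ _ dia] := P_polytope.
have /(dia (face A i) (face A i.+2)) : face A i < face A i.+2.
  by have /andP[/lt_trans h /h] := face_between fA lin.
rewrite !face_rankE !height_face //; try lia.
have -> : (i.+2%:Z - 1 = i%:Z - 1 + 2)%R by rewrite addrAC -PoszD addn2.
move=> /(_ erefl) c2.
have [z] : exists z, z \in [set z : P | face A i < z < face A i.+2] :\ face A i.+1.
  apply/card_gt0P; have := cardsD1 (face A i.+1) [set z | face A i < z < face A i.+2].
  by rewrite c2 inE (face_between fA lin) add1n => -[<-].
rewrite !inE => /andP[zA zb]; have [B fB hB] := flag_upd fA lin zb.
exists B; split=> // j /hB ->; case: (eqVneq j i.+1) => [->|]; last by rewrite eqxx.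
by rewrite eq_sym (negPf zA).
Qed.

(** The face of rank j is replaced inside an interval bounded by the two levels next to it. A change
    at a rank i that is not consecutive to j leaves these alone, so the two changes can be made in
    either order. *)
Lemma nadj_comm i j A B C : (i.+1 < j)%N -> (j < n)%N ->
  nadj i A B -> nadj j B C -> exists2 D, nadj j A D & nadj i D C.
Proof.
move=> lij ljn AB BC; have [fA fB hA] := AB; have [_ fC hB] := BC.
have lin : (i < n)%N by apply: ltn_trans ljn; apply: ltnW.
have e k : (k < n.+2)%N -> k != i.+1 -> face A k = face B k.
  by move=> lk ki; apply/eqP; rewrite hA.
have [D fD hD] : exists2 D, flag D & forall k, (k < n.+2)%N ->
    face D k = if k == j.+1 then face C j.+1 else face A k.
  apply: flag_upd => //; have := nadj_between ljn BC.
  by rewrite !e //; lia.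
have jC : face C j.+1 != face B j.+1 by rewrite eq_sym hB ?eqxx // ltnS leqW.
have ij : j.+1 != i.+1 by rewrite eqSS gtn_eqF // ltnW.
exists D; split=> // k lk.
  rewrite hD //; case: (eqVneq k j.+1) => [->|]; last by rewrite eqxx.
  by rewrite e //; [rewrite eq_sym (negPf jC) | lia].
rewrite hD //; case: (eqVneq k j.+1) => [->|kj]; first by rewrite eqxx ij.
by have /eqP <- : face B k == face C k; rewrite ?hB ?hA.
Qed.

Lemma GammaP s : reflect {mono s : x y / x <= y} (s \in Gamma P).
Proof.
rewrite inE; apply: (iffP forallP) => [h x y|h x].
  by have /forallP/(_ y)/eqP := h x.
by apply/forallP => y; rewrite h.
Qed.

Lemma Gamma_chain s A : s \in Gamma P -> chain (s @: A) = chain A.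
Proof.
move=> /GammaP sm; apply/chainP/chainP => cA x y.
  move=> xA yA; have := cA _ _ (imset_f s xA) (imset_f s yA).
  by rewrite /Order.comparable !sm.
move=> /imsetP[{}x xA ->] /imsetP[{}y yA ->].
by have := cA _ _ xA yA; rewrite /Order.comparable !sm.
Qed.

Lemma imset_permK s A : s^-1%g @: (s @: A) = A.
Proof. by rewrite -imset_comp -[RHS]imset_id; apply: eq_imset => x /=; rewrite permK. Qed.

Lemma imset_permKV s A : s @: (s^-1%g @: A) = A.
Proof. by rewrite -{1}[s]invgK imset_permK. Qed.

Lemma imset_permM s t A : (s * t)%g @: A = t @: (s @: A).
Proof. by rewrite -imset_comp; apply: eq_imset => x /=; rewrite permM. Qed.

Lemma imset_perm1 A : (1 : {perm P})%g @: A = A.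
Proof. by rewrite -[RHS]imset_id; apply: eq_imset => x; rewrite perm1. Qed.

Lemma setact_imset s A : ('P^*)%act A s = s @: A.
Proof. by []. Qed.

Lemma Gamma_flag s A : s \in Gamma P -> flag A -> flag (s @: A).
Proof.
move=> sG fA; apply/maxsetP; rewrite Gamma_chain // flag_chain //; split=> // B cB sAB.
have sVG : s^-1%g \in Gamma P by rewrite groupV.
have e : s^-1%g @: B = A.
  apply: (maxsetsup fA); first by rewrite Gamma_chain.
  by have := imsetS s^-1%g sAB; rewrite imset_permK.
by rewrite -e imset_permKV.
Qed.

Lemma Gamma_height_le s x : s \in Gamma P -> (height x <= height (s x))%N.
Proof.
move=> sG; have [A [cA Ax <-]] := height_witness x.
rewrite -(card_imset A (@perm_inj _ s)); apply: height_ge.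
  by rewrite Gamma_chain.
move=> _ /imsetP[y yA ->]; have /GammaP sm := sG.
by rewrite lt_neqAle (inj_eq perm_inj) sm -lt_neqAle Ax.
Qed.

Lemma Gamma_height s x : s \in Gamma P -> height (s x) = height x.
Proof.
move=> sG; apply/eqP; rewrite eqn_leq Gamma_height_le // andbT.
by have := @Gamma_height_le s^-1%g (s x); rewrite groupV permK; apply.
Qed.

Lemma Gamma_face s A i : s \in Gamma P -> flag A -> (i < n.+2)%N ->
  face (s @: A) i = s (face A i).
Proof.
move=> sG fA lin; rewrite -[in LHS](height_face fA lin) -(Gamma_height _ sG).
by rewrite face_height ?Gamma_flag // imset_f // face_in.
Qed.

Lemma Gamma_nadj s i A B : s \in Gamma P -> nadj i A B -> nadj i (s @: A) (s @: B).
Proof.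
move=> sG [fA fB h]; split; try exact: Gamma_flag.
by move=> j ljn; rewrite !Gamma_face // (inj_eq perm_inj) h.
Qed.

Lemma flag_cover x : exists2 A, flag A & x \in A.
Proof.
have : chain [set x].
  by apply/chainP => y z /set1P-> /set1P->; apply: comparablexx.
by case/flag_sup => A fA; rewrite sub1set => xA; exists A.
Qed.

(** Strong flag-connectedness gives a path of adjacent flags from [A] to [B]; only its existence is
    kept here, not the faces its flags share. *)
Lemma flag_ind (p : {set P} -> Prop) A : flag A -> p A ->
  (forall i B C, (i < n)%N -> p B -> nadj i B C -> p C) ->
  forall B, flag B -> p B.
Proof.
have [_ sfc _] := P_polytope.
move=> fA pA step B fB; have /connectP[q] := sfc _ _ fA fB.
move: (A :&: B) => I; elim: q A fA pA => [|C q IHq] A fA pA /=; first by move=> _ ->.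
move=> /andP[/and3P[aAC _ _] pq]; have [i lin AC] := adjacent_nadj aAC.
have [_ fC _] := AC; apply: IHq => //; exact: step AC.
Qed.

(** An automorphism fixing one flag fixes each adjacent flag, because the i-adjacent flag is unique.
    Flag induction spreads this to all flags, and every face lies in a flag. *)
Lemma Gamma_free s A : s \in Gamma P -> flag A -> s @: A = A -> s = 1%g.
Proof.
move=> sG fA sA; have fix_flag : forall B, flag B -> s @: B = B.
  apply: (flag_ind fA sA) => i B C lin sB BC.
  by apply: (nadj_uniq lin _ BC); rewrite -{1}sB; apply: Gamma_nadj.
apply/permP => x; rewrite perm1; have [B fB xB] := flag_cover x.
have lx : (height x < n.+2)%N by rewrite ltnS polytope_height_max.
by rewrite -(face_height fB xB) -Gamma_face // fix_flag.
Qed.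

End PolytopeTheory.

Section DualityTheory.
Import Order.TTheory.
Local Open Scope order_scope.
Variables (n : nat) (d : Order.disp_t) (P : finTBPOrderType d).
Hypothesis P_polytope : polytope n P.
Variable f : {perm P}.
Hypothesis f_duality : duality f.
Implicit Types (x y z : P) (A B C : {set P}).

Lemma dualityV : duality f^-1%g.
Proof. by move=> x y; rewrite -[in RHS](permKV f x) -[in RHS](permKV f y) f_duality. Qed.

Lemma duality_chain A : chain A -> chain (f @: A).
Proof.
move=> /chainP cA; apply/chainP => x y /imsetP[{}x xA ->] /imsetP[{}y yA ->].
by have := cA _ _ xA yA; rewrite /Order.comparable !f_duality orbC.
Qed.

Lemma duality_flag A : flag A -> flag (f @: A).
Proof.
have [card_flag _ _] := P_polytope.
move=> fA; have [B fB sAB] := flag_sup (duality_chain (flag_chain fA)).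
suff -> : f @: A = B by []; apply/eqP; rewrite eqEcard sAB card_imset; last exact: perm_inj.
by rewrite /= (card_flag _ fA) (card_flag _ fB).
Qed.

Lemma duality_face A i : flag A -> (i < n.+2)%N ->
  face (f @: A) i = f (face A (n.+1 - i)).
Proof.
move=> fA lin; pose a j := f (face A (n.+1 - j)).
have [j ljn|fB hB] := @stair_flag n d P P_polytope a.
  rewrite /a lt_neqAle (inj_eq perm_inj) f_duality eq_sym -lt_neqAle.
  by apply: (face_lt P_polytope); lia.
suff -> : f @: A = [set a i | i : 'I_n.+2] by rewrite hB.
have [card_flag _ _] := P_polytope.
apply/eqP; rewrite eq_sym eqEcard card_imset; last exact: perm_inj.
rewrite (card_flag _ fA) (card_flag _ fB) leqnn andbT.
apply/subsetP => _ /imsetP[j _ ->]; rewrite /a imset_f //.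
by apply: (face_in P_polytope) => //; lia.
Qed.

Lemma duality_nadj i A B : (i < n)%N -> nadj n i A B ->
  nadj n (n.-1 - i) (f @: A) (f @: B).
Proof.
move=> lin [fA fB h]; split; try exact: duality_flag.
move=> j ljn; rewrite !duality_face // (inj_eq perm_inj) h; lia.
Qed.

End DualityTheory.

(** * Regular polytopes: distinguished involutions and the rotation subgroup *)

Section RegularPolytope.
Import Order.TTheory.
Local Open Scope group_scope.
Variables (n : nat) (d : Order.disp_t) (P : finTBPOrderType d).
Hypothesis P_polytope : polytope n P.
Hypothesis P_regular : regular P.
Variable Phi : {set P}.
Hypothesis Phi_flag : flag Phi.
Implicit Types (x y z : P) (A B C : {set P}) (s t g : {perm P}).
Local Notation rho := (rho Phi).
Local Notation G := (Gamma P).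

Lemma regular_ex A B : flag A -> flag B -> exists2 s, s \in G & s @: A = B.
Proof.
move=> fA fB; have AF : A \in flags P by rewrite inE.
have : B \in orbit ('P^*)%act (Gamma P) A by rewrite (atransP P_regular _ AF) inE.
by case/orbitP=> s sG <-; exists s.
Qed.

(** Flag-transitivity supplies a candidate for the [pick], so the default value in [rho] never
    occurs. *)
Lemma rhoP i : (i < n)%N -> rho i \in G /\ nadj n i Phi (rho i @: Phi).
Proof.
move=> lin; rewrite /rho; case: pickP => [s /andP[sG]|no] /=.
  by case/(rank_adjacent_nadj P_polytope).
have [B AB] := nadj_ex P_polytope lin Phi_flag; have [_ fB _] := AB.
have [s sG sB] := regular_ex Phi_flag fB.
by have := no s; rewrite sG sB (nadj_rank_adjacent P_polytope).
Qed.

Lemma rho_Gamma i : (i < n)%N -> rho i \in G.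
Proof. by case/rhoP. Qed.

Lemma Gamma_eq s t : s \in G -> t \in G -> s @: Phi = t @: Phi -> s = t.
Proof.
move=> sG tG e; apply/eqP; rewrite eq_mulgV1; apply/eqP.
apply: (Gamma_free P_polytope (groupM sG (groupVr tG)) Phi_flag) => //.
by rewrite imset_permM e imset_permK.
Qed.

(** Permutations compose from left to right, so passing from the flag of [g] to an adjacent one
    multiplies [g] by a generator on the left. All later words follow this convention. *)
Lemma nadj_rho i g : (i < n)%N -> g \in G ->
  nadj n i (g @: Phi) ((rho i * g) @: Phi).
Proof.
by move=> lin gG; rewrite imset_permM; apply: Gamma_nadj => //; case: (rhoP lin).
Qed.

Lemma rho_uniq i g h : (i < n)%N -> g \in G -> h \in G ->
  nadj n i (g @: Phi) (h @: Phi) -> h = rho i * g.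
Proof.
move=> lin gG hG gh; have rG := rho_Gamma lin.
apply: Gamma_eq; rewrite ?groupM //.
exact: (nadj_uniq P_polytope lin gh (nadj_rho lin gG)).
Qed.

Lemma rho_inv i : (i < n)%N -> rho i * rho i = 1.
Proof.
move=> lin; have rG := rho_Gamma lin; apply/esym/rho_uniq => //.
apply: nadj_sym; have := nadj_rho lin (group1 _).
by rewrite mulg1 imset_perm1.
Qed.

Lemma rhoV i : (i < n)%N -> (rho i)^-1 = rho i.
Proof. by move=> lin; apply: (mulgI (rho i)); rewrite mulgV rho_inv. Qed.

Lemma rho_comm i j : (i.+1 < j)%N -> (j < n)%N -> rho i * rho j = rho j * rho i.
Proof.
move=> lij ljn; have lin : (i < n)%N by lia.
have iG := rho_Gamma lin; have jG := rho_Gamma ljn.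
have ij := nadj_rho lin (group1 G); have := nadj_rho ljn iG.
rewrite mulg1 in ij => ji; have [D jD Di] := nadj_comm P_polytope lij ljn ij ji.
have eD : D = rho j @: Phi.
  apply: (nadj_uniq P_polytope ljn jD).
  by have := nadj_rho ljn (group1 G); rewrite mulg1.
rewrite eD in Di; apply: Gamma_eq; rewrite ?groupM //.
exact: (nadj_uniq P_polytope lin (nadj_rho lin jG) Di).
Qed.

Lemma rho_face i j : (i < n)%N -> (j < n.+2)%N -> j != i.+1 ->
  rho i (face Phi j) = face Phi j.
Proof.
move=> lin ljn ji; have [rG [_ _ /(_ j ljn)]] := rhoP lin.
by rewrite ji (Gamma_face P_polytope) // => /eqP<-.
Qed.

Lemma sigma_step i g A B : (0 < i < n)%N -> g \in G ->
  nadj n i (g @: Phi) A -> nadj n i.-1 A B ->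
  (sigma Phi i * g) @: Phi = B.
Proof.
move=> /andP[i0 lin] gG gA AB; have lin' : (i.-1 < n)%N by lia.
have eA : A = (rho i * g) @: Phi.
  exact: (nadj_uniq P_polytope lin gA (nadj_rho lin gG)).
have rG : rho i * g \in G by rewrite groupM ?rho_Gamma.
rewrite eA in AB; rewrite /sigma -mulgA.
exact: (nadj_uniq P_polytope lin' (nadj_rho lin' rG) AB).
Qed.

Lemma sigma_Gamma i : (0 < i < n)%N -> sigma Phi i \in G.
Proof.
by move=> /andP[i0 lin]; rewrite /sigma groupM ?rho_Gamma //; apply: leq_ltn_trans lin; lia.
Qed.

Lemma rotation_subgroup_Gamma : rotation_subgroup n Phi \subset G.
Proof.
rewrite gen_subG; apply/subsetP => _ /imsetP[i i0 ->]; rewrite sigma_Gamma //.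
by move: i0; rewrite inE => -> /=.
Qed.

Lemma sigma_rotation i : (0 < i < n)%N -> sigma Phi i \in rotation_subgroup n Phi.
Proof.
move=> /andP[i0 lin]; apply: mem_gen; apply/imsetP.
by exists (Ordinal lin); rewrite // inE.
Qed.

Local Notation Gp := <<[set sigma Phi i | i : 'I_n & 0 < i]>>%G.

Lemma rho0_rho_rotation i : (i < n)%N -> rho 0 * rho i \in Gp.
Proof.
elim: i => [|i IHi] lin; first by rewrite rho_inv.
have -> : rho 0 * rho i.+1 = rho 0 * rho i * sigma Phi i.+1.
  by rewrite /sigma /= -mulgA (mulgA (rho i)) rho_inv ?mul1g // ltnW.
by rewrite groupM ?IHi ?sigma_rotation // ltnW.
Qed.

(** Each crossing multiplies by some [rho i], and [rho 0 * rho i] telescopes to a product of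
    rotations; hence along a path of flags only two cosets can occur. *)
Lemma Gamma_rotation g : 0 < n -> g \in G -> g \in Gp \/ rho 0 * g \in Gp.
Proof.
move=> n0 gG; have rr i : (i < n)%N -> rho i * rho 0 \in Gp.
  by move=> lin; rewrite -groupV invMg !rhoV // rho0_rho_rotation.
pose p (A : {set P}) := exists2 h, h \in G & A = h @: Phi /\ (h \in Gp \/ rho 0 * h \in Gp).
have : p (g @: Phi).
  apply: (flag_ind P_polytope Phi_flag); last exact: Gamma_flag.
    by exists 1; rewrite ?group1 ?imset_perm1 //; split=> //; left.
  move=> i B C lin [h hG [-> hp]] BC; exists (rho i * h).
    by rewrite groupM ?rho_Gamma.
  split; first exact: (nadj_uniq P_polytope lin BC (nadj_rho lin hG)).
  case: hp => hp; [right; rewrite mulgA | left].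
    by rewrite groupM // rho0_rho_rotation.
  have -> : rho i * h = rho i * rho 0 * (rho 0 * h).
    by rewrite -mulgA (mulgA (rho 0)) rho_inv // mul1g.
  by rewrite groupM // rr.
by case=> h hG [/(Gamma_eq gG hG) ->].
Qed.

Lemma card_Gamma_rotation : 0 < n ->
  G = Gp \/ #|G| = (2 * #|rotation_subgroup n Phi|)%N.
Proof.
move=> n0; have sGp : Gp \subset Gamma_group P by exact: rotation_subgroup_Gamma.
have [r0|r0] := boolP (rho 0 \in Gp).
  left; apply/eqP; rewrite eqEsubset [X in _ && X]sGp andbT.
  by apply/subsetP => g /(Gamma_rotation n0)[//|]; rewrite groupMl.
right; have r0G := rho_Gamma n0.
have -> : G = Gp :|: rho 0 *: Gp.
  apply/setP => g; rewrite in_setU mem_lcoset rhoV //; apply/idP/orP => [/(Gamma_rotation n0)//|].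
  case=> [/(subsetP sGp)//|/(subsetP sGp)]; by rewrite groupMl.
rewrite cardsU card_lcoset /rotation_subgroup mul2n -addnn.
suff -> : Gp :&: rho 0 *: Gp = set0 by rewrite cards0 subn0.
apply/setP => g; rewrite in_set0 in_setI mem_lcoset rhoV //; apply/andP => -[gp].
by rewrite groupMr //; apply/negP.
Qed.

(** Flag-transitivity corrects an arbitrary duality so that it fixes [Phi]; conjugation by the
    corrected one then reverses the order of the generators [rho i]. *)
Lemma flag_fixing_duality : self_dual P -> exists2 f : {perm P}, duality f & f @: Phi = Phi.
Proof.
case=> f fd; have [s sG sf] := regular_ex (duality_flag P_polytope fd Phi_flag) Phi_flag.
exists (f * s); last by rewrite imset_permM.
by move=> x y; rewrite !permM (GammaP _ sG) fd.
Qed.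

Lemma duality_rho (f : {perm P}) i : duality f -> f @: Phi = Phi -> (i < n)%N ->
  rho i ^ f = rho (n.-1 - i).
Proof.
move=> fd fP lin; have lin' : (n.-1 - i < n)%N by lia.
have rG := rho_Gamma lin; have rG' := rho_Gamma lin'.
have fV : f^-1 @: Phi = Phi by rewrite -{1}fP imset_permK.
have cG : rho i ^ f \in G.
  apply/GammaP => x y; rewrite conjgE !permM fd (GammaP _ rG).
  exact: (dualityV fd).
apply: Gamma_eq => //; rewrite conjgE !imset_permM fV.
have [_ /(duality_nadj P_polytope fd lin)] := rhoP lin; rewrite fP => h.
by apply: (nadj_uniq P_polytope lin' h); case: (rhoP lin').
Qed.

End RegularPolytope.

(** * Walks in the rotation group of the hexagonal tessellation *)

Section PlaneRotations.
Import GRing.Theory.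
Local Open Scope ring_scope.
Implicit Types (k l : 'Z_6) (z t v : point).

Definition rotz (k : 'Z_6) (z : point) : point := iter k rot60 z.

Lemma Z6_case (p : 'Z_6 -> Prop) :
  p 0 -> p 1 -> p 2 -> p 3 -> p 4 -> p 5 -> forall k, p k.
Proof.
move=> p0 p1 p2 p3 p4 p5 [[|[|[|[|[|[|//]]]]]] lk].
- by rewrite (_ : Ordinal lk = 0) //; apply: val_inj.
- by rewrite (_ : Ordinal lk = 1) //; apply: val_inj.
- by rewrite (_ : Ordinal lk = 2) //; apply: val_inj.
- by rewrite (_ : Ordinal lk = 3) //; apply: val_inj.
- by rewrite (_ : Ordinal lk = 4) //; apply: val_inj.
- by rewrite (_ : Ordinal lk = 5) //; apply: val_inj.
Qed.

Lemma pointE z : z = (z.1, z.2). Proof. by case: z. Qed.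

Lemma rot60_6 z : iter 6 rot60 z = z.
Proof. by case: z => x y; rewrite /= /rot60 /=; congr pair; lia. Qed.

Lemma iter_rot60_mod n z : iter (n %% 6) rot60 z = iter n rot60 z.
Proof.
rewrite [in RHS](divn_eq n 6) addnC iterD; congr (iter _ _ _).
by elim: (n %/ 6)%N => // q IHq; rewrite mulSn iterD -IHq rot60_6.
Qed.

Lemma rotzD k l z : rotz (k + l) z = rotz k (rotz l z).
Proof. by rewrite /rotz -iterD -[RHS]iter_rot60_mod. Qed.

Lemma rotz0 z : rotz 0 z = z. Proof. by []. Qed.

Lemma rotz_nat n z : rotz (n%:R) z = iter n rot60 z.
Proof. by rewrite /rotz val_Zp_nat // iter_rot60_mod. Qed.

Lemma rot60D z t : rot60 (z + t) = rot60 z + rot60 t.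
Proof. by case: z t => [x y] [x' y']; congr pair => /=; lia. Qed.

Lemma rotz_additive k : {morph rotz k : z t / z + t}.
Proof. by move=> z t; rewrite /rotz; elim: (nat_of_ord k) => //= n ->; rewrite rot60D. Qed.

Lemma rotz_0 k : rotz k 0 = 0.
Proof. by apply: (addrI (rotz k 0)); rewrite -rotz_additive !addr0. Qed.

Lemma rotzN k z : rotz k (- z) = - rotz k z.
Proof. by apply: (addrI (rotz k z)); rewrite -rotz_additive !subrr rotz_0. Qed.

Lemma rotzMn k z n : rotz k (z *+ n) = rotz k z *+ n.
Proof. by elim: n => [|n IHn]; rewrite ?mulr0n ?rotz_0 // !mulrS rotz_additive IHn. Qed.

Lemma pointMz (x y i : int) : ((x, y) : point) *~ i = (x * i, y * i).
Proof.
have pM n : ((x, y) : point) *+ n = (x *+ n, y *+ n).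
  by elim: n => // n IHn; rewrite mulrS IHn !mulrS.
rewrite -!mulrzz; case: i => n; first by rewrite -!pmulrn pM.
by rewrite NegzE !mulrNz -!pmulrn pM.
Qed.

Lemma lattice_0 v : lattice v 0.
Proof. by exists 0, 0; rewrite !mulr0z addr0. Qed.

Lemma lattice_D v z t : lattice v z -> lattice v t -> lattice v (z + t).
Proof.
move=> [i [j ->]] [i' [j' ->]]; exists (i + i'), (j + j').
by rewrite !mulrzDr addrACA.
Qed.

Lemma lattice_N v z : lattice v z -> lattice v (- z).
Proof. by move=> [i [j ->]]; exists (- i), (- j); rewrite opprD !mulrNz. Qed.

Lemma rot60Mz z (i : int) : rot60 (z *~ i) = rot60 z *~ i.
Proof.
have r60 t : rot60 t = rotz 1 t by [].
case: i => n; first by rewrite !r60 rotzMn.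
by rewrite !NegzE !mulrNz r60 rotzN rotzMn.
Qed.

Lemma lattice_rot60 v z : lattice v z -> lattice v (rot60 z).
Proof.
move=> [i [j ->]]; exists (- j), (i + j).
rewrite rot60D !rot60Mz mulrNz mulrzDr.
have -> : rot60 (rot60 v) = rot60 v - v by case: v => x y; congr pair => /=; lia.
by rewrite mulrzBl addrC addrAC addrC; congr (_ + _); rewrite addrC.
Qed.

Lemma lattice_rotz v k z : lattice v z -> lattice v (rotz k z).
Proof. by rewrite /rotz; elim: (nat_of_ord k) => //= n IHn /IHn; apply: lattice_rot60. Qed.

(** Needed because hexagonal faces live in coordinates multiplied by 3, while motions keep the
    original ones. *)
Lemma lattice_scale v c t :
  lattice (v *+ c) t <-> exists2 z, lattice v z & t = z *+ c.
Proof.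
have e : rot60 (v *+ c) = rot60 v *+ c by exact: (rotzMn 1).
split=> [[i [j ->]]|[_ [i [j ->]] ->]].
  exists (v *~ i + rot60 v *~ j); first by exists i, j.
  by rewrite mulrnDl e !pmulrn -!mulrzA ![c%:Z * _]mulrC.
by exists i, j; rewrite mulrnDl e !pmulrn -!mulrzA ![c%:Z * _]mulrC.
Qed.

End PlaneRotations.

Section PlaneGroup.
Import GRing.Theory.
Local Open Scope ring_scope.

(* The pair (k, t) stands for the motion z |-> rot60^k z + t. *)
Definition motion : Type := ('Z_6 * point)%type.
Implicit Types (w u : motion).

Definition mcomp w u : motion := (w.1 + u.1, rotz w.1 u.2 + w.2).
Definition mone : motion := (0, 0).
Definition minv w : motion := (- w.1, - rotz (- w.1) w.2).

(* The rotations by 60 degrees about the hexagon centred at 0 and by 120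
   degrees about the centre of the triangle (0,0), (1,0), (0,1). *)
Definition rot_hexagon : motion := (1, 0).
Definition rot_corner : motion := (2, (1, 0)).

Lemma mcompA : associative mcomp.
Proof.
move=> w u x; rewrite /mcomp /= addrA; congr pair.
by rewrite rotz_additive rotzD addrA.
Qed.

Lemma mcomp1 : right_id mone mcomp.
Proof. by move=> [k t]; rewrite /mcomp /= addr0 rotz_0 add0r. Qed.

Lemma m1comp : left_id mone mcomp.
Proof. by move=> [k t]; rewrite /mcomp /= add0r rotz0 addr0. Qed.

Lemma mcompV w : mcomp w (minv w) = mone.
Proof.
by rewrite /mcomp /minv /= subrr rotzN -rotzD subrr rotz0 addNr.
Qed.

Lemma mVcomp w : mcomp (minv w) w = mone.
Proof. by rewrite /mcomp /minv /= addNr subrr. Qed.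

Lemma minvM w u : minv (mcomp w u) = mcomp (minv u) (minv w).
Proof.
rewrite /minv /mcomp /= opprD addrC; congr pair.
by rewrite rotz_additive -rotzD addrNK opprD rotzN -rotzD; apply: addrC.
Qed.

Lemma minvK : involutive minv.
Proof. by move=> w; rewrite -[RHS]mcomp1 -(mcompV (minv w)) mcompA mcompV m1comp. Qed.

End PlaneGroup.

(** * Words in two generators and the plane motions they spell *)

Section Walks.
Import GRing.Theory.
Local Open Scope group_scope.
Variables (gT : finGroupType) (a b : gT).
Implicit Types (g h : gT) (w u : motion).

(* Groups act on the right, so a product of group elements is read in the order
   opposite to the composition of motions. *)
Inductive walk : gT -> motion -> Prop :=
| Walk1 : walk 1 mone
| WalkHexagon g w : walk g w -> walk (a * g) (mcomp w rot_hexagon)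
| WalkCorner g w : walk g w -> walk (b * g) (mcomp w rot_corner).

Lemma walkM g h w u : walk g w -> walk h u -> walk (h * g) (mcomp w u).
Proof.
move=> gw; elim=> [|h' u' _ IH|h' u' _ IH]; first by rewrite mul1g mcomp1.
  by rewrite -mulgA mcompA; constructor.
by rewrite -mulgA mcompA; constructor.
Qed.

Lemma walk_hexagon : walk a rot_hexagon.
Proof. by rewrite -[a]mulg1 -[rot_hexagon]m1comp; constructor; constructor. Qed.

Lemma walk_corner : walk b rot_corner.
Proof. by rewrite -[b]mulg1 -[rot_corner]m1comp; constructor; constructor. Qed.

Lemma walk_iter g w n : walk g w -> walk (g ^+ n) (iter n (mcomp w) mone).
Proof.
by move=> gw; elim: n => [|n IHn]; [constructor | rewrite expgSr; apply: walkM].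
Qed.

(** Powers of the hexagon rotation give all rotations about 0. A corner rotation combined with a
    rotation by 240 degrees about 0 has total angle 0, so it is a translation by a unit vector; its
    conjugates are the six unit translations, which generate all others. *)
Lemma walk_total w : exists g, walk g w.
Proof.
pose total u := exists g, walk g u.
have totalM u x : total u -> total x -> total (mcomp u x).
  by move=> [g gu] [h hx]; exists (h * g); apply: walkM.
have rot (k : 'Z_6) : total (k, 0%R).
  exists (a ^+ k).
  suff <- : iter k (mcomp rot_hexagon) mone = (k, 0%R) by exact/walk_iter/walk_hexagon.
  have e n : iter n (mcomp rot_hexagon) mone = (n%:R, 0)%R.
    by elim: n => // n /= ->; rewrite /mcomp /= rotz_0 addr0 -mulrS.
  by rewrite e natr_Zp.
have tr k : total (0, rotz k (1, 0))%R.
  have -> : (0, rotz k (1, 0))%R =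
      mcomp (mcomp (k, 0%R) (mcomp rot_corner (4, 0)%R)) ((- k)%R, 0%R).
    rewrite /mcomp /= !rotz_0; congr pair; last by rewrite !addr0 !add0r.
    by rewrite (_ : 2 + 4 = 0 :> 'Z_6)%R ?addr0 ?subrr //; apply: val_inj.
  apply: (totalM _ _); last exact: rot.
  apply: (totalM _ _); first exact: rot.
  apply: (totalM _ _); last exact: rot.
  by exists b; apply: walk_corner.
have trD z t : total (0, z)%R -> total (0, t)%R -> total (0, z + t)%R.
  move=> tz tt; have -> : (0, z + t)%R = mcomp (0, t)%R (0, z)%R.
    by rewrite /mcomp /= addr0 rotz0.
  exact: totalM.
have trX (n : nat) k : total (0, rotz k (1, 0) *+ n)%R.
  by elim: n => [|n IHn]; [exists 1; constructor | rewrite mulrS; apply: trD].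
have all_tr t : total (0, t)%R.
  have trz (i : int) k : total (0, rotz k (1, 0) *~ i)%R.
    case: i => n; first exact: trX.
    (* A half-turn changes the sign, so negative multiples need no inverse of a walk. *)
    have := trX n.+1 (k + 3)%R; rewrite rotzD.
    have -> : (rotz 3 (1, 0) = - (1, 0))%R by [].
    by rewrite rotzN mulNrn NegzE mulrNz.
  have -> : t = (rotz 0 (1, 0) *~ t.1 + rotz 1 (1, 0) *~ t.2)%R.
    case: t => x y; rewrite rotz0 (_ : rotz 1%R _ = (0, 1)%R) // !pointMz !mul1r !mul0r.
    by rewrite [RHS]pointE /= addr0 add0r.
  exact: trD.
rewrite (_ : w = mcomp (0%R, w.2) (w.1, 0%R)); first exact: totalM.
by case: w => k t; rewrite /mcomp /= add0r rotz0 add0r.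
Qed.

Lemma walk_gen g w : walk g w -> g \in <<[set a; b]>>.
Proof.
elim=> [|h u _ IH|h u _ IH]; rewrite ?group1 // groupM // mem_gen // !inE eqxx ?orbT //.
Qed.

Lemma gen_walk g : g \in <<[set a; b]>> -> exists w, walk g w.
Proof.
case/gen_prodgP => n [c cab ->]; elim: n c cab => [|n IHn] c cab.
  by rewrite big_ord0; exists mone; constructor.
rewrite big_ord_recl; have [w hw] := IHn (fun i => c (lift ord0 i)) (fun i => cab _).
have /set2P[->|->] := cab ord0; first by exists (mcomp w rot_hexagon); constructor.
by exists (mcomp w rot_corner); constructor.
Qed.

(** Describes the kernel of the map from rotations of the tessellation onto [<<[set a; b]>>] without
    presupposing that this map is well defined; that follows in [walk_fun]. *)
Definition exact_walks (v : point) : Prop :=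
  forall g w, walk g w -> (g = 1 <-> w.1 = 0%R /\ lattice v w.2).

Variable v : point.
Hypothesis exact : exact_walks v.

Lemma exact_hexagon6 : a ^+ 6 = 1.
Proof.
apply/(exact (walk_iter 6 walk_hexagon)); split; first exact: val_inj.
by rewrite (_ : (iter _ _ _).2 = 0%R) //; apply: lattice_0.
Qed.

Lemma exact_corner3 : b ^+ 3 = 1.
Proof.
apply/(exact (walk_iter 3 walk_corner)); split; first exact: val_inj.
by rewrite (_ : (iter _ _ _).2 = 0%R) //; apply: lattice_0.
Qed.

(** Walks are words in positive powers only. Inverses are reached because exactness forces
    [a ^+ 6 = 1] and [b ^+ 3 = 1]. *)
Lemma walkV g w : walk g w -> walk g^-1 (minv w).
Proof.
elim=> [|h u _ IH|h u _ IH].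
- by rewrite invg1 (_ : minv mone = mone); [constructor | rewrite /minv /= oppr0 rotz0 oppr0].
- rewrite invMg minvM; apply: walkM => //.
  have -> : a^-1 = a ^+ 5 by apply/eqP; rewrite eq_invg_mul -expgS exact_hexagon6.
  by have := walk_iter 5 walk_hexagon; congr walk; congr pair; apply: val_inj.
- rewrite invMg minvM; apply: walkM => //.
  have -> : b^-1 = b ^+ 2 by apply/eqP; rewrite eq_invg_mul -expgS exact_corner3.
  by have := walk_iter 2 walk_corner; congr walk; congr pair; apply: val_inj.
Qed.

Lemma walk_fun g h w u : walk g w -> walk h u ->
  (g = h <-> w.1 = u.1 /\ lattice v (u.2 - w.2)%R).
Proof.
move=> gw hu; have := exact (walkM hu (walkV gw)).
rewrite /mcomp /minv /= => e; split.
  move=> ghE; have /e[e1 e2] : g^-1 * h = 1 by rewrite ghE mulVg.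
  have wu : w.1 = u.1 by apply/eqP; rewrite eq_sym -subr_eq0; apply/eqP.
  by split=> //; move: e2; rewrite wu rotzN -rotzD subrr rotz0 addrC.
move=> [wu l]; suff: g^-1 * h = 1 by move/eqP; rewrite -eq_invg_mul invgK => /eqP.
apply/e; rewrite wu subrr; split=> //.
by rewrite rotzN -rotzD subrr rotz0 addrC.
Qed.

End Walks.

(** * Base flags of the two tessellations and their stabilizers *)

Section TessellationFaces.
Import GRing.Theory.
Local Open Scope ring_scope.
Implicit Types (c : nat) (w u : motion) (z t : point).

(* Motions act on coordinates multiplied by c. *)
Definition mapply c w z : point := rotz w.1 z + w.2 *+ c.

Lemma mapply_comp c w u z : mapply c (mcomp w u) z = mapply c w (mapply c u z).
Proof. by rewrite /mapply /mcomp /= rotz_additive mulrnDl rotzD rotzMn addrA. Qed.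

Lemma mapply1 c z : mapply c mone z = z.
Proof. by rewrite /mapply rotz0 mul0rn addr0. Qed.

(* Vertices of the faces of a base flag; level r is stabilized by the rotations
   in [stabilizer r]. *)
Definition hex_base (r : nat) : seq point :=
  match r with
  | 1 => [:: (1, 1)]
  | 2 => [:: (1, 1); (2, -1)]
  | _ => [:: (1, 1); (-1, 2); (-2, 1); (-1, -1); (1, -2); (2, -1)]
  end.

Definition tri_base (r : nat) : seq point :=
  match r with
  | 1 => [:: 0; (1, 0); (0, 1)]
  | 2 => [:: 0; (1, 0)]
  | _ => [:: 0]
  end.

Definition stabilizer (r : nat) : seq motion :=
  match r with
  | 1 => [:: mone; rot_corner; (4, (0, 1))]
  | 2 => [:: mone; (3, (1, 0))]
  | _ => [:: (0, 0); (1, 0); (2, 0); (3, 0); (4, 0); (5, 0)]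
  end.

Definition small_motions : seq motion :=
  [seq (k, z) | k <- [:: 0; 1; 2; 3; 4; 5],
                z <- [seq (x, y) | x <- [:: -2; -1; 0; 1; 2], y <- [:: -2; -1; 0; 1; 2]]].

Lemma stabilizer_base r w : w \in stabilizer r ->
  all (fun z => mapply 3 w z \in hex_base r) (hex_base r) &&
  all (fun z => mapply 1 w z \in tri_base r) (tri_base r).
Proof.
move: w; apply/allP; case: r => [|[|[|r]]]; by vm_compute.
Qed.

Lemma stabilizerV r w : w \in stabilizer r -> minv w \in stabilizer r.
Proof. by move: w; apply/allP; case: r => [|[|[|r]]]; vm_compute. Qed.

(** One base vertex landing on a base face bounds the translation part, so questions of incidence
    reduce to the 150 motions in [small_motions]. *)
Lemma mapply_small c (bs bs' : seq point) w : 
  (c == 3%N) && (bs \in [:: hex_base 1; hex_base 2; hex_base 3]) &&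
  (bs' \in [:: hex_base 1; hex_base 2; hex_base 3]) ||
  (c == 1%N) && (bs \in [:: tri_base 1; tri_base 2; tri_base 3]) &&
  (bs' \in [:: tri_base 1; tri_base 2; tri_base 3]) ->
  mapply c w (head 0 bs) \in bs' -> w \in small_motions.
Proof.
case: w => k [x y] h zb.
have : (-2 <= x <= 2) && (-2 <= y <= 2).
  case/orP: h zb => /andP[/andP[/eqP-> bs3] bs3'] zb.
    have e : head 0 bs = (1, 1) by move: bs3; rewrite !inE => /or3P[] /eqP->.
    have sb : mapply 3 (k, (x, y)) (1, 1) \in hex_base 3.
      rewrite -e; move: bs3' zb; rewrite 3!inE => /or3P[] /eqP-> //.
        by rewrite !inE => ->.
      by rewrite !inE => /orP[] ->; rewrite ?orbT.
    move: sb; rewrite /mapply /rotz !inE; move: k {zb}; apply: Z6_case;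
      rewrite /= -![_ == _ :> point]/(_ && _) /=; lia.
  have e : head 0 bs = 0 by move: bs3; rewrite !inE => /or3P[] /eqP->.
  have sb : mapply 1 (k, (x, y)) 0 \in tri_base 1.
    rewrite -e; move: bs3' zb; rewrite 3!inE => /or3P[] /eqP-> //.
      by rewrite !inE => /orP[] ->; rewrite ?orbT.
    by rewrite !inE => ->.
  move: sb; rewrite /mapply /rotz !inE; move: k {zb}; apply: Z6_case;
      rewrite /= -![_ == _ :> point]/(_ && _) /=; lia.
have b5 (i : int) : -2 <= i <= 2 -> i \in ([:: -2; -1; 0; 1; 2] : seq int).
  by rewrite !inE; lia.
move=> /andP[/b5 xb /b5 yb]; apply/allpairsP; exists (k, (x, y)); split=> //.
  by move: k {zb}; apply: Z6_case.
by apply/allpairsP; exists (x, y).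
Qed.

(** The factorization says that a coset of one stabilizer meets the other stabilizer, which is the
    incidence rule of coset geometries. After the reduction to small motions it is a finite
    computation. *)
Lemma hex_incidence r r' w : (0 < r < 4)%N -> (0 < r' < 4)%N ->
  all (fun z => mapply 3 w z \in hex_base r') (hex_base r) ->
  (r <= r')%N /\ exists u x, [/\ u \in stabilizer r', x \in stabilizer r & w = mcomp u x].
Proof.
move=> hr hr' inc.
have ws : w \in small_motions.
  apply: (@mapply_small 3 (hex_base r) (hex_base r')).
    by move: hr hr' {inc}; case: r => [|[|[|[|]]]] //; case: r' => [|[|[|[|]]]].
  by move: hr inc; case: r => [|[|[|[|]]]] //= _ /andP[].
suff /andP[-> /hasP[u us /hasP[x xs /eqP->]]] :
  (r <= r')%N && has (fun u => has (fun x => w == mcomp u x) (stabilizer r)) (stabilizer r').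
  by split=> //; exists u, x.
move: w ws inc.
pose p w := all (fun z => mapply 3 w z \in hex_base r') (hex_base r) ==>
  ((r <= r')%N && has (fun u => has (fun x => w == mcomp u x) (stabilizer r)) (stabilizer r')).
suff /allP h : all p small_motions by move=> w /h/implyP.
by rewrite /p; move: hr hr'; case: r {p} => [|[|[|[|]]]] //; case: r' => [|[|[|[|]]]] //; vm_compute.
Qed.

(** Levels of the triangular tessellation run from triangles (1) to vertices (3), dually to the
    hexagonal one. Hence the same stabilizers serve, and inclusion is reversed. *)
Lemma tri_incidence r r' w : (0 < r < 4)%N -> (0 < r' < 4)%N ->
  all (fun z => mapply 1 w z \in tri_base r) (tri_base r') ->
  (r <= r')%N /\ exists u x, [/\ u \in stabilizer r, x \in stabilizer r' & w = mcomp u x].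
Proof.
move=> hr hr' inc.
have ws : w \in small_motions.
  apply: (@mapply_small 1 (tri_base r') (tri_base r)).
    by move: hr hr' {inc}; case: r => [|[|[|[|]]]] //; case: r' => [|[|[|[|]]]].
  by move: hr' inc; case: r' => [|[|[|[|]]]] //= _ /andP[].
suff /andP[-> /hasP[u us /hasP[x xs /eqP->]]] :
  (r <= r')%N && has (fun u => has (fun x => w == mcomp u x) (stabilizer r')) (stabilizer r).
  by split=> //; exists u, x.
move: w ws inc.
pose p w := all (fun z => mapply 1 w z \in tri_base r) (tri_base r') ==>
  ((r <= r')%N && has (fun u => has (fun x => w == mcomp u x) (stabilizer r')) (stabilizer r)).
suff /allP h : all p small_motions by move=> w /h/implyP.
by rewrite /p; move: hr hr'; case: r {p} => [|[|[|[|]]]] //; case: r' => [|[|[|[|]]]] //; vm_compute.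
Qed.

End TessellationFaces.

Section Dihedral.
Local Open Scope group_scope.
Variables (gT : finGroupType) (x y : gT).
Hypotheses (x2 : x * x = 1) (xy2 : x * y * (x * y) = 1).

(** Since [x] and [x * y] square to 1, [x] inverts [y]. *)
Lemma dihedral_conj h : h \in <[y]> -> x * h * x \in <[y]>.
Proof.
have xV : x^-1 = x by apply/eqP; rewrite eq_invg_mul x2.
case/cycleP => n ->; suff -> : x * y ^+ n * x = y^-1 ^+ n by rewrite groupX // groupV cycle_id.
have <- : y ^ x = y^-1.
  have : x * (y * x) * y = 1 by rewrite -xy2 !mulgA.
  by move/(canRL (mulgK y)); rewrite mul1g conjgE xV.
by rewrite -conjXg conjgE xV mulgA.
Qed.

Lemma dihedral_mem g : g \in <<[set x; y]>> -> g \in <[y]> \/ g * x \in <[y]>.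
Proof.
case/gen_prodgP => n [c cxy ->]; elim: n c cxy => [|n IHn] c cxy.
  by rewrite big_ord0; left; apply: group1.
rewrite big_ord_recl; have := IHn (fun i => c (lift ord0 i)) (fun i => cxy _).
move: (\prod_(i < n) _) => h; have /set2P[->|->] := cxy ord0 => -[] hy.
- by right; rewrite dihedral_conj.
- by left; have := dihedral_conj hy; rewrite -!mulgA x2 mulg1.
- by left; rewrite groupM ?cycle_id.
- by right; rewrite -mulgA groupM ?cycle_id.
Qed.

End Dihedral.

Lemma mem_cycle_sub (gT : finGroupType) (K : {group gT}) y g :
  (y \in K -> g \in <[y]> -> g \in K)%g.
Proof. by rewrite -cycle_subG => /subsetP; apply. Qed.

(** * Coset geometries *)

(* Rotational generators of a rank 4 geometry; only the relations that make
   incidence transitive are recorded. *)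
Record rotary := Rotary {
  rot_type : finGroupType;
  ra : rot_type; rb : rot_type; rc : rot_type;
  rotary_ab : (ra * rb * (ra * rb) = 1)%g;
  rotary_bc : (rb * rc * (rb * rc) = 1)%g;
  rotary_abc : (ra * rb * rc * (ra * rb * rc) = 1)%g }.

Section CosetGeometry.
Local Open Scope group_scope.
Variable D : rotary.
Local Notation gT := (rot_type D).
Local Notation a := (ra D).
Local Notation b := (rb D).
Local Notation c := (rc D).

(* Faces of rank r are right cosets of [cgroup r.+1]; the two improper faces
   are the whole group. *)
Definition cgroup (i : nat) : {group gT} :=
  match i with
  | 1 => generated_group [set b; c]
  | 2 => generated_group [set a * b; c]
  | 3 => generated_group [set b * c; a]
  | 4 => generated_group [set a; b]
  | _ => generated_group [set a; b; c]
  end.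

Record cface := CFace {
  cface_val : 'I_6 * {set gT};
  _ : cface_val.2 \in rcosets (cgroup cface_val.1) (cgroup 0) }.

HB.instance Definition _ := [isSub for cface_val].
HB.instance Definition _ := [Finite of cface by <:].

Definition cindex (x : cface) : nat := (val x).1.
Definition cbody (x : cface) : {set gT} := (val x).2.
Definition cle (x y : cface) : bool := (cindex x <= cindex y)%N && (cbody x :&: cbody y != set0).

Local Notation G := (cgroup 0).
Local Notation H := cgroup.

Lemma mem_abc : [/\ a \in G, b \in G & c \in G].
Proof. by rewrite !mem_gen // !inE eqxx ?orbT. Qed.

Lemma bG : b \in G. Proof. by case: mem_abc. Qed.
Lemma cG : c \in G. Proof. by case: mem_abc. Qed.

Lemma b_H1 : b \in H 1. Proof. by rewrite mem_gen // !inE eqxx. Qed.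
Lemma c_H1 : c \in H 1. Proof. by rewrite mem_gen // !inE eqxx orbT. Qed.
Lemma ab_H2 : a * b \in H 2. Proof. by rewrite mem_gen // !inE eqxx. Qed.
Lemma c_H2 : c \in H 2. Proof. by rewrite mem_gen // !inE eqxx orbT. Qed.
Lemma bc_H3 : b * c \in H 3. Proof. by rewrite mem_gen // !inE eqxx. Qed.
Lemma a_H3 : a \in H 3. Proof. by rewrite mem_gen // !inE eqxx orbT. Qed.
Lemma a_H4 : a \in H 4. Proof. by rewrite mem_gen // !inE eqxx. Qed.
Lemma b_H4 : b \in H 4. Proof. by rewrite mem_gen // !inE eqxx orbT. Qed.

Lemma cgroup_sub i : H i \subset G.
Proof.
have [Ga Gb Gc] := mem_abc.
case: i => [|[|[|[|[|i]]]]] //=; rewrite gen_subG; apply/subsetP => x /set2P[] ->;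
  by rewrite ?groupM.
Qed.

Lemma abV : (a * b)^-1 = a * b.
Proof. by apply/eqP; rewrite eq_invg_mul (rotary_ab D). Qed.

Lemma bcV : (b * c)^-1 = b * c.
Proof. by apply/eqP; rewrite eq_invg_mul (rotary_bc D). Qed.

Lemma abcV : (a * b * c)^-1 = a * b * c.
Proof. by apply/eqP; rewrite eq_invg_mul (rotary_abc D). Qed.

Lemma abc_c : a * b * c = c^-1 * (a * b).
Proof. by rewrite -abcV invMg abV. Qed.

Lemma bc_a : b * c * a = a^-1 * (b * c).
Proof. by apply: (mulgI a); rewrite !mulgA mulgV mul1g -{1}abcV !invMg -mulgA mulgKV -invMg bcV. Qed.

Lemma bca2 : b * c * a * (b * c * a) = 1.
Proof.
have -> : b * c * a * (b * c * a) = a^-1 * (b * c * (b * c)) * a by rewrite {1}bc_a !mulgA.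
by rewrite (rotary_bc D) mulg1 mulVg.
Qed.

Lemma H2P g : g \in H 2 -> g \in <[c]> \/ g * (a * b) \in <[c]>.
Proof. by apply: dihedral_mem; [apply: rotary_ab | apply: rotary_abc]. Qed.

Lemma H3P g : g \in H 3 -> g \in <[a]> \/ g * (b * c) \in <[a]>.
Proof. by apply: dihedral_mem; [apply: rotary_bc | apply: bca2]. Qed.

Lemma H2_left g : g \in H 2 -> exists u v, [/\ u \in <[c]>, v = 1 \/ v = a * b & g = u * v].
Proof.
case/H2P => h; first by exists g, 1; rewrite mulg1; split=> //; left.
exists (g * (a * b)), (a * b); split; [by [] | by right |].
by rewrite -mulgA rotary_ab mulg1.
Qed.

Lemma H3_left g : g \in H 3 -> exists u v, [/\ u \in <[a]>, v = 1 \/ v = b * c & g = u * v].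
Proof.
case/H3P => h; first by exists g, 1; rewrite mulg1; split=> //; left.
exists (g * (b * c)), (b * c); split; [by [] | by right |].
by rewrite -mulgA rotary_bc mulg1.
Qed.

Lemma H3_right g : g \in H 3 -> exists u v, [/\ v \in <[a]>, u = 1 \/ u = b * c & g = u * v].
Proof.
rewrite -groupV => /H3_left[u [v [ua hv e]]]; exists v, u^-1; rewrite groupV; split=> //.
by rewrite -[g]invgK e invMg; case: hv => ->; rewrite ?invg1 ?bcV.
Qed.

(** [H 2] and [H 3] are dihedral, so their elements are powers of [c], respectively [a], up to one
    involution, which can be shifted to the side where it is wanted. The resulting factorization is
    what makes incidence of cosets transitive. *)
Lemma cgroup_factor i j k g : (i < j < k)%N -> (k < 6)%N -> g \in H j ->
  exists u v, [/\ u \in H i, u \in H j, v \in H j, v \in H k & g = u * v].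
Proof.
move=> /andP[ij jk] k6 gj; have gG : g \in G := subsetP (cgroup_sub j) _ gj.
case: i ij => [|i] ij; first by exists g, 1; rewrite !group1 mulg1; split.
have [k5|k4] := eqVneq k 5; first by exists 1, g; rewrite !group1 mul1g k5; split.
have {}k4 : (k < 5)%N by rewrite ltn_neqAle k4 -ltnS.
case: i j k ij jk k4 gj {k6} => [|[|[|i]]] [|[|[|[|j]]]] [|[|[|[|[|k]]]]] // _ _ _ gj.
- have [u [v [uc hv ->]]] := H2_left gj.
  have [u1 u2] := (mem_cycle_sub c_H1 uc, mem_cycle_sub c_H2 uc).
  case: hv => ->; first by exists u, 1; rewrite !group1.
  (* Inserting [c] moves the involution into [H 3]: [c^-1 * (a * b)] equals [a * b * c]. *)
  exists (u * c), (c^-1 * (a * b)); split.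
  - by rewrite groupM ?c_H1.
  - by rewrite groupM ?c_H2.
  - by rewrite (groupM (groupVr c_H2) ab_H2).
  - by rewrite -abc_c -mulgA (groupM a_H3 bc_H3).
  - by rewrite [RHS]mulgA mulgK.
- have [u [v [uc hv ->]]] := H2_left gj.
  have [u1 u2] := (mem_cycle_sub c_H1 uc, mem_cycle_sub c_H2 uc).
  by case: hv => ->; exists u; [exists 1 | exists (a * b)];
    rewrite ?group1 ?ab_H2 ?(groupM a_H4 b_H4).
- have [u [v [va hu ->]]] := H3_right gj.
  have [v1 v2] := (mem_cycle_sub a_H3 va, mem_cycle_sub a_H4 va).
  by case: hu => ->; [exists 1 | exists (b * c)]; exists v;
    rewrite ?group1 ?bc_H3 ?(groupM b_H1 c_H1).
- have [u [v [va hu ->]]] := H3_right gj.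
  have [v1 v2] := (mem_cycle_sub a_H3 va, mem_cycle_sub a_H4 va).
  case: hu => ->; first by exists 1, v; rewrite !group1.
  (* Dually, [a] is inserted, using that [a * (b * c) * a] equals [b * c]. *)
  exists (a * (b * c)), (a * v); split.
  - by rewrite mulgA (groupM ab_H2 c_H2).
  - by rewrite (groupM a_H3 bc_H3).
  - by rewrite groupM ?a_H3.
  - by rewrite groupM ?a_H4.
  - by rewrite !mulgA -(mulgA a b c) -(mulgA a _ a) bc_a !mulgA mulgV mul1g.
Qed.

Lemma index_lt x : (cindex x < 6)%N. Proof. exact: ltn_ord. Qed.

Lemma bodyP x : exists2 g, g \in G & cbody x = H (cindex x) :* g.
Proof. by have /rcosetsP := valP x. Qed.

Lemma body_mem x g : g \in cbody x -> g \in G /\ cbody x = H (cindex x) :* g.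
Proof.
have [h hG ->] := bodyP x => gx; split; last exact/esym/rcoset_eqP.
by move: gx; rewrite mem_rcoset => /(subsetP (cgroup_sub _)); rewrite groupMr // groupV.
Qed.

Lemma cface_eq x y : cindex x = cindex y -> cbody x = cbody y -> x = y.
Proof.
move=> ei eb; apply: val_inj; move: ei eb; rewrite /cindex /cbody.
by case: (val x) (val y) => [i A] [j B] /= /val_inj -> ->.
Qed.

Lemma cle_refl : reflexive cle.
Proof.
move=> x; rewrite /cle leqnn setIid; have [g _ ->] := bodyP x.
by apply/set0Pn; exists g; apply: rcoset_refl.
Qed.

Lemma body_meet x y g : cindex x = cindex y -> g \in cbody x -> g \in cbody y -> x = y.
Proof.
move=> ei /body_mem[_ ex] /body_mem[_ ey].
by apply: cface_eq => //; rewrite ex ey ei.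
Qed.

Lemma cle_anti : antisymmetric cle.
Proof.
move=> x y /andP[/andP[lxy /set0Pn[g /setIP[gx gy]]] /andP[lyx _]].
by apply: (body_meet _ gx gy); apply/eqP; rewrite eqn_leq lxy.
Qed.

(** Factoring the quotient of the two common elements inside [H (cindex y)] replaces them by a
    single element lying in all three cosets. *)
Lemma cle_between x y z : (cindex x < cindex y < cindex z)%N -> cle x y -> cle y z ->
  exists g, [/\ g \in cbody x, g \in cbody y & g \in cbody z].
Proof.
move=> lt3 /andP[_ /set0Pn[g /setIP[gx gy]]] /andP[_ /set0Pn[h /setIP[hy hz]]].
have [gG ex] := body_mem gx; have [_ ey] := body_mem gy.
have [hG ez] := body_mem hz.
have ghy : g * h^-1 \in H (cindex y).
  by rewrite -mem_rcoset; have [_ <-] := body_mem hy.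
have [u [v [ui uj vj vk e]]] := cgroup_factor lt3 (index_lt z) ghy.
have e' : u^-1 * g = v * h by rewrite -[g](mulgKV h) e mulgA mulKg.
exists (u^-1 * g); split.
- by rewrite ex mem_rcoset mulgK groupV.
- by rewrite ey mem_rcoset mulgK groupV.
- by rewrite e' ez mem_rcoset mulgK.
Qed.

Lemma cle_trans : transitive cle.
Proof.
move=> y x z xy yz; have [lxy lyz] : (cindex x <= cindex y /\ cindex y <= cindex z)%N.
  by case/andP: xy => -> _; case/andP: yz.
have exy : cindex x = cindex y -> x = y.
  by case/andP: xy => _ /set0Pn[g /setIP[gx gy]] e; apply: body_meet gx gy.
have eyz : cindex y = cindex z -> y = z.
  by case/andP: yz => _ /set0Pn[g /setIP[gx gy]] e; apply: body_meet gx gy.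
move: lxy; rewrite leq_eqVlt => /predU1P[/exy->//|lxy].
move: lyz; rewrite leq_eqVlt => /predU1P[/eyz<-//|lyz].
have [|g [gx gy gz]] := cle_between _ xy yz; first by rewrite lxy.
rewrite /cle (ltnW (ltn_trans lxy lyz)); apply/set0Pn; exists g; exact/setIP.
Qed.

Fact coset_display : Order.disp_t. Proof. exact: (Order.Disp tt tt). Qed.

HB.instance Definition _ :=
  Order.Le_isPOrder.Build coset_display cface cle_refl cle_anti cle_trans.

Fact cbot_proof : (ord0 : 'I_6, G : {set gT}).2 \in rcosets (cgroup (ord0 : 'I_6)) G.
Proof. by apply/rcosetsP; exists 1; rewrite ?group1 // rcoset1. Qed.

Fact ctop_proof : (ord_max : 'I_6, G : {set gT}).2 \in rcosets (cgroup (ord_max : 'I_6)) G.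
Proof. by apply/rcosetsP; exists 1; rewrite ?group1 // rcoset1. Qed.

Definition cbot : cface := @CFace (ord0, G : {set gT}) cbot_proof.
Definition ctop : cface := @CFace (ord_max, G : {set gT}) ctop_proof.

Lemma cbot_le x : (cbot <= x)%O.
Proof.
have [g gG e] := bodyP x; apply/andP; split=> //; apply/set0Pn; exists g.
by rewrite inE e rcoset_refl andbT.
Qed.

Lemma ctop_ge x : (x <= ctop)%O.
Proof.
have [g gG e] := bodyP x; apply/andP; split; first by rewrite -ltnS index_lt.
by apply/set0Pn; exists g; rewrite inE e rcoset_refl.
Qed.

HB.instance Definition _ := Order.hasBottom.Build coset_display cface cbot_le.
HB.instance Definition _ := Order.hasTop.Build coset_display cface ctop_ge.

(** The default [cbot] is a junk value; the face is meant for [i < 6] and [g] in [G]. *)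
Definition mkface (i : nat) (g : gT) : cface :=
  insubd cbot ((inord i : 'I_6), H i :* g).

Lemma mkfaceE i g : (i < 6)%N -> g \in G ->
  cindex (mkface i g) = i /\ cbody (mkface i g) = H i :* g.
Proof.
move=> li gG; have e : val (mkface i g) = (inord i, H i :* g).
  by rewrite insubdK // /in_mem /= inordK //; apply/rcosetsP; exists g.
by rewrite /cindex /cbody e /= inordK.
Qed.

Lemma index_mkface i g : (i < 6)%N -> g \in G -> cindex (mkface i g) = i.
Proof. by move=> li /(mkfaceE li)[]. Qed.

Lemma body_mkface i g : (i < 6)%N -> g \in G -> cbody (mkface i g) = H i :* g.
Proof. by move=> li /(mkfaceE li)[]. Qed.

Lemma cfaceE (x : cface) g : g \in cbody x -> x = mkface (cindex x) g.
Proof.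
move=> /body_mem[gG e]; have li := index_lt x.
by apply: cface_eq; rewrite ?index_mkface ?body_mkface.
Qed.

Lemma cfaceP (x : cface) : exists2 g, g \in G & x = mkface (cindex x) g.
Proof.
by have [g gG e] := bodyP x; exists g; rewrite -?cfaceE // e rcoset_refl.
Qed.

Lemma mkface_eqP i g h : (i < 6)%N -> g \in G -> h \in G ->
  reflect (mkface i g = mkface i h) (g * h^-1 \in H i).
Proof.
move=> li gG hG; rewrite -mem_rcoset; apply: (iffP idP) => [/rcoset_eqP e|e].
  by apply: cface_eq; rewrite ?index_mkface ?body_mkface.
by rewrite -body_mkface // -e body_mkface // rcoset_refl.
Qed.

Lemma mkface_mul i u g : (i < 6)%N -> u \in H i -> g \in G -> mkface i (u * g) = mkface i g.
Proof.
move=> li ui gG; have uG := subsetP (cgroup_sub i) _ ui.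
by apply/mkface_eqP => //; rewrite ?mulgK // groupM.
Qed.

Lemma mkface_le i j g : (i <= j < 6)%N -> g \in G -> (mkface i g <= mkface j g)%O.
Proof.
move=> /andP[ij lj] gG; have li := leq_ltn_trans ij lj.
apply/andP; rewrite !index_mkface // !body_mkface //; split=> //.
by apply/set0Pn; exists g; rewrite inE !rcoset_refl.
Qed.

Lemma cleP (x y : cface) :
  reflect ((cindex x <= cindex y)%N /\ exists2 g, g \in cbody x & g \in cbody y) (x <= y)%O.
Proof.
apply: (iffP andP) => [[-> /set0Pn[g /setIP[gx gy]]]|[-> [g gx gy]]].
  by split=> //; exists g.
by split=> //; apply/set0Pn; exists g; apply/setIP.
Qed.

Lemma le_index_eq (x y : cface) : (x <= y)%O -> cindex x = cindex y -> x = y.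
Proof. by move=> /cleP[_ [g gx gy]] e; apply: body_meet gx gy. Qed.

Lemma lt_index (x y : cface) : (x < y)%O -> (cindex x < cindex y)%N.
Proof.
rewrite Order.POrderTheory.lt_neqAle => /andP[nxy xy]; rewrite ltn_neqAle.
have /cleP[-> _] := xy; rewrite andbT.
by apply: contra nxy => /eqP e; apply/eqP/le_index_eq.
Qed.

Lemma le_lt_index (x y : cface) : (x <= y)%O -> (cindex x < cindex y)%N -> (x < y)%O.
Proof.
move=> xy lt_xy; rewrite Order.POrderTheory.lt_neqAle xy andbT.
by apply: contraTneq lt_xy => ->; rewrite ltnn.
Qed.

Lemma comparable_index (x y : cface) : (x >=< y)%O -> (cindex x <= cindex y)%N -> (x <= y)%O.
Proof.
move=> /orP[//|yx] lxy; have /cleP[lyx _] := yx.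
by rewrite (le_index_eq yx) //; apply/eqP; rewrite eqn_leq lxy lyx.
Qed.

Lemma chain_index_inj (A : {set cface}) : chain A -> {in A &, injective cindex}.
Proof.
move=> /chainP cA x y xA yA e; apply: le_index_eq => //.
by apply: comparable_index; rewrite ?cA ?e.
Qed.

Lemma card_chain_index (A : {set cface}) n : chain A ->
  {in A, forall x, (cindex x < n)%N} -> (#|A| <= n)%N.
Proof.
move=> cA An; case: n An => [|n] An.
  by rewrite leqn0 cards_eq0; apply/set0Pn => -[x /An].
pose f x : 'I_n.+1 := inord (cindex x).
have fI : {in A &, injective f}.
  move=> x y xA yA /(congr1 val); rewrite /= !inordK ?An //.
  exact: (chain_index_inj cA).
by rewrite -(card_in_imset fI) -[X in (_ <= X)%N](card_ord n.+1) max_card.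
Qed.

Lemma height_index (x : cface) : height x = cindex x.
Proof.
apply/eqP; rewrite eqn_leq; apply/andP; split.
  have [A [cA Ax <-]] := height_witness x.
  by apply: card_chain_index => // y /Ax /lt_index.
have [g gG e] := cfaceP x; have lx := index_lt x.
pose A := [set mkface i g | i : 'I_(cindex x)].
have li (i : 'I_(cindex x)) : (i < 6)%N by apply: ltn_trans lx.
have cA : #|A| = cindex x.
  rewrite card_imset ?card_ord // => i j /(congr1 cindex).
  by rewrite !index_mkface // => /val_inj.
rewrite -[X in (X <= _)%N]cA; apply: height_ge.
  apply/chainP => _ _ /imsetP[i _ ->] /imsetP[j _ ->]; rewrite /Order.comparable.
  by case: (leqP i j) => ij; apply/orP; [left | right]; apply: mkface_le => //;
    rewrite ?ij ?(ltnW ij) /=.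
move=> _ /imsetP[i _ ->]; rewrite [X in (_ < X)%O]e; apply: le_lt_index.
  by rewrite mkface_le // lx ltnW.
by rewrite !index_mkface.
Qed.

(** If index i seems missing, the nearest faces of [A] below and above share an element [g]; then
    [mkface i g] is comparable with all of [A], and maximality puts it in [A]. *)
Lemma flag_has_index (A : {set cface}) i : flag A -> (i < 6)%N ->
  exists2 x, x \in A & cindex x = i.
Proof.
move=> fA li; have cA := flag_chain fA.
have [/exists_inP[x xA /eqP xi]|] := boolP [exists x in A, cindex x == i].
  by exists x.
move=> /exists_inPn no; have noA x : x \in A -> cindex x != i by apply: no.
have i0 : i != 0%N by have := noA _ (flag_bot fA); rewrite eq_sym.
have i5 : i != 5 by have := noA _ (flag_top fA); rewrite eq_sym.
have botA : (\bot%O \in A) && (cindex \bot%O < i)%N by rewrite flag_bot //= lt0n.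
have topA : (\top%O \in A) && (i < cindex \top%O)%N.
  by rewrite flag_top //= ltn_neqAle i5 -ltnS.
have [x /andP[xA xi] xmax] := arg_maxnP (P := fun x => (x \in A) && (cindex x < i)%N) cindex botA.
have [y /andP[yA yi] ymin] := arg_minnP (P := fun x => (x \in A) && (i < cindex x)%N) cindex topA.
have cmp z t : z \in A -> t \in A -> (cindex z <= cindex t)%N -> (z <= t)%O.
  by move=> zA tA; apply: comparable_index; apply: (chainP _ cA).
have xy : (x <= y)%O by rewrite cmp // ltnW // (ltn_trans xi).
have [_ [g gx gy]] := cleP _ _ xy; have [gG _] := body_mem gx.
pose z := mkface i g; have iz : cindex z = i by rewrite index_mkface.
have xz : (x <= z)%O by rewrite (cfaceE gx) mkface_le // (ltnW xi).
have zy : (z <= y)%O by rewrite (cfaceE gy) mkface_le // index_lt (ltnW yi).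
exists z => //; apply: flag_mem => // t tA; rewrite /Order.comparable.
have := noA _ tA; rewrite neq_ltn => /orP[ti|it].
  have tx := cmp _ _ tA xA (xmax t _); rewrite tA ti in tx.
  by rewrite (Order.POrderTheory.le_trans (tx isT) xz) orbT.
have yt := cmp _ _ yA tA (ymin t _); rewrite tA it in yt.
by rewrite (Order.POrderTheory.le_trans zy (yt isT)).
Qed.

Lemma card_flag6 (A : {set cface}) : flag A -> #|A| = 6.
Proof.
move=> fA; have cA := flag_chain fA; apply/eqP; rewrite eqn_leq; apply/andP; split.
  by apply: card_chain_index => // x _; apply: index_lt.
have h (i : 'I_6) : exists x, (x \in A) && (cindex x == i).
  by have [x xA <-] := flag_has_index fA (ltn_ord i); exists x; rewrite xA eqxx.
pose f i := xchoose (h i).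
have fP i : f i \in A /\ cindex (f i) = i by have /andP[-> /eqP->] := xchooseP (h i).
have fI : injective f.
  by move=> i j e; apply: val_inj; have [_ /= <-] := fP i; have [_ <-] := fP j; rewrite e.
rewrite -[X in (X <= _)%N](card_ord 6) -(card_imset _ fI).
by apply: subset_leq_card; apply/subsetP => _ /imsetP[i _ ->]; case: (fP i).
Qed.

Lemma chain6_flag (A : {set cface}) : chain A -> #|A| = 6 -> flag A.
Proof.
move=> cA A6; have [B fB sAB] := flag_sup cA.
suff -> : A = B by [].
by apply/eqP; rewrite eqEcard sAB (card_flag6 fB) A6.
Qed.

(* The base flag and its 2-adjacent flag, translated by g. Among the flags
   [cflag true _] the one that is (i-1)-adjacent to [cflag false g] is
   [cflag true (kappa i * g)]. *)
Definition eps (e : bool) (i : nat) : gT := if e && (i == 3) then b else 1.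
Definition kappa (i : nat) : gT :=
  match i with 1 => a * b | 2 => b^-1 | 3 => 1 | _ => c end.
Definition cflag (e : bool) (g : gT) : {set cface} :=
  [set mkface i (eps e i * g) | i : 'I_6].

Lemma eps_G e i : eps e i \in G.
Proof. by rewrite /eps; case: ifP; rewrite ?group1 ?bG. Qed.

Lemma kappa_G i : kappa i \in G.
Proof. by have [Ga Gb Gc] := mem_abc; case: i => [|[|[|[|i]]]] //=; rewrite ?group1 ?groupM ?groupV. Qed.

(** In terms of cosets: the even flag of [g] and the odd flag of [kappa i * g] share every face of
    index other than i. *)
Lemma eps_kappa i j : (0 < i < 5)%N -> i != j -> (j < 6)%N -> eps true j * kappa i \in H j.
Proof.
have [Ga Gb Gc] := mem_abc; have baba : b * (a * b) = a^-1 by rewrite -abV invMg mulKVg.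
case: i => [|[|[|[|[|i]]]]] //; case: j => [|[|[|[|[|[|j]]]]]] // _ _ _;
  rewrite /eps /= ?mul1g ?baba ?mulgV ?groupV;
  first [exact: group1 | exact: ab_H2 | exact: c_H1 | exact: c_H2 | exact: bc_H3
       | exact: b_H1 | exact: b_H4 | exact: a_H3 | exact: (groupM a_H4 b_H4)
       | exact: (groupM Ga Gb) | exact: Gb | exact: Gc].
Qed.

Lemma kappa_face i j g : (0 < i < 5)%N -> i != j -> (j < 6)%N -> g \in G ->
  mkface j (eps true j * (kappa i * g)) = mkface j g.
Proof. by move=> i5 ij j6 gG; rewrite mulgA mkface_mul // eps_kappa. Qed.

(** The order inside an even flag is evident. For two given levels of an odd flag some other proper
    level n remains, and away from n the odd flag coincides with an even one. *)
Lemma mkface_eps_le e i j g : (i <= j < 6)%N -> g \in G ->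
  (mkface i (eps e i * g) <= mkface j (eps e j * g))%O.
Proof.
move=> /andP[ij lj] gG; have li := leq_ltn_trans ij lj; have eG := eps_G.
case: e; last by rewrite /eps !mul1g mkface_le // ij.
have key (k l n : nat) : (0 < n < 5)%N -> n != k -> n != l -> (k <= l < 6)%N ->
    (mkface k (eps true k * g) <= mkface l (eps true l * g))%O.
  move=> n5 nk nl /andP[kl l6]; have k6 := leq_ltn_trans kl l6.
  have e k' : (k' < 6)%N -> n != k' -> mkface k' (eps true k' * g) = mkface k' ((kappa n)^-1 * g).
    have hG : (kappa n)^-1 * g \in G by rewrite groupM ?groupV ?kappa_G.
    by move=> k6' nk'; rewrite -(kappa_face n5 nk' k6' hG) mulKVg.
  by rewrite !e // mkface_le ?kl // groupM ?groupV ?kappa_G.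
have [n [n5 ni nj]] : exists n, [/\ (0 < n < 5)%N, n != i & n != j].
  have [h1|h1] := boolP ((i == 1%N) || (j == 1%N)); last by exists 1%N; split; lia.
  have [h2|h2] := boolP ((i == 2) || (j == 2)); last by exists 2; split; lia.
  by exists 3; split; lia.
by apply: (key i j n) => //; rewrite ij.
Qed.

Lemma cflag_face e g i : (i < 6)%N -> mkface i (eps e i * g) \in cflag e g.
Proof. by move=> li; apply/imsetP; exists (Ordinal li). Qed.

Lemma cflag_flag e g : g \in G -> flag (cflag e g).
Proof.
move=> gG; have eG i : eps e i * g \in G by rewrite groupM ?eps_G.
apply: chain6_flag.
  apply/chainP => _ _ /imsetP[i _ ->] /imsetP[j _ ->]; rewrite /Order.comparable.
  by case: (leqP i j) => ij; apply/orP; [left | right]; apply: mkface_eps_le => //;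
    rewrite ?ij ?(ltnW ij) /=.
by rewrite card_imset ?card_ord // => i j /(congr1 cindex); rewrite !index_mkface // => /val_inj.
Qed.

(** Fix [g] common to the faces of index 2 and 3. The dihedral groups [H 2] and [H 3] leave two
    choices for the face of index 1 and two for that of index 4. The four combinations are the even
    flag of [g], the odd flags of [c * g] and [a * b * g], and the even flag of [a * b * c * g]. *)
Lemma cflag_ex (A : {set cface}) : flag A -> exists e, exists2 g, g \in G & A = cflag e g.
Proof.
have [Ga Gb Gc] := mem_abc.
move=> fA; have cA := flag_chain fA.
have [x1 x1A i1] := flag_has_index fA (isT : 1 < 6)%N.
have [x2 x2A i2] := flag_has_index fA (isT : 2 < 6)%N.
have [x3 x3A i3] := flag_has_index fA (isT : 3 < 6)%N.
have [x4 x4A i4] := flag_has_index fA (isT : 4 < 6)%N.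
have cmp z t : z \in A -> t \in A -> (cindex z <= cindex t)%N -> (z <= t)%O.
  by move=> zA tA; apply: comparable_index; apply: (chainP _ cA).
have /cleP[_ [g g2 g3]] : (x2 <= x3)%O by rewrite cmp // i2 i3.
have /cleP[_ [h h1 h2]] : (x1 <= x2)%O by rewrite cmp // i1 i2.
have /cleP[_ [k k3 k4]] : (x3 <= x4)%O by rewrite cmp // i3 i4.
have [gG e2] := body_mem g2; have [_ e3] := body_mem g3.
have [hG _] := body_mem h1; have [kG _] := body_mem k4.
have {h2} h2 : h * g^-1 \in H 2 by rewrite -mem_rcoset -i2 -e2.
have {k3} k3 : k * g^-1 \in H 3 by rewrite -mem_rcoset -i3 -e3.
have E1 : x1 = mkface 1 g \/ x1 = mkface 1 (a * b * g).
  rewrite (cfaceE h1) i1; have [u [v [uc hv e]]] := H2_left h2.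
  have -> : h = u * (v * g) by rewrite mulgA -e mulgKV.
  have u1 : u \in H 1 by apply: mem_cycle_sub uc; apply: c_H1.
  case: hv => ->; rewrite mkface_mul ?mul1g ?groupM //; by [left | right].
have E4 : x4 = mkface 4 g \/ x4 = mkface 4 (c * g).
  rewrite (cfaceE k4) i4; have [u [v [ua hv e]]] := H3_left k3.
  have -> : k = u * (v * g) by rewrite mulgA -e mulgKV.
  have u4 : u \in H 4 by apply: mem_cycle_sub ua; apply: a_H4.
  case: hv => ->; rewrite mkface_mul ?mul1g ?groupM //; first by left.
  by right; rewrite -mulgA mkface_mul ?b_H4 ?groupM.
have E2 : x2 = mkface 2 g by rewrite (cfaceE g2) i2.
have E3 : x3 = mkface 3 g by rewrite (cfaceE g3) i3.
have eqA e h' : h' \in G -> x1 = mkface 1 (eps e 1 * h') -> x2 = mkface 2 (eps e 2 * h') ->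
    x3 = mkface 3 (eps e 3 * h') -> x4 = mkface 4 (eps e 4 * h') -> A = cflag e h'.
  move=> h'G f1 f2 f3 f4; have eG i : eps e i * h' \in G by rewrite groupM ?eps_G.
  apply/esym/eqP; rewrite eqEcard !card_flag6 ?cflag_flag // leqnn andbT.
  apply/subsetP => _ /imsetP[[i li] _ ->] /=.
  case: i li => [|[|[|[|[|[|//]]]]]] li; rewrite -?f1 -?f2 -?f3 -?f4 //.
    suff -> : mkface 0 (eps e 0 * h') = \bot%O by apply: flag_bot.
    apply/esym/le_index_eq; first exact: cbot_le.
    by rewrite index_mkface.
  suff -> : mkface 5 (eps e 5 * h') = \top%O by apply: flag_top.
  apply: le_index_eq; first exact: ctop_ge.
  by rewrite index_mkface.
move: E1 E4 => [] E1 [] E4.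
- exists false, g => //; apply: eqA => //; by rewrite /eps mul1g.
- exists true, (c * g); first by rewrite groupM.
  have kf j := @kappa_face 4 j g isT; apply: eqA; first by rewrite groupM.
  - exact: etrans E1 (esym (kf 1%N isT isT gG)).
  - exact: etrans E2 (esym (kf 2 isT isT gG)).
  - exact: etrans E3 (esym (kf 3 isT isT gG)).
  - by rewrite E4 [eps true 4 * _]mul1g.
- exists true, (a * b * g); first by rewrite !groupM.
  have kf j := @kappa_face 1 j g isT; apply: eqA; first by rewrite !groupM.
  - by rewrite E1 [eps true 1 * _]mul1g.
  - exact: etrans E2 (esym (kf 2 isT isT gG)).
  - exact: etrans E3 (esym (kf 3 isT isT gG)).
  - exact: etrans E4 (esym (kf 4 isT isT gG)).
- exists false, (a * b * c * g); first by rewrite !groupM.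
  have eG : a * b * c * g \in G by rewrite !groupM.
  apply: eqA => //; rewrite /eps mul1g.
  + by rewrite abc_c -(mulgA c^-1) mkface_mul ?groupV ?c_H1 ?groupM.
  + by rewrite mkface_mul // groupM ?ab_H2 ?c_H2.
  + by rewrite mkface_mul // -mulgA groupM ?a_H3 ?bc_H3.
  + by rewrite -(mulgA (a * b)) mkface_mul ?groupM ?a_H4 ?b_H4.
Qed.

End CosetGeometry.

(** * The polytope axioms for coset geometries *)

Section CosetPolytope.
Local Open Scope group_scope.
Variable D : rotary.
Local Notation gT := (rot_type D).
Local Notation a := (ra D).
Local Notation b := (rb D).
Local Notation c := (rc D).
Local Notation H := (cgroup D).
Local Notation G := (cgroup D 0).
Local Notation kappa := (kappa D).
Local Notation eps := (eps D).
Local Notation P := (cface D).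

(** A short list from which [cap_gen] derives all intersections of the face stabilizers. *)
Definition intersection_property : bool :=
  [&& H 1 :&: H 4 \subset <[b]>, <[a]> :&: <[b]> == 1, <[b]> :&: <[c]> == 1,
      a != 1, b != 1 & c != 1].

Hypothesis ip : intersection_property.

Let cap14 : H 1 :&: H 4 \subset <[b]>. Proof. by case/and5P: ip. Qed.
Let cap_ab : <[a]> :&: <[b]> = 1. Proof. by case/and5P: ip => _ /eqP. Qed.
Let cap_bc : <[b]> :&: <[c]> = 1. Proof. by case/and5P: ip => _ _ /eqP. Qed.
Let a_neq1 : a != 1. Proof. by case/and5P: ip. Qed.
Let b_neq1 : b != 1. Proof. by case/and5P: ip => _ _ _ _ /andP[]. Qed.
Let c_neq1 : c != 1. Proof. by case/and5P: ip => _ _ _ _ /andP[]. Qed.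

Lemma a_cap_H1 g : g \in <[a]> -> g \in H 1 -> g = 1.
Proof.
move=> ga g1; have g4 : g \in H 4 by apply: (mem_cycle_sub _ ga); apply: a_H4.
have gb : g \in <[b]> by apply: (subsetP cap14); rewrite inE g1.
by apply/set1P; rewrite -[[set 1]]cap_ab inE ga.
Qed.

Lemma c_cap_H4 g : g \in <[c]> -> g \in H 4 -> g = 1.
Proof.
move=> gc g4; have g1 : g \in H 1 by apply: (mem_cycle_sub _ gc); apply: c_H1.
have gb : g \in <[b]> by apply: (subsetP cap14); rewrite inE g1.
by apply/set1P; rewrite -[[set 1]]cap_bc inE gb.
Qed.

Lemma a_notin_H1 : a \notin H 1.
Proof. by apply: contraNN a_neq1 => /(a_cap_H1 (cycle_id a)) ->. Qed.

Lemma c_notin_H4 : c \notin H 4.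
Proof. by apply: contraNN c_neq1 => /(c_cap_H4 (cycle_id c)) ->. Qed.

Lemma b_notin_a : b \notin <[a]>.
Proof.
apply: contraNN b_neq1 => ba; apply/eqP/set1P.
by rewrite -[[set 1]]cap_ab inE ba cycle_id.
Qed.

Lemma b_notin_c : b \notin <[c]>.
Proof.
apply: contraNN b_neq1 => bc; apply/eqP/set1P.
by rewrite -[[set 1]]cap_bc inE bc cycle_id.
Qed.

Lemma cap_c_H3 x : x \in <[c]> -> x \in H 3 -> x = 1.
Proof.
move=> xc; have x1 : x \in H 1 by apply: (mem_cycle_sub _ xc); apply: c_H1.
case/H3P => xa; first exact: (a_cap_H1 xa).
have e : x * (b * c) = 1.
  by apply: a_cap_H1 => //; rewrite !groupM ?b_H1 ?c_H1.
have : b \in <[c]>.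
  rewrite -(groupMr _ (cycle_id c)) -groupV.
  suff -> : (b * c)^-1 = x by [].
  by apply/esym/eqP; rewrite eq_sym eq_invg_mul -[b * c](mulKg x) e mulg1 mulVg.
by move=> bc; have := b_notin_c; rewrite bc.
Qed.

(* All cases of the intersection property, with the generators
   [(kappa k)^-1 * kappa l] of the stabilizer of the faces of index in J. *)
Lemma cap_gen (J : pred nat) x : x \in G ->
  (forall i, (0 < i < 5)%N -> J i -> x \in H i) ->
  x \in <<[set (kappa kl.1)^-1 * kappa kl.2 | kl : 'I_5 * 'I_5
            & [&& (0 < kl.1)%N, ~~ J kl.1, (0 < kl.2)%N & ~~ J kl.2]]>>.
Proof.
move=> xG xH; set K := <<_>>.
have gens (k l : nat) : (0 < k < 5)%N -> (0 < l < 5)%N -> ~~ J k -> ~~ J l ->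
    (kappa k)^-1 * kappa l \in K.
  move=> /andP[k0 k5] /andP[l0 l5] Jk Jl; apply: mem_gen; apply/imsetP.
  by exists (Ordinal k5, Ordinal l5); rewrite // inE /= k0 l0 Jk.
have ga : ~~ J 1%N -> ~~ J 2 -> a \in K.
  by move=> J1 J2; have := gens 1%N 2 isT isT J1 J2; rewrite /= abV mulgK.
have gb : ~~ J 2 -> ~~ J 3 -> b \in K.
  by move=> J1 J2; have := gens 2 3 isT isT J1 J2; rewrite /= invgK mulg1.
have gc : ~~ J 3 -> ~~ J 4 -> c \in K.
  by move=> J1 J2; have := gens 3 4 isT isT J1 J2; rewrite /= invg1 mul1g.
have gab : ~~ J 1%N -> ~~ J 3 -> a * b \in K.
  by move=> J1 J2; have := gens 1%N 3 isT isT J1 J2; rewrite /= abV mulg1.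
have gbc : ~~ J 2 -> ~~ J 4 -> b * c \in K.
  by move=> J1 J2; have := gens 2 4 isT isT J1 J2; rewrite /= invgK.
have gabc : ~~ J 1%N -> ~~ J 4 -> a * b * c \in K.
  by move=> J1 J2; have := gens 1%N 4 isT isT J1 J2; rewrite /= abV.
have sub (S : {set gT}) : x \in <<S>> -> {in S, forall y, y \in K} -> x \in K.
  by move=> xS SK; apply: subsetP xS; rewrite gen_subG; apply/subsetP.
have cyc y : x \in <[y]> -> y \in K -> x \in K by move=> xy yK; apply: (mem_cycle_sub _ xy).
have x1 := xH 1%N isT; have x2 := xH 2 isT; have x3 := xH 3 isT; have x4 := xH 4 isT.
have one : x = 1 -> x \in K by move=> ->; apply: group1.
have h12 : x \in H 1 -> x \in H 2 -> x \in <[c]>.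
  move=> h1 /H2P[//|xc]; have : a * b \in H 1.
    by rewrite -(groupMl _ h1); apply: (mem_cycle_sub _ xc); apply: c_H1.
  by rewrite groupMr ?b_H1 // (negPf a_notin_H1).
have h34 : x \in H 3 -> x \in H 4 -> x \in <[a]>.
  move=> /H3P[//|xa] h4; have : b * c \in H 4.
    by rewrite -(groupMl _ h4); apply: (mem_cycle_sub _ xa); apply: a_H4.
  by rewrite groupMl ?b_H4 // (negPf c_notin_H4).
have h24 : x \in H 2 -> x \in H 4 -> x \in <[a * b]>.
  move=> /H2P[xc|xc] h4; first by rewrite (c_cap_H4 xc h4) group1.
  have e : x * (a * b) = 1 by apply: c_cap_H4 => //; rewrite !groupM ?a_H4 ?b_H4.
  suff -> : x = (a * b)^-1 by rewrite groupV cycle_id.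
  by rewrite -[x](mulgK (a * b)) e mul1g.
have h13 : x \in H 1 -> x \in H 3 -> x \in <[b * c]>.
  move=> h1 /H3P[xa|xa]; first by rewrite (a_cap_H1 xa h1) group1.
  have e : x * (b * c) = 1 by apply: a_cap_H1 => //; rewrite !groupM ?b_H1 ?c_H1.
  suff -> : x = (b * c)^-1 by rewrite groupV cycle_id.
  by rewrite -[x](mulgK (b * c)) e mul1g.
have h23 : x \in H 2 -> x \in H 3 -> x \in <[a * b * c]>.
  move=> h2 h3; have [xc|xc] := H2P h2; first by rewrite (cap_c_H3 xc h3) group1.
  have x1' : x * (a * b) \in H 1 by apply: (mem_cycle_sub _ xc); apply: c_H1.
  have [xa|xa] := H3P h3.
    have e : x * (a * b) = 1.
      by apply: c_cap_H4 => //; rewrite !groupM ?a_H4 ?b_H4 //; apply: (mem_cycle_sub _ xa); apply: a_H4.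
    have : b \in <[a]>.
      rewrite -(groupMl _ (cycle_id a)) -groupV; suff -> : (a * b)^-1 = x by [].
      by rewrite -[x](mulgK (a * b)) e mul1g.
    by rewrite (negPf b_notin_a).
  (* Since [a * (b * c) * a] equals [b * c], this element is also [x * (a * b) * c]; so it lies both
     in [<[a]>] and in [H 1]. *)
  have e : x * (b * c) * a^-1 = 1.
    apply: a_cap_H1; first by rewrite groupM // groupV cycle_id.
    suff -> : x * (b * c) * a^-1 = x * (a * b) * c by rewrite groupM ?c_H1.
    apply: (mulIg a); rewrite mulgKV.
    have -> : x * (a * b) * c * a = x * (a * (b * c * a)) by rewrite !mulgA.
    by rewrite bc_a mulKVg.
  suff -> : x = a * b * c by rewrite cycle_id.
  by rewrite -[x](mulgK (b * c)) -[x * _](mulgKV a) e mul1g bcV mulgA.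
have h234 : x \in <[a]> -> x \in H 2 -> x = 1.
  move=> xa h2; have h4 : x \in H 4 by apply: (mem_cycle_sub _ xa); apply: a_H4.
  have [xc|xc] := H2P h2; first exact: c_cap_H4.
  have e : x * (a * b) = 1 by apply: c_cap_H4 => //; rewrite !groupM ?a_H4 ?b_H4.
  have : b \in <[a]>.
    rewrite -(groupMl _ (cycle_id a)) -groupV; suff -> : (a * b)^-1 = x by [].
    by rewrite -[x](mulgK (a * b)) e mul1g.
  by rewrite (negPf b_notin_a).
have no (p : bool) (Q : Prop) : ~~ p -> p -> Q by case: p.
(* One bullet for each subset J of the four proper levels, from the full one to the empty one. *)
have [J1|J1] := boolP (J 1%N); have [J2|J2] := boolP (J 2);
have [J3|J3] := boolP (J 3); have [J4|J4] := boolP (J 4).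
- by apply/one/c_cap_H4; auto.
- by apply/one/cap_c_H3; auto.
- by apply/one/c_cap_H4; auto.
- by apply: (cyc c); auto.
- by apply/one/a_cap_H1; auto.
- by apply: (cyc (b * c)); auto.
- by apply: (cyc b); auto; apply: (subsetP cap14); rewrite inE x1 ?x4.
- by apply: (sub [set b; c]); [exact: x1 | move=> y /set2P[] ->; auto].
- by apply/one/h234; auto.
- by apply: (cyc (a * b * c)); auto.
- by apply: (cyc (a * b)); auto.
- by apply: (sub [set a * b; c]); [exact: x2 | move=> y /set2P[] ->; auto].
- by apply: (cyc a); auto.
- by apply: (sub [set b * c; a]); [exact: x3 | move=> y /set2P[] ->; auto].
- by apply: (sub [set a; b]); [exact: x4 | move=> y /set2P[] ->; auto].
- by apply: (sub [set a; b; c]) => // y; rewrite !inE => /orP[/orP[]|] /eqP->; auto.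
Qed.

(** When level i alone is left free, the generating set of [cap_gen] reduces to
    [(kappa i)^-1 * kappa i], which is 1. *)
Lemma cap_trivial i x : (0 < i < 5)%N -> x \in G ->
  (forall j, (0 < j < 5)%N -> j != i -> x \in H j) -> x = 1.
Proof.
move=> i5 xG xH; have := @cap_gen (fun j => j != i) x xG.
move=> /(_ _) /wrap[] => [j j5 ji|]; first exact: xH.
suff /subsetP h : <<[set (kappa kl.1)^-1 * kappa kl.2 | kl : 'I_5 * 'I_5
    & [&& (0 < kl.1)%N, ~~ (kl.1 != i :> nat), (0 < kl.2)%N & ~~ (kl.2 != i :> nat)]]>> \subset [1 gT].
  by move/h/set1P.
rewrite gen_subG; apply/subsetP => y /imsetP[[k l]].
rewrite inE /= !negbK => /and4P[_ /eqP-> _ /eqP->] ->.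
by rewrite mulVg set11.
Qed.

(** Complements [eps_kappa]: at level i the even and the odd flag do differ, so the adjacency is
    genuine. *)
Lemma eps_kappa_self i : (0 < i < 5)%N -> eps true i * kappa i \notin H i.
Proof.
case: i => [|[|[|[|[|i]]]]] // _; rewrite /eps /= ?mul1g ?mulg1.
- by rewrite groupMr ?b_H1 // a_notin_H1.
- apply/negP; rewrite groupV => /H2P[]; first by rewrite (negPf b_notin_c).
  rewrite -{1}abV invMg mulKVg groupV => ac; have := a_notin_H1.
  by rewrite (mem_cycle_sub (c_H1 D) ac).
- apply/negP => /H3P[]; first by rewrite (negPf b_notin_a).
  move=> bbc; have e : b * (b * c) = 1 by apply: a_cap_H1 => //; rewrite !groupM ?b_H1 ?c_H1.
  have := c_notin_H4; suff -> : c = b^-1 * b^-1 by rewrite groupM // groupV b_H4.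
  by rewrite -[c](mulKg b) -[b * c](mulKg b) e mulg1.
- exact: c_notin_H4.
Qed.

Lemma mem_cflag e g (x : P) : x \in cflag e g -> x = mkface (cindex x) (eps e (cindex x) * g) \/ g \notin G.
Proof.
case/imsetP => i _ ->; have [gG|] := boolP (g \in G); last by right.
by left; rewrite index_mkface // groupM ?eps_G.
Qed.

Lemma in_cflag e g (x : P) : g \in G ->
  (x \in cflag e g) = (x == mkface (cindex x) (eps e (cindex x) * g)).
Proof.
move=> gG; apply/idP/eqP => [/mem_cflag[//|]|e1]; first by rewrite gG.
by rewrite {1}e1 cflag_face // index_lt.
Qed.

Lemma mkface_in_cflag e g i h : (i < 6)%N -> g \in G -> h \in G ->
  (mkface i h \in cflag e g) = (mkface i h == mkface i (eps e i * g)).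
Proof. by move=> li gG hG; rewrite in_cflag // index_mkface. Qed.

Lemma improper_mkface i g h : (i == 0%N) || (i == 5) -> g \in G -> h \in G ->
  mkface i g = mkface i h.
Proof.
move=> i05 gG hG; apply/mkface_eqP => //; first by case/orP: i05 => /eqP->.
by case/orP: i05 => /eqP->; rewrite groupM // groupV.
Qed.

Lemma cflag_kappa_diff i g : (0 < i < 5)%N -> g \in G ->
  forall x : P, cindex x != i -> (x \in cflag true (kappa i * g)) = (x \in cflag false g).
Proof.
move=> i5 gG x xi; have lx := index_lt x.
rewrite !in_cflag ?groupM ?kappa_G // kappa_face // 1?eq_sym //.
by rewrite /eps mul1g.
Qed.

Lemma cflag_adjacent i g : (0 < i < 5)%N -> g \in G ->
  adjacent (cflag false g) (cflag true (kappa i * g)).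
Proof.
move=> i5 gG; have kG : kappa i * g \in G by rewrite groupM ?kappa_G.
have i6 : (i < 6)%N by case/andP: i5 => _ /leqW.
have e1 : eps false i = 1 by [].
have fA := cflag_flag false gG; have fB := cflag_flag true kG.
have ne : mkface i g != mkface i (eps true i * (kappa i * g)).
  apply/eqP => /esym/mkface_eqP; rewrite i6 gG groupM ?eps_G //= mulgA mulgK.
  by move=> /(_ isT isT isT); apply/negP/eps_kappa_self.
have key A B (f : P) : flag A -> flag B -> f \in A -> f \notin B -> cindex f = i ->
    (forall x : P, cindex x != i -> (x \in A) = (x \in B)) -> #|A :\: B| = 1%N.
  move=> fA' fB' f_A fNB fi AB; suff -> : A :\: B = [set f] by rewrite cards1.
  apply/setP => x; rewrite !inE; have [xi|xi] := eqVneq (cindex x) i; last first.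
    rewrite AB // andNb; apply/esym/negbTE; apply: contra xi => /eqP->.
    by rewrite fi.
  apply/andP/eqP => [[_ xA]|->]; last by [].
  by apply: (chain_index_inj (flag_chain fA')) => //; rewrite xi fi.
apply/and4P; split=> //; apply/eqP.
  apply: (key _ _ (mkface i g)) => //; rewrite ?index_mkface //.
  - by rewrite mkface_in_cflag // e1 mul1g.
  - by rewrite mkface_in_cflag.
  - by move=> x xi; rewrite cflag_kappa_diff.
apply: (key _ _ (mkface i (eps true i * (kappa i * g)))) => //; rewrite ?index_mkface ?groupM ?eps_G ?kappa_G //.
- by rewrite mkface_in_cflag ?groupM ?eps_G ?kappa_G.
- by rewrite mkface_in_cflag ?groupM ?eps_G ?kappa_G // e1 mul1g eq_sym.
- by move=> x xi; rewrite cflag_kappa_diff.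
Qed.

Lemma adjacent_sym (A B : {set P}) : adjacent A B = adjacent B A.
Proof. by rewrite /adjacent; case: (flag A); case: (flag B) => //=; rewrite andbC. Qed.

Section Connected.
Variable I : {set P}.
Local Notation adjI := [rel A B : {set P} | [&& adjacent A B, I \subset A & I \subset B]].

Lemma adjI_sym A B : connect adjI A B = connect adjI B A.
Proof.
apply: sym_connect_sym => {}A {}B /=.
by rewrite adjacent_sym; case: (adjacent B A) => //=; rewrite andbC.
Qed.

Lemma adjI_kappa i g : (0 < i < 5)%N -> g \in G -> i \notin [seq cindex x | x in I] ->
  (I \subset cflag false g) = (I \subset cflag true (kappa i * g)).
Proof.
move=> i5 gG iI; have xi x : x \in I -> cindex x != i.
  by move=> xI; apply: contraNneq iI => <-; apply: image_f.
by apply/subsetP/subsetP => h x xI; have := h x xI; rewrite cflag_kappa_diff ?xi.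
Qed.

(** [cap_gen] writes [h * g^-1] with generators [(kappa k)^-1 * kappa l] for levels k and l that do
    not occur in [I]. Each generator is a path of two adjacencies, at levels l and k, through an odd
    flag that still contains [I]. *)
Lemma connect_even g h : g \in G -> h \in G ->
  I \subset cflag false g -> I \subset cflag false h ->
  connect adjI (cflag false g) (cflag false h).
Proof.
move=> gG hG Ig Ih; pose J i := i \in [seq cindex x | x in I].
have hgG : h * g^-1 \in G by rewrite groupM ?groupV.
have := @cap_gen J _ hgG.
have hJ i : (0 < i < 5)%N -> J i -> h * g^-1 \in H i.
  move=> i5 /imageP[x xI ->].
  have := subsetP Ig x xI; rewrite in_cflag // [eps false _ * _]mul1g => /eqP xg.
  have := subsetP Ih x xI; rewrite in_cflag // [eps false _ * _]mul1g => /eqP xh.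
  by apply/mkface_eqP; rewrite ?index_lt // -xg -xh.
move=> /(_ hJ) /gen_prodgP[n [s sS e]].
have {e} eh : h = (\prod_(i < n) s i) * g by rewrite -e mulgKV.
suff [] : [/\ (\prod_(i < n) s i) * g \in G, I \subset cflag false ((\prod_(i < n) s i) * g)
  & connect adjI (cflag false g) (cflag false ((\prod_(i < n) s i) * g))] by rewrite -eh.
elim: n s sS {eh} => [|n IHn] s sS; first by rewrite big_ord0 mul1g connect0.
rewrite big_ord_recl -mulgA.
have [] := IHn (fun i => s (lift ord0 i)) (fun i => sS _).
move: (\prod_(i < n) _ * g) => g' g'G Ig' cg'.
have /imsetP[[k l]] := sS ord0; rewrite inE /= => /and4P[k0 Jk l0 Jl] ->.
have k5 : (0 < k < 5)%N by rewrite k0 /=.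
have l5 : (0 < l < 5)%N by rewrite l0 /=.
set g'' := (kappa k)^-1 * kappa l * g'.
have g''G : g'' \in G by rewrite !groupM ?groupV ?kappa_G.
have e : kappa l * g' = kappa k * g'' by rewrite /g'' -mulgA mulKVg.
have I1 : I \subset cflag true (kappa l * g') by rewrite -adjI_kappa.
have I2 : I \subset cflag false g'' by rewrite (adjI_kappa k5) // -e.
split=> //; apply: connect_trans cg' _.
apply: (@connect_trans _ _ (cflag true (kappa l * g'))); apply: connect1 => /=.
  by rewrite cflag_adjacent // Ig' I1.
by rewrite I1 I2 adjacent_sym e cflag_adjacent.
Qed.

(** If [I] occupies all proper levels, the flags coincide. Otherwise one crossing at a free level
    turns an odd flag into an even one, and [connect_even] applies. *)
Lemma connect_flags A B : flag A -> flag B -> I \subset A -> I \subset B ->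
  connect adjI A B.
Proof.
move=> fA fB IA IB.
have [/forall_inP allI|] := boolP [forall i : 'I_6, (0 < i < 5)%N ==> (nat_of_ord i \in [seq cindex x | x in I])].
  suff -> : A = B by rewrite connect0.
  apply/eqP; rewrite eqEcard !card_flag6 // leqnn andbT; apply/subsetP => x xA.
  have [x05|x05] := boolP (0 < cindex x < 5)%N.
    have /imageP[y yI exy] := allI (Ordinal (index_lt x)) x05.
    suff -> : x = y by apply: (subsetP IB).
    apply: (chain_index_inj (flag_chain fA)) => //; exact: (subsetP IA).
  have [e [g gG eB]] := cflag_ex fB; have [e' [h hG eA]] := cflag_ex fA.
  have := xA; rewrite eB eA !in_cflag // => /eqP ex; rewrite {1}ex; apply/eqP/improper_mkface.
  - by move: x05 (index_lt x); case: (cindex x) => [|[|[|[|[|[|]]]]]].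
  - by rewrite groupM ?eps_G.
  - by rewrite groupM ?eps_G.
rewrite negb_forall => /existsP[i]; rewrite negb_imply => /andP[i5 iI].
have even C : flag C -> I \subset C -> exists g, [/\ g \in G, I \subset cflag false g
    & connect adjI C (cflag false g)].
  move=> fC IC; have [[] [g gG eC]] := cflag_ex fC; last by exists g; rewrite -eC connect0.
  exists ((kappa i)^-1 * g); have hG : (kappa i)^-1 * g \in G by rewrite groupM ?groupV ?kappa_G.
  have I2 : I \subset cflag false ((kappa i)^-1 * g) by rewrite (adjI_kappa i5) // mulKVg -eC.
  split=> //; apply: connect1 => /=; rewrite IC I2 adjacent_sym andbT.
  by have := cflag_adjacent i5 hG; rewrite mulKVg -eC => ->.
have [g [gG Ig Ag]] := even A fA IA; have [h [hG Ih Bh]] := even B fB IB.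
apply: connect_trans Ag _; rewrite adjI_sym; apply: connect_trans Bh _.
exact: connect_even.
Qed.

End Connected.

Lemma coset_strongly_connected : strongly_flag_connected P.
Proof.
by move=> A B fA fB; apply: connect_flags => //; [apply: subsetIl | apply: subsetIr].
Qed.

(** The two faces are those at level i of an even flag and of its neighbour at that level. There is
    no third: exchanging [z1] for [z] gives a flag that is again even or odd, and [cap_trivial] then
    identifies its group element. *)
Lemma coset_diamond : diamond P.
Proof.
move=> x y xy; rewrite !face_rankE !height_index => /eqP.
have -> : ((cindex y)%:Z - 1 == (cindex x)%:Z - 1 + 2)%R = (cindex y == (cindex x).+2).
  by apply/eqP/eqP; lia.
move=> /eqP iy; have /cleP[_ [g gx gy]] := Order.POrderTheory.ltW xy.
have [gG _] := body_mem gx; set i := (cindex x).+1.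
have ly := index_lt y; have i5 : (0 < i < 5)%N by rewrite iy in ly.
have i6 : (i < 6)%N by case/andP: i5 => _ /leqW.
have kG : kappa i * g \in G by rewrite groupM ?kappa_G.
have ekG : eps true i * (kappa i * g) \in G by rewrite groupM ?eps_G.
have Ex : x = mkface (cindex x) g by apply: cfaceE.
have Ey : y = mkface (cindex y) g by apply: cfaceE.
pose z1 := mkface i g; pose z2 := mkface i (eps true i * (kappa i * g)).
have xi : i != cindex x by rewrite neq_ltn leqnn orbT.
have yi : i != cindex y by rewrite iy neq_ltn leqnn.
have Ex2 : x = mkface (cindex x) (eps true (cindex x) * (kappa i * g)).
  by rewrite kappa_face // index_lt.
have Ey2 : y = mkface (cindex y) (eps true (cindex y) * (kappa i * g)).
  by rewrite kappa_face.
suff -> : [set z : P | (x < z < y)%O] = [set z1; z2].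
  rewrite cards2 (_ : z1 != z2) //.
  apply/eqP => /esym/mkface_eqP; rewrite i6 gG ekG mulgA mulgK.
  by move=> /(_ isT isT isT); apply/negP/eps_kappa_self.
apply/setP => z; rewrite !inE; apply/andP/orP => [[xz zy]|].
  have iz : cindex z = i.
    by apply/eqP; rewrite eqn_leq -ltnS -iy (lt_index xz) (lt_index zy).
  have [h hG Ez] := cfaceP z; rewrite iz in Ez.
  pose A := z |: (cflag false g :\ z1).
  have z1A : z1 \in cflag false g by rewrite mkface_in_cflag // mul1g.
  have zNA : z \notin cflag false g :\ z1.
    apply/setD1P => -[zz1]; rewrite in_cflag // iz mul1g => /eqP e; case/eqP: zz1.
    by rewrite e.
  have fA : flag A.
    apply: chain6_flag; last by rewrite cardsU1 zNA -(card_flag6 (cflag_flag false gG))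
      [in RHS](cardsD1 z1) z1A.
    apply: chainU1.
      apply: chainS (flag_chain (cflag_flag false gG)); exact: subsetDl.
    move=> t /setD1P[tz1]; rewrite in_cflag // mul1g => /eqP et.
    have ti : cindex t != i by apply: contraNneq tz1 => ti; rewrite et ti.
    rewrite /Order.comparable; have [tle|tge] := leqP (cindex t) (cindex x).
      have tx : (t <= x)%O by rewrite et Ex mkface_le // tle index_lt.
      by rewrite (Order.POrderTheory.le_trans tx (Order.POrderTheory.ltW xz)) orbT.
    have yt : (y <= t)%O.
      by rewrite et Ey mkface_le // index_lt andbT iy ltn_neqAle eq_sym ti.
    by rewrite (Order.POrderTheory.le_trans (Order.POrderTheory.ltW zy) yt).
  have zA : z \in A by rewrite setU11.
  have fj j : (0 < j < 5)%N -> j != i -> mkface j g \in A.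
    move=> j5 ji; have j6 : (j < 6)%N by case/andP: j5 => _ /leqW.
    apply/setU1P; right; apply/setD1P; split; last by rewrite mkface_in_cflag // mul1g.
    by apply: contraNneq ji => /(congr1 (@cindex D)); rewrite !index_mkface // => ->.
  have [[] [h' h'G eA]] := cflag_ex fA; rewrite eA in zA fj; last first.
    left; move: zA; rewrite in_cflag // iz mul1g => /eqP->.
    suff -> : h' = g by [].
    suff: g * h'^-1 = 1 by move/(canRL (mulgKV _)); rewrite mul1g.
    apply: (@cap_trivial i) => // [|j j5 ji]; first by rewrite groupM ?groupV.
    have j6 : (j < 6)%N by case/andP: j5 => _ /leqW.
    by have := fj j j5 ji; rewrite mkface_in_cflag // mul1g => /eqP/mkface_eqP; apply.
  right; move: zA; rewrite in_cflag // iz => /eqP->; apply/eqP.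
  suff -> : h' = kappa i * g by [].
  have kh : (kappa i)^-1 * h' \in G by rewrite groupM ?groupV ?kappa_G.
  suff: g * ((kappa i)^-1 * h')^-1 = 1.
    by move/(canRL (mulgKV _)); rewrite mul1g => ->; rewrite mulKVg.
  apply: (@cap_trivial i) => // [|j j5 ji]; first by rewrite groupM ?groupV.
  have j6 : (j < 6)%N by case/andP: j5 => _ /leqW.
  have := fj j j5 ji; rewrite mkface_in_cflag //.
  have -> : eps true j * h' = eps true j * (kappa i * ((kappa i)^-1 * h')) by rewrite mulKVg.
  have ij : i != j by rewrite eq_sym.
  by rewrite kappa_face // => /eqP/mkface_eqP; apply.
have between e h : h \in G -> x = mkface (cindex x) (eps e (cindex x) * h) ->
    y = mkface (cindex y) (eps e (cindex y) * h) ->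
    (x < mkface i (eps e i * h))%O /\ (mkface i (eps e i * h) < y)%O.
  move=> hG ex ey; have eG j : eps e j * h \in G by rewrite groupM ?eps_G.
  split; apply: le_lt_index; rewrite ?index_mkface // ?iy ?leqnn //.
    by rewrite ex mkface_eps_le // i6 andbT /i leqnSn.
  by rewrite ey mkface_eps_le // index_lt andbT iy leqnSn.
case=> /eqP->; last exact: between.
by have := @between false g gG; rewrite ![eps false _ * _]mul1g; apply.
Qed.

Lemma coset_polytope : polytope 4 P.
Proof.
by split; [apply: card_flag6 | apply: coset_strongly_connected | apply: coset_diamond].
Qed.

End CosetPolytope.

(** * Automorphisms, chirality and proper self-duality of coset polytopes *)

Section CosetAutomorphisms.
Local Open Scope group_scope.
Variable D : rotary.
Local Notation gT := (rot_type D).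
Local Notation a := (ra D).
Local Notation b := (rb D).
Local Notation c := (rc D).
Local Notation H := (cgroup D).
Local Notation G := (cgroup D 0).
Local Notation kappa := (kappa D).
Local Notation eps := (eps D).
Local Notation P := (cface D).

(** Outside [G] the default makes this the identity, so it is injective for every [g] and yields a
    permutation. *)
Definition translate_face (g : gT) (x : P) : P :=
  insubd x ((val x).1, cbody x :* g).

Lemma translate_faceE g (x : P) : g \in G ->
  cindex (translate_face g x) = cindex x /\ cbody (translate_face g x) = cbody x :* g.
Proof.
move=> gG; have e : val (translate_face g x) = ((val x).1, cbody x :* g).
  rewrite insubdK // /in_mem /=; have [h hG ->] := bodyP x.
  by apply/rcosetsP; exists (h * g); rewrite ?groupM // rcosetM.
by rewrite /cindex /cbody e.
Qed.

Lemma translate_face_inj g : injective (translate_face g).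
Proof.
have [gG|gNG] := boolP (g \in G); last first.
  suff h x : translate_face g x = x by move=> x y; rewrite !h.
  apply: val_inj; rewrite val_insubd ifN //; apply/negP => /rcosetsP[h hG] /= e.
  have : g \in G; last by rewrite (negPf gNG).
  have [k kG ek] := bodyP x; rewrite ek -rcosetM in e.
  have : k * g \in H (cindex x) :* h by rewrite -[_ :* h]e rcoset_refl.
  rewrite mem_rcoset => /(subsetP (cgroup_sub _ _)).
  by rewrite groupMr ?groupV // groupMl.
move=> x y e; have [i1 b1] := translate_faceE x gG; have [i2 b2] := translate_faceE y gG.
apply: cface_eq; first by rewrite -i1 e i2.
by rewrite -[cbody x](rcosetK g) -[cbody y](rcosetK g) -b1 -b2 e.
Qed.

Definition translation (g : gT) : {perm P} := perm (@translate_face_inj g).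

Lemma translation_mkface g i h : (i < 6)%N -> g \in G -> h \in G ->
  translation g (mkface i h) = mkface i (h * g).
Proof.
move=> li gG hG; rewrite permE; have [e1 e2] := translate_faceE (mkface i h) gG.
by apply: cface_eq; rewrite ?e1 ?e2 ?index_mkface ?body_mkface ?groupM // rcosetM.
Qed.

Lemma translationM : {in G &, {morph translation : g h / g * h}}.
Proof.
move=> g h gG hG; apply/permP => x; have [k kG ->] := cfaceP x; have lx := index_lt x.
by rewrite permM !translation_mkface ?groupM // mulgA.
Qed.

Lemma translation_Gamma g : g \in G -> translation g \in Gamma P.
Proof.
move=> gG; apply/GammaP => x y; rewrite !permE; have [i1 b1] := translate_faceE x gG.
have [i2 b2] := translate_faceE y gG; apply/cleP/cleP; rewrite i1 b1 i2 b2 => -[-> [h hx hy]].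
  by split=> //; exists (h * g^-1); rewrite -mem_rcoset.
by split=> //; exists (h * g); rewrite mem_rcoset mulgK.
Qed.

Lemma translation_cflag e g h : g \in G -> h \in G ->
  translation g @: cflag e h = cflag e (h * g).
Proof.
move=> gG hG; rewrite /cflag -imset_comp; apply: eq_imset => i /=.
by rewrite translation_mkface ?groupM ?eps_G // mulgA.
Qed.

Hypothesis ip : intersection_property D.
Let P_polytope : polytope 4 P := coset_polytope ip.

Lemma face_cflag e g i : (i < 6)%N -> g \in G -> face (cflag e g) i = mkface i (eps e i * g).
Proof.
move=> li gG; have := @face_height _ P (cflag e g) (mkface i (eps e i * g)) (cflag_flag e gG).
by rewrite cflag_face // height_index index_mkface ?groupM ?eps_G //; apply.
Qed.

Lemma cflag_nadj i g : (i < 4)%N -> g \in G ->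
  nadj 4 i (cflag false g) (cflag true (kappa i.+1 * g)).
Proof.
move=> i4 gG; have kG : kappa i.+1 * g \in G by rewrite groupM ?kappa_G.
split; [exact: cflag_flag | exact: cflag_flag |].
move=> j j6; rewrite !face_cflag // [eps false j * g]mul1g.
have [->|ji] := eqVneq j i.+1; last by rewrite kappa_face ?eqxx // eq_sym.
have i6 : (i.+1 < 6)%N by apply: (leq_ltn_trans i4).
apply/negP => /eqP/esym/mkface_eqP; rewrite i6 gG groupM ?eps_G //= mulgA mulgK.
by move=> /(_ isT isT isT); apply/negP/eps_kappa_self.
Qed.

Lemma cflag_inj g h : g \in G -> h \in G -> cflag false g = cflag false h -> g = h.
Proof.
move=> gG hG e; suff: g * h^-1 = 1 by move/(canRL (mulgKV _)); rewrite mul1g.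
apply: (@cap_trivial _ ip 1) => // [|j j5 _]; first by rewrite groupM ?groupV.
have j6 : (j < 6)%N by case/andP: j5 => _ /leqW.
apply/mkface_eqP => //.
by have := congr1 (fun A => face A j) e; rewrite !face_cflag // !mul1g.
Qed.

(** The odd flag of [h] is adjacent at rank 2 to the even flag of [(kappa 3)^-1 * h]. Were it also
    the even flag of [g], the two even flags would agree off level 3, so have the same element by
    [cap_trivial], and a flag would be adjacent to itself. *)
Lemma cflag_parity g h : g \in G -> h \in G -> cflag false g != cflag true h.
Proof.
move=> gG hG; apply/eqP => e.
have kG : (kappa 3)^-1 * h \in G by rewrite groupM ?groupV ?kappa_G.
have := @cflag_nadj 2 _ isT kG; rewrite mulKVg -e => ad.
have ge : (kappa 3)^-1 * h = g.
  apply/eqP; rewrite eq_mulgV1; apply/eqP.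
  apply: (@cap_trivial _ ip 3) => // [|j j5 j3]; first by rewrite groupM ?groupV.
  have j6 : (j < 6)%N by case/andP: j5 => _ /leqW.
  have [_ _ /(_ j j6)] := ad; rewrite j3 !face_cflag // !mul1g => /eqP/mkface_eqP.
  exact.
by have [_ _ /(_ 3 isT)] := ad; rewrite ge !eqxx.
Qed.

Lemma cflag_nadj_parity i e g B : (i < 4)%N -> g \in G -> nadj 4 i (cflag e g) B ->
  exists2 h, h \in G & B = cflag (~~ e) h.
Proof.
move=> i4 gG; case: e => AB.
  have kG : (kappa i.+1)^-1 * g \in G by rewrite groupM ?groupV ?kappa_G.
  exists ((kappa i.+1)^-1 * g) => //=.
  have := cflag_nadj i4 kG; rewrite mulKVg => BA.
  exact: (nadj_uniq P_polytope i4 AB (nadj_sym BA)).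
exists (kappa i.+1 * g); first by rewrite groupM ?kappa_G.
exact: (nadj_uniq P_polytope i4 AB (cflag_nadj i4 gG)).
Qed.

Lemma translation_inj : {in G &, injective translation}.
Proof.
move=> g h gG hG e; apply: cflag_inj => //; rewrite -[g]mul1g -[h]mul1g.
by rewrite -!translation_cflag ?group1 // e.
Qed.

(** In a regular polytope, conjugation by [rho 2] acts on the rotations in this way. [theta] is a
    bare function because it will be obtained by choice from an automorphism of the poset. *)
Definition no_mirror : Prop := forall theta : gT -> gT,
  {in G, forall x, theta x \in G} -> {in G &, {morph theta : x y / x * y}} ->
  theta (a * b) = a * b -> theta b = b^-1 -> theta c = c^-1 -> False.

Hypothesis nm : no_mirror.

(** Every adjacency changes parity, so an automorphism reversing the parity of one flag reverses it
    for all. *)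
Lemma Gamma_flip s : s \in Gamma P -> (exists2 g, g \in G & s @: cflag false 1 = cflag true g) ->
  forall A, flag A -> exists e g h, [/\ g \in G, h \in G, A = cflag e g & s @: A = cflag (~~ e) h].
Proof.
move=> sG [g0 g0G e0]; have f1 := cflag_flag false (group1 G).
apply: (flag_ind P_polytope f1); first by exists false, 1, g0; rewrite group1.
move=> i B C i4 [e [g [h [gG hG eB sB]]]] BC.
have sBC := Gamma_nadj P_polytope sG BC; rewrite sB in sBC; rewrite eB in BC.
have [k kG eC] := cflag_nadj_parity i4 gG BC.
have [l lG eC'] := cflag_nadj_parity i4 hG sBC.
by exists (~~ e), k, l.
Qed.

(* A mirror would conjugate translations to translations and invert every
   [kappa i]. *)
Lemma Gamma_no_flip s g : s \in Gamma P -> g \in G -> s @: cflag false 1 <> cflag true g.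
Proof.
move=> sG gG es; pose s' := s * translation g^-1.
have gVG : g^-1 \in G by rewrite groupV.
have s'G : s' \in Gamma P by rewrite groupM ?translation_Gamma.
have s'1 : s' @: cflag false 1 = cflag true 1.
  by rewrite imset_permM es translation_cflag // mulgV.
clearbody s'; have flip := Gamma_flip s'G (ex_intro2 _ _ 1 (group1 G) s'1).
have exT k : k \in G -> exists h, (h \in G) && (s' @: cflag false k == cflag true h).
  move=> kG; have [e [k' [h [k'G hG eA eB]]]] := flip _ (cflag_flag false kG).
  case: e eA eB => eA eB; last by exists h; rewrite hG eB eqxx.
  by have := cflag_parity kG k'G; rewrite eA eqxx.
pose theta k := odflt 1 [pick h in G | s' @: cflag false k == cflag true h].
have thetaP k : k \in G -> theta k \in G /\ s' @: cflag false k = cflag true (theta k).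
  move=> kG; rewrite /theta; case: pickP => [h /andP[hG /eqP//]|no].
  by have [h] := exT k kG; rewrite no.
have conj k : k \in G -> translation k * s' = s' * translation (theta k).
  move=> kG; have [tG et] := thetaP k kG.
  apply: (Gamma_eq P_polytope (cflag_flag false (group1 G))); rewrite ?groupM ?translation_Gamma //.
  by rewrite !imset_permM translation_cflag // mul1g et s'1 translation_cflag // mul1g.
have thetaM : {in G &, {morph theta : x y / x * y}}.
  move=> x y xG yG; have [tx _] := thetaP x xG; have [ty _] := thetaP y yG.
  have xyG : x * y \in G by rewrite groupM.
  have [txy _] := thetaP _ xyG.
  apply: translation_inj => //; rewrite ?groupM // translationM //.
  apply: (mulgI s'); rewrite -conj // translationM // mulgA -conj // -!mulgA -conj //.
(* As [kappa 3] is trivial, the base even and odd flags are adjacent at rank 2, so [s'] exchanges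
   them. *)
have s'2 : s' @: cflag true 1 = cflag false 1.
  have ad := @cflag_nadj 2 1 isT (group1 G); rewrite /= mul1g in ad.
  have := Gamma_nadj P_polytope s'G ad; rewrite s'1 => ad'.
  exact: (nadj_uniq P_polytope _ ad' (nadj_sym ad)).
have theta_kappa i : (i < 4)%N -> theta (kappa i.+1) = (kappa i.+1)^-1.
  move=> i4; have kG := kappa_G D i.+1; have [tG et] := thetaP _ kG.
  have kVG : (kappa i.+1)^-1 \in G by rewrite groupV.
  apply: cflag_inj => //.
  have ad := cflag_nadj i4 (group1 G); rewrite mulg1 in ad.
  have := Gamma_nadj P_polytope s'G ad; rewrite s'1.
  have -> : s' @: cflag true (kappa i.+1) = cflag false (theta (kappa i.+1)).
    rewrite -[kappa i.+1 in LHS]mul1g -translation_cflag // -imset_permM conj //.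
    by rewrite imset_permM s'2 translation_cflag // mul1g.
  move=> ad'; have ad2 := cflag_nadj i4 kVG; rewrite mulgV in ad2.
  exact: (nadj_uniq P_polytope i4 ad' (nadj_sym ad2)).
have bG := bG D; have theta1 : theta 1 = 1.
  by apply: (mulgI (theta 1)); rewrite mulg1 -thetaM ?mulg1.
apply: (nm (theta := theta)) => //.
- by move=> k /thetaP[].
- by rewrite (theta_kappa 0) //= abV.
- have := theta_kappa 1%N isT; rewrite /= invgK => tb.
  have : theta (b * b^-1) = 1 by rewrite mulgV.
  by rewrite thetaM ?groupV // tb => /(canRL (mulgK _)); rewrite mul1g.
- exact: (theta_kappa 3).
Qed.

Lemma Gamma_translation s : s \in Gamma P -> exists2 g, g \in G & s = translation g.
Proof.
move=> sG; have f1 := cflag_flag false (group1 G).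
have [[] [g gG es]] := cflag_ex (Gamma_flag sG f1); first by case: (Gamma_no_flip sG gG).
exists g => //; apply: (Gamma_eq P_polytope f1) => //; first exact: translation_Gamma.
by rewrite es translation_cflag // mul1g.
Qed.

Lemma coset_Gamma_isog : Gamma P \isog G.
Proof.
rewrite isog_sym; apply/isogP; exists (Morphism translationM).
  by apply/injmP; apply: translation_inj.
apply/setP => s; apply/morphimP/idP => [[g gG _ ->]|/Gamma_translation[g gG ->]].
  exact: translation_Gamma.
by exists g.
Qed.

Lemma orbit_cflag e g (A : {set P}) : g \in G ->
  reflect (exists2 h, h \in G & A = cflag e h) (A \in orbit ('P^*)%act (Gamma P) (cflag e g)).
Proof.
move=> gG; apply: (iffP orbitP) => [[s /Gamma_translation[h hG ->] <-]|[h hG ->]].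
  exists (g * h); first by rewrite groupM.
  exact: translation_cflag.
have ghG : g^-1 * h \in G by rewrite groupM ?groupV.
exists (translation (g^-1 * h)); first exact: translation_Gamma.
by rewrite setact_imset translation_cflag // mulKVg.
Qed.

Lemma flag_orbitsE : flag_orbits P =
  [set orbit ('P^*)%act (Gamma P) (cflag false 1); orbit ('P^*)%act (Gamma P) (cflag true 1)].
Proof.
apply/setP => O; rewrite inE; apply/imsetP/orP.
  move=> [A]; rewrite [A \in _]inE => /cflag_ex[e [g gG ->]] ->.
  have : cflag e g \in orbit ('P^*)%act (Gamma P) (cflag e 1).
    by apply/orbit_cflag; [apply: group1 | exists g].
  move/orbit_eqP => ->.
  by rewrite !in_set1; case: e; [right | left].
have f e : cflag e 1 \in flags P by rewrite inE cflag_flag.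
by rewrite !in_set1 => -[] /eqP->; eexists; try reflexivity; apply: f.
Qed.

Lemma coset_chiral : chiral P.
Proof.
split.
  rewrite flag_orbitsE cards2; set O := orbit _ _ _; set O' := orbit _ _ _.
  suff -> : O != O' by [].
  apply/eqP => e; have : cflag false 1 \in O' by rewrite -e orbit_refl.
  by case/orbit_cflag => // h hG /eqP; apply/negP/cflag_parity.
move=> A B AB; have [i i4 ad] := adjacent_nadj P_polytope AB.
have [fA _ _] := ad; have [e [g gG eA]] := cflag_ex fA; rewrite eA in ad *.
have [h hG ->] := cflag_nadj_parity i4 gG ad.
apply/orbit_cflag => // -[k kG]; case: e {ad eA} => /= e.
  by have := cflag_parity hG kG; rewrite e eqxx.
by have := cflag_parity kG hG; rewrite e eqxx.
Qed.

Variable d : gT.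
Hypotheses (da : a ^ d = c^-1) (db : b ^ d = b^-1) (dc : c ^ d = a^-1).

Lemma cgroup_conj i : (i < 6)%N -> H i :^ d = H (5 - i).
Proof.
have sub j : (j < 6)%N -> H j :^ d \subset H (5 - j).
  have [Ga Gb Gc] := mem_abc D.
  have gJ (x y : gT) (K : {group gT}) : x ^ d \in K -> y ^ d \in K -> <<[set x; y]>> :^ d \subset K.
    move=> xK yK; rewrite -genJ gen_subG conjUg !conjg_set1.
    by apply/subsetP => z /set2P[] ->.
  have sG : H 0 :^ d \subset G.
    rewrite -genJ gen_subG !conjUg !conjg_set1 da db dc; apply/subsetP => z.
    by rewrite !inE => /orP[/orP[]|] /eqP->; rewrite groupV.
  case: j => [|[|[|[|[|[|//]]]]]] _ //; apply: gJ; rewrite ?conjMg ?da ?db ?dc -?invMg groupV;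
    first [exact: b_H4 | exact: a_H4 | exact: bc_H3 | exact: a_H3 | exact: ab_H2
            | exact: c_H2 | exact: b_H1 | exact: c_H1].
move=> i6; apply/eqP; rewrite eqEcard sub // cardJg.
have := subset_leq_card (sub (5 - i)%N _); rewrite cardJg subKn //; first apply.
by rewrite ltnS leq_subr.
Qed.

Definition dual_face (x : P) : P := insubd x (rev_ord (val x).1, cbody x :^ d).

Lemma rcosetJ (A : {set gT}) g : (A :* g) :^ d = A :^ d :* g ^ d.
Proof. by rewrite conjsMg conjg_set1. Qed.

Lemma dual_faceE (x : P) :
  cindex (dual_face x) = (5 - cindex x)%N /\ cbody (dual_face x) = cbody x :^ d.
Proof.
have e : val (dual_face x) = (rev_ord (val x).1, cbody x :^ d).
  rewrite insubdK // /in_mem /=; have [h hG ->] := bodyP x.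
  apply/rcosetsP; exists (h ^ d); first by rewrite -(cgroup_conj (isT : 0 < 6)%N) memJ_conjg.
  by rewrite rcosetJ cgroup_conj ?index_lt // subSS.
by rewrite /cindex /cbody e /= subSS.
Qed.

Lemma dual_face_inj : injective dual_face.
Proof.
move=> x y e; have [i1 b1] := dual_faceE x; have [i2 b2] := dual_faceE y.
apply: cface_eq; last by apply: (conjsg_inj (x := d)); rewrite -b1 -b2 e.
have lx := index_lt x; have ly := index_lt y; rewrite ltnS in lx; rewrite ltnS in ly.
by rewrite -(subKn lx) -(subKn ly) -i1 -i2 e.
Qed.

Definition dual_perm : {perm P} := perm dual_face_inj.

Lemma dual_perm_duality : duality dual_perm.
Proof.
move=> x y; rewrite !permE; have [i1 b1] := dual_faceE x; have [i2 b2] := dual_faceE y.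
have lx := index_lt x; have ly := index_lt y; rewrite ltnS in lx; rewrite ltnS in ly.
apply/cleP/cleP; rewrite i1 i2 b1 b2 => -[le [g gx gy]].
  split; first by have := leq_sub2l 5 le; rewrite !subKn.
  by exists (g ^ d^-1); rewrite -mem_conjg.
by split; [rewrite leq_sub2l | exists (g ^ d); rewrite memJ_conjg].
Qed.

Lemma dual_perm_cflag g : g \in G -> dual_perm @: cflag false g = cflag false (g ^ d).
Proof.
move=> gG; have gdG : g ^ d \in G by rewrite -(cgroup_conj (isT : 0 < 6)%N) memJ_conjg.
apply/eqP; rewrite eqEcard (card_imset _ (@perm_inj _ dual_perm)).
rewrite !card_flag6 ?cflag_flag // leqnn andbT; apply/subsetP => _ /imsetP[_ /imsetP[i _ ->] ->].
rewrite permE mul1g; have [e1 e2] := dual_faceE (mkface i g).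
rewrite in_cflag // mul1g; apply/eqP/cfaceE; rewrite e2 body_mkface // rcosetJ.
exact: rcoset_refl.
Qed.

Lemma coset_properly_self_dual : properly_self_dual P.
Proof.
exists dual_perm; first exact: dual_perm_duality.
have imI : injective (fun A : {set P} => dual_perm @: A) by apply/imset_inj/perm_inj.
set E := orbit ('P^*)%act (Gamma P) (cflag false 1).
have G1 := group1 G.
have evenE : [set dual_perm @: A | A : {set P} in E] = E.
  apply/eqP; rewrite eqEcard (card_imset _ imI) leqnn andbT; apply/subsetP => _ /imsetP[A AE ->].
  have /(orbit_cflag _ _ G1)[g gG ->] := AE; rewrite dual_perm_cflag //.
  apply/orbit_cflag => //; exists (g ^ d) => //.
  by rewrite -(cgroup_conj (isT : 0 < 6)%N) memJ_conjg.
move=> O; rewrite flag_orbitsE !inE => /orP[] /eqP-> //.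
apply/eqP; rewrite eqEcard (card_imset _ imI) leqnn andbT; apply/subsetP => _ /imsetP[A AO ->].
(* The odd orbit is settled by exclusion: the even orbit is already filled by images of even flags,
   so an injective map cannot send an odd flag there. *)
have /(orbit_cflag _ _ G1)[g gG eA] := AO.
have [[] [h hG ef]] := cflag_ex (duality_flag (coset_polytope ip) dual_perm_duality (cflag_flag true gG)).
  by rewrite eA ef; apply/orbit_cflag => //; exists h.
have : dual_perm @: A \in E by rewrite eA ef; apply/orbit_cflag => //; exists h.
rewrite -evenE => /imsetP[B BE] /imI eAB; rewrite -eAB eA in BE.
by have /(orbit_cflag _ _ G1)[k kG /eqP] := BE; rewrite eq_sym (negPf (cflag_parity kG gG)).
Qed.

End CosetAutomorphisms.

(** * Facets and vertex-figures of coset geometries *)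

Section Tessellations.
Import GRing.Theory boolp classical_sets functions.
Local Open Scope ring_scope.
Local Open Scope classical_set_scope.
Local Notation point := Defs.point.
Implicit Types (c : nat) (w u : motion) (A : set point).

Definition mset c w A : set point := [set mapply c w x | x in A].

Lemma mset_comp c w u A : mset c (mcomp w u) A = mset c w (mset c u A).
Proof.
apply/seteqP; split=> [_ [x Ax <-]|_ [_ [x Ax <-] <-]].
  by exists (mapply c u x); [exists x | rewrite mapply_comp].
by exists x => //; rewrite mapply_comp.
Qed.

Lemma mset1 c A : mset c mone A = A.
Proof.
apply/seteqP; split=> [_ [x Ax <-]|x Ax]; first by rewrite mapply1.
by exists x => //; rewrite mapply1.
Qed.

Lemma translate_mset c t w A : translate (t *+ c) (mset c w A) = mset c (mcomp (0, t) w) A.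
Proof.
apply/seteqP; split=> [_ [_ [x Ax <-] <-]|_ [x Ax <-]].
  by exists x => //; rewrite mapply_comp /mapply /= rotz0.
by exists (mapply c w x); [exists x | rewrite mapply_comp /mapply /= rotz0].
Qed.

(** Levels 0 and 4 are the improper faces, fixed by every motion; the condition is vacuous there. *)
Definition stab (r : nat) w : Prop := (0 < r < 4)%N -> w \in stabilizer r.

Lemma stabM r w u : stab r w -> stab r u -> stab r (mcomp w u).
Proof.
move=> sw su hr; have {}sw := sw hr; have {}su := su hr.
suff /allP/(_ w sw)/allP : all (fun w => all (fun u => mcomp w u \in stabilizer r) (stabilizer r))
  (stabilizer r) by apply.
by move: hr {sw su}; case: r => [|[|[|[|]]]] //; vm_compute.
Qed.

(* A tessellation given by the images under motions of one base flag B 1, B 2, B 3 with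
   improper faces B 0 and B 4, ordered by le. *)
Record tessellation c (F : set (set point)) (B : nat -> set point)
    (le : set point -> set point -> Prop) : Prop := Tessellation {
  tess_faces : forall A, F A <-> exists r w, (r < 5)%N /\ A = mset c w (B r);
  tess_mono : forall r r', (r <= r' < 5)%N -> le (B r) (B r');
  tess_map : forall w A A', le A A' -> le (mset c w A) (mset c w A');
  tess_stab : forall r w, (r < 5)%N -> stab r w -> mset c w (B r) = B r;
  tess_inc : forall r r' w, (r < 5)%N -> (r' < 5)%N -> le (mset c w (B r)) (B r') ->
    (r <= r')%N /\ exists u x, [/\ stab r' u, stab r x & w = mcomp u x] }.

Section TessellationTheory.
Variables (c : nat) (F : set (set point)) (B : nat -> set point).
Variable (le : set point -> set point -> Prop).
Hypothesis tess : tessellation c F B le.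

(** The factorization through stabilizers lets one motion carry both base faces to the given
    incident pair. *)
Lemma tess_incidence r r' w w' : (r < 5)%N -> (r' < 5)%N ->
  le (mset c w (B r)) (mset c w' (B r')) ->
  (r <= r')%N /\ exists u, mset c u (B r) = mset c w (B r) /\ mset c u (B r') = mset c w' (B r').
Proof.
move=> r5 r5' /(tess_map tess (minv w')); rewrite -!mset_comp mVcomp mset1.
case/(tess_inc tess r5 r5') => rr' [u [x [su sx e]]]; split=> //.
exists (mcomp w' u); split; last by rewrite mset_comp (tess_stab tess r5' su).
have -> : w = mcomp (mcomp w' u) x by rewrite -mcompA -e mcompA mcompV m1comp.
by rewrite [RHS]mset_comp (tess_stab tess r5 sx).
Qed.

(** Incidence in both directions equates the levels; the factorization then has both factors in the
    same stabilizer. *)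
Lemma tess_eq r r' w w' : (r < 5)%N -> (r' < 5)%N ->
  mset c w (B r) = mset c w' (B r') -> r = r' /\ stab r (mcomp (minv w') w).
Proof.
move=> r5 r5' e; have e' : mset c (mcomp (minv w') w) (B r) = B r'.
  by rewrite mset_comp e -mset_comp mVcomp mset1.
have refl s : (s < 5)%N -> le (B s) (B s) by move=> s5; apply: (tess_mono tess); rewrite leqnn.
have [rr' _] : (r <= r')%N /\ exists u x, [/\ stab r' u, stab r x & mcomp (minv w') w = mcomp u x].
  by apply: (tess_inc tess) => //; rewrite e'; apply: refl.
have e2 : mset c (mcomp (minv w) w') (B r') = B r.
  by rewrite mset_comp -e -mset_comp mVcomp mset1.
have [r'r _] : (r' <= r)%N /\ exists u x, [/\ stab r u, stab r' x & mcomp (minv w) w' = mcomp u x].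
  by apply: (tess_inc tess) => //; rewrite e2; apply: refl.
have rE : r = r' by apply/eqP; rewrite eqn_leq rr' r'r.
split=> //; rewrite -rE in e'.
have [_ [u [x [su sx ->]]]] : (r <= r)%N /\
    exists u x, [/\ stab r u, stab r x & mcomp (minv w') w = mcomp u x].
  by apply: (tess_inc tess) => //; rewrite e'; apply: refl.
exact: stabM.
Qed.

End TessellationTheory.

Definition hex_level (r : nat) : set point :=
  if r == 0%N then set0 else if r == 4 then setT else [set` hex_base r].

Definition tri_level (r : nat) : set point :=
  if r == 0%N then setT else if r == 4 then set0 else [set` tri_base r].

Lemma mset_seq c w (s : seq point) : mset c w [set` s] = [set` map (mapply c w) s].
Proof.
apply/seteqP; split=> [_ [x xs <-]|x]; first exact: map_f.
by move=> /mapP[y ys ->]; exists y.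
Qed.

Lemma set1_seq (x : point) : [set x] = [set` [:: x]].
Proof. by apply/seteqP; split=> z /=; rewrite inE; [move=> -> | move/eqP]. Qed.

Lemma set2_seq (x y : point) : [set x; y] = [set` [:: x; y]].
Proof.
apply/seteqP; split=> z /=; rewrite !inE; first by case=> ->; rewrite eqxx ?orbT.
by case/orP => /eqP->; [left | right].
Qed.

Lemma set3_seq (x y z : point) : [set x; y; z] = [set` [:: x; y; z]].
Proof.
apply/seteqP; split=> t /=; rewrite !inE; first by case=> [[]|] ->; rewrite eqxx ?orbT.
by case/or3P => /eqP->; [left; left | left; right | right].
Qed.

Lemma set2C (x y : point) : [set x; y] = [set y; x].
Proof. by apply/seteqP; split=> z /= [] ->; auto. Qed.

Lemma mset0 c w : mset c w set0 = set0.
Proof. by apply/seteqP; split=> [x []|]. Qed.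

Lemma msetT c w : mset c w setT = setT.
Proof.
apply/seteqP; split=> // x _; exists (mapply c (minv w) x) => //.
by rewrite -mapply_comp mcompV mapply1.
Qed.

Lemma msetS c w A A' : A `<=` A' -> mset c w A `<=` mset c w A'.
Proof. by move=> AA' _ [x Ax <-]; exists x => //; apply: AA'. Qed.

Lemma setT_seq (s : seq point) : ~ (setT `<=` [set` s]).
Proof.
move=> sT; pose m := \max_(z <- s) `|z.1|%N.
have /sT /= : setT (m.+1%:Z, 0 : int) by [].
move/(@leq_bigmax_seq _ _ xpredT (fun z : point => `|z.1|%N)) => /(_ isT).
by rewrite -/m /= ltnn.
Qed.

Lemma mset_stab c r w (s : seq point) : 
  (forall w, w \in stabilizer r -> all (fun z => mapply c w z \in s) s) ->
  w \in stabilizer r -> mset c w [set` s] = [set` s].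
Proof.
move=> h ws; have sub u : u \in stabilizer r -> mset c u [set` s] `<=` [set` s].
  by move=> us _ [x xs <-]; apply: (allP (h u us)).
apply/seteqP; split; first exact: sub.
rewrite -{1}[[set` s]](mset1 c) -(mcompV w) mset_comp; apply: msetS.
exact/sub/stabilizerV.
Qed.

Lemma level_cases r : (r < 5)%N -> [\/ r = 0%N, r = 4 | (0 < r < 4)%N].
Proof. by case: r => [|[|[|[|[|]]]]] // _; [constructor 1 | constructor 3..| constructor 2]. Qed.

Lemma hex_levelE r : (0 < r < 4)%N -> hex_level r = [set` hex_base r].
Proof. by case: r => [|[|[|[|]]]]. Qed.

Lemma tri_levelE r : (0 < r < 4)%N -> tri_level r = [set` tri_base r].
Proof. by case: r => [|[|[|[|]]]]. Qed.

Lemma hex_tessellation : tessellation 3 hex_face hex_level (fun A A' => A `<=` A').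
Proof.
have hex_corner_range (w : point) : range (hex_corner w) = mset 3 (0, w) [set` hex_base 3].
  apply/seteqP; split=> [_ [k _ <-]|_ [x xb <-]].
    exists (rotz k%:R (1, 1)); last by rewrite /mapply /= rotz0 addrC /hex_corner rotz_nat.
    by apply/(Z6_case (p := fun k => rotz k (1, 1) \in hex_base 3)); vm_compute.
  have [k ->] : exists k : nat, x = iter k rot60 (1, 1).
    by move: xb; rewrite /= !inE => /orP[|/orP[|/orP[|/orP[|/orP[]]]]] /eqP->;
      [exists 0%N | exists 1%N | exists 2 | exists 3 | exists 4 | exists 5].
  by exists k => //; rewrite /mapply /= rotz0 /hex_corner addrC.
split.
- move=> A; split.
    case=> [|w k|w k|w|].
    + by exists 0%N, mone; rewrite mset0.
    + exists 1%N, (k%:R, w); split=> //; rewrite hex_levelE // mset_seq set1_seq /= /mapply /=.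
      by rewrite rotz_nat addrC.
    + exists 2, (k.+1%:R, w); split=> //; rewrite hex_levelE // mset_seq set2C set2_seq /= /mapply /=.
      by rewrite !rotz_nat ![_ + w *+ 3]addrC [iter k.+1 rot60 (2, -1)]iterSr.
    + by exists 3, (0, w); split=> //; rewrite hex_levelE // hex_corner_range.
    + by exists 4, mone; rewrite msetT.
  case=> r [[k w] [r5 ->]]; have [->|->|hr] := level_cases r5.
  + by rewrite mset0; constructor.
  + by rewrite msetT; constructor.
  rewrite hex_levelE //; case: r hr {r5} => [|[|[|[|]]]] // _.
  + have -> : mset 3 (k, w) [set` hex_base 1] = [set hex_corner w k]; last by constructor.
    by rewrite mset_seq set1_seq /= /mapply /= /hex_corner addrC.
  (* [(2, -1)] is [(1, 1)] rotated five times, so the base edge joins corners 5 and 6; hence the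
     [k + 5]. *)
  + have -> : mset 3 (k, w) [set` hex_base 2] = [set hex_corner w (k + 5); hex_corner w (k + 5).+1].
      rewrite mset_seq set2C set2_seq /= /mapply /= /hex_corner -addnS !iterD rot60_6.
      by rewrite ![_ + w *+ 3]addrC.
    by constructor.
  + have -> : mset 3 (k, w) [set` hex_base 3] = range (hex_corner w); last by constructor.
    rewrite hex_corner_range; have -> : (k, w) = mcomp (0, w) (k, 0).
      by rewrite /mcomp /= add0r rotz0 add0r.
    rewrite mset_comp (@mset_stab 3 3) // => [u us|]; last by move: k; apply: Z6_case.
    by have /andP[] := stabilizer_base us.
- move=> r r' /andP[rr' r5']; have := leq_ltn_trans rr' r5'; move: rr' r5'.
  case: r => [|[|[|[|[|r]]]]]; case: r' => [|[|[|[|[|r']]]]] // _ _ _ x; rewrite /hex_level //=.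
  + by rewrite !inE => ->.
  + by rewrite !inE => /eqP->.
  + by rewrite !inE => /orP[] ->; rewrite ?orbT.
- by move=> w A A'; apply: msetS.
- move=> r w r5; have [->|->|hr] := level_cases r5.
  + by rewrite mset0.
  + by rewrite msetT.
  move=> /(_ hr) ws; rewrite hex_levelE //; apply: (@mset_stab 3 r) => // u us.
  by have /andP[] := stabilizer_base us.
- move=> r r' w r5 r5'.
  have [->|->|hr] := level_cases r5.
  + move=> _; split=> //; exists mone, w; rewrite m1comp; split=> // hr'.
    by case: r' hr' {r5'} => [|[|[|[|]]]] // _; vm_compute.
  + have [->|->|hr'] := level_cases r5'.
    * by rewrite msetT => /(_ 0 I).
    * by move=> _; split=> //; exists w, mone; rewrite mcomp1.
    * by rewrite msetT hex_levelE // => /setT_seq.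
  have [->|->|hr'] := level_cases r5'.
  + rewrite hex_levelE // mset_seq => h; exfalso.
    by case: r hr h {r5} => [|[|[|[|]]]] // _ /(_ _ (mem_head _ _)).
  + move=> _; split; first by case: r hr {r5} => [|[|[|[|]]]].
    exists w, mone; rewrite mcomp1; split=> // _.
    by case: r hr {r5} => [|[|[|[|]]]] // _; vm_compute.
  rewrite !hex_levelE // => h.
  have /(hex_incidence hr hr')[rr' [u [x [us xs e]]]] :
      all (fun z => mapply 3 w z \in hex_base r') (hex_base r).
    by apply/allP => z zb; apply: (h (mapply 3 w z)); exists z.
  by split=> //; exists u, x; split=> // _.
Qed.

Lemma tri_tessellation : tessellation 1 tri_face tri_level (fun A A' => A' `<=` A).
Proof.
split.
- move=> A; split.
    case=> [|w|w k|w k|].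
    + by exists 4, mone; rewrite mset0.
    + exists 3, (0, w); split=> //; rewrite tri_levelE // mset_seq set1_seq /= /mapply /=.
      by rewrite rotz0 add0r.
    + exists 2, (k%:R, w); split=> //; rewrite tri_levelE // mset_seq set2_seq /= /mapply /=.
      by rewrite rotz_0 add0r rotz_nat [_ + w *+ 1]addrC.
    + exists 1%N, (k%:R, w); split=> //; rewrite tri_levelE // mset_seq set3_seq /= /mapply /=.
      by rewrite rotz_0 add0r !rotz_nat ![_ + w *+ 1]addrC -iterS iterSr.
    + by exists 0%N, mone; rewrite msetT.
  case=> r [[k w] [r5 ->]]; have [->|->|hr] := level_cases r5.
  + by rewrite msetT; constructor.
  + by rewrite mset0; constructor.
  rewrite tri_levelE //; case: r hr {r5} => [|[|[|[|]]]] // _.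
  + have -> : mset 1 (k, w) [set` tri_base 1] =
       [set w; w + iter k rot60 (1, 0); w + iter k.+1 rot60 (1, 0)]; last by constructor.
    by rewrite mset_seq set3_seq /= /mapply /= rotz_0 add0r ![_ + w *+ 1]addrC -iterS iterSr.
  + have -> : mset 1 (k, w) [set` tri_base 2] = [set w; w + iter k rot60 (1, 0)]; last by constructor.
    by rewrite mset_seq set2_seq /= /mapply /= rotz_0 add0r [_ + w *+ 1]addrC.
  + have -> : mset 1 (k, w) [set` tri_base 3] = [set w]; last by constructor.
    by rewrite mset_seq set1_seq /= /mapply /= rotz_0 add0r.
- move=> r r' /andP[rr' r5']; have := leq_ltn_trans rr' r5'; move: rr' r5'.
  case: r => [|[|[|[|[|r]]]]]; case: r' => [|[|[|[|[|r']]]]] // _ _ _ x; rewrite /tri_level //=.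
  + by rewrite !inE => /orP[] ->; rewrite ?orbT.
  + by rewrite !inE => ->.
  + by rewrite !inE => ->.
- by move=> w A A'; apply: msetS.
- move=> r w r5; have [->|->|hr] := level_cases r5.
  + by rewrite msetT.
  + by rewrite mset0.
  move=> /(_ hr) ws; rewrite tri_levelE //; apply: (@mset_stab 1 r) => // u us.
  by have /andP[] := stabilizer_base us.
- move=> r r' w r5 r5'.
  have stab1 s : stab s mone.
    by case: s => [|[|[|[|s]]]] // _; vm_compute.
  have [->|->|hr] := level_cases r5.
  + by move=> _; split=> //; exists mone, w; rewrite m1comp.
  + have [->|->|hr'] := level_cases r5'.
    * by rewrite mset0 => /(_ 0 I).
    * by move=> _; split=> //; exists w, mone; rewrite mcomp1.
    * rewrite mset0 tri_levelE // => h; exfalso.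
      by case: r' hr' h {r5'} => [|[|[|[|]]]] // _ /(_ _ (mem_head _ _)).
  have [->|->|hr'] := level_cases r5'.
  + by rewrite (tri_levelE hr) mset_seq => h; case: (setT_seq h).
  + move=> _; split; first by case: r hr {r5} => [|[|[|[|]]]].
    by exists w, mone; rewrite mcomp1.
  rewrite !tri_levelE // => h.
  have /(tri_incidence hr hr')[rr' [u [x [us xs e]]]] :
      all (fun z => mapply 1 (minv w) z \in tri_base r) (tri_base r').
    apply/allP => z zb; have [y yb <-] := h z zb.
    by rewrite -mapply_comp mVcomp mapply1.
  split=> //; exists (minv x), (minv u); split=> [_|_|]; try exact: stabilizerV.
  by rewrite -minvM -e minvK.
Qed.

End Tessellations.

(** * The base facet of a coset polytope as a torus map *)

Section FacetSections.
Import GRing.Theory boolp classical_sets functions.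
Local Open Scope group_scope.
Local Open Scope classical_set_scope.
Local Notation point := Defs.point.
Variable D : rotary.
Local Notation gT := (rot_type D).
Local Notation a := (ra D).
Local Notation b := (rb D).
Local Notation c := (rc D).
Local Notation H := (cgroup D).
Local Notation G := (cgroup D 0).
Local Notation P := (cface D).
Local Notation x0 := (mkface 4 (1 : gT) : P).
Hypothesis ip : intersection_property D.
Variable v : point.
Hypothesis exact : exact_walks a b v.

Lemma walk_H4 g w : walk a b g w -> g \in H 4.
Proof. by move/walk_gen. Qed.

Lemma walk_G g w : walk a b g w -> g \in G.
Proof. by move/walk_H4/(fintype.subsetP (cgroup_sub D 4)). Qed.

Lemma cap_24 g : g \in H 2 -> g \in H 4 -> g = 1 \/ g = a * b.
Proof.
move=> /H2P[gc|gc] g4; first by left; apply: (c_cap_H4 ip).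
have e : g * (a * b) = 1 by apply: (c_cap_H4 ip) => //; rewrite !groupM ?a_H4 ?b_H4.
by right; rewrite -[g](mulgK (a * b)) e mul1g abV.
Qed.

Lemma cap_34 g : g \in H 3 -> g \in H 4 -> g \in <[a]>.
Proof.
move=> /H3P[//|ga] g4; have : b * c \in H 4.
  by rewrite -(groupMl _ g4); apply: (mem_cycle_sub _ ga); apply: a_H4.
by rewrite groupMl ?b_H4 // (negPf (c_notin_H4 ip)).
Qed.

Lemma walk_det g h w : walk a b g w -> walk a b h w -> g = h.
Proof. by move=> gw hw; apply/(walk_fun exact gw hw); rewrite subrr; split=> //; apply: lattice_0. Qed.

Lemma iter_hexagon n : iter n (mcomp rot_hexagon) mone = (n%:R, 0)%R.
Proof. by elim: n => // n /= ->; rewrite /mcomp /= rotz_0 addr0 -mulrS. Qed.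

Lemma walk_ab : walk a b (a * b) (3, (1, 0))%R.
Proof.
have := walkM (walk_corner a b) (walk_hexagon a b).
by congr walk; rewrite /mcomp /= rotz_0 add0r; congr pair; apply: val_inj.
Qed.

(** Together with [walk_stab] this matches [H r] inside [<<[set a; b]>>] with the motions that
    stabilize level r of the base flag. *)
Lemma stab_walk r g u : (r < 5)%N -> walk a b g u -> stab r u -> g \in H r.
Proof.
move=> r5 gu; have [->|->|hr] := level_cases r5.
- by move=> _; apply: walk_G gu.
- by move=> _; apply: walk_H4 gu.
move/(_ hr) => us; case: r hr us {r5} => [|[|[|[|]]]] // _.
- rewrite !inE => /or3P[] /eqP eu; rewrite eu in gu.
  + by rewrite (walk_det gu (Walk1 a b)) group1.
  + by rewrite (walk_det gu (walk_corner a b)) b_H1.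
  + have b2 : walk a b (b ^+ 2) (4, (0, 1))%R.
      by have := walk_iter 2 (walk_corner a b); congr walk; congr pair; apply: val_inj.
    by rewrite (walk_det gu b2) groupX ?b_H1.
- rewrite !inE => /orP[] /eqP eu; rewrite eu in gu.
  + by rewrite (walk_det gu (Walk1 a b)) group1.
  + by rewrite (walk_det gu walk_ab) ab_H2.
- have rotH k : walk a b g (k, 0%R) -> g \in H 3.
    move=> gk; have := walk_iter k (walk_hexagon a b); rewrite iter_hexagon natr_Zp => ak.
    by rewrite (walk_det gk ak) groupX ?a_H3.
  move=> us; apply: (rotH u.1); suff <- : u = (u.1, 0%R) by [].
  by apply/eqP; move: u us {gu}; apply/allP; vm_compute.
Qed.

Lemma walk_stab r g : (r < 5)%N -> g \in H r -> g \in H 4 ->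
  exists2 u, walk a b g u & stab r u.
Proof.
move=> r5 gr g4; have [u gu] := gen_walk g4; have [e|e|hr] := level_cases r5.
- by exists u; rewrite // e.
- by exists u; rewrite // e.
case: r hr gr {r5} => [|[|[|[|]]]] // _ gr.
- have /cycleP[n ->] : g \in <[b]>.
    by case/and5P: ip => h _ _ _ _; apply: (fintype.subsetP h); rewrite inE gr.
  rewrite -(expg_mod n (exact_corner3 exact)).
  exists (iter (n %% 3) (mcomp rot_corner) mone); first exact/walk_iter/walk_corner.
  by have := ltn_pmod n (isT : 0 < 3)%N; case: (n %% 3)%N => [|[|[|]]].
- have [->|->] := cap_24 gr g4; first by exists mone; first exact: Walk1.
  by exists (3, (1, 0))%R; first exact: walk_ab.
- have /cycleP[n ->] := cap_34 gr g4.
  exists (n%:R, 0)%R; first by rewrite -iter_hexagon; apply/walk_iter/walk_hexagon.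
  by move=> _; move: (n%:R)%R; apply: Z6_case.
Qed.

Variables (s : nat) (F : set (set point)) (B : nat -> set point).
Variable (le : set point -> set point -> Prop).
Hypothesis tess : tessellation s F B le.

(** The isomorphism onto the torus map: the elements of a coset are unfolded to all motions over
    them, and by exactness the resulting faces form a single lattice orbit. *)
Definition torus_face (z : P) : set (set point) :=
  [set A | exists g w, [/\ walk a b g w, g \in cbody z & A = mset s w (B (cindex z))]].

Local Notation class A := [set translate t A | t in lattice (v *+ s)%R].

Lemma walk_lattice g w t : walk a b g w -> lattice v t -> walk a b g (mcomp (0%R, t) w).
Proof.
move=> gw lt; have [h hw] := walk_total a b (mcomp (0%R, t) w).
suff -> : g = h by [].
apply/(walk_fun exact gw hw); rewrite /mcomp /= add0r rotz0; split=> //.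
by rewrite addrC addKr.
Qed.

Lemma torus_faceE (z : P) g w : (cindex z < 5)%N -> walk a b g w -> g \in cbody z ->
  torus_face z = class (mset s w (B (cindex z))).
Proof.
move=> z5 gw gz; have [gG ez] := body_mem gz; apply/seteqP; split.
  move=> _ [h [w' [hw' hz ->]]]; have hg : h * g^-1 \in H (cindex z).
    by rewrite -mem_rcoset -ez.
  have [u hu su] := walk_stab z5 hg (groupM (walk_H4 hw') (groupVr (walk_H4 gw))).
  have := walkM gw hu; rewrite mulgKV => hwu.
  have /(walk_fun exact hwu hw')[e1 e2] : h = h by [].
  exists ((w'.2 - (mcomp w u).2) *+ s)%R; first by apply/lattice_scale; eexists; first exact: e2.
  rewrite -{1}(tess_stab tess z5 su) -mset_comp translate_mset; congr mset.
  move: e1; case: w' {hw' e2} => k t; case: (mcomp w u) => k' t' /= <-.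
  by rewrite /mcomp /= add0r rotz0 addrC subrK.
move=> _ [_ /lattice_scale[t lt ->] <-]; rewrite translate_mset.
by exists g, (mcomp (0%R, t) w); split=> //; apply: walk_lattice.
Qed.

Lemma section_facet (z : P) : (z <= x0)%O ->
  (cindex z < 5)%N /\ exists g w, walk a b g w /\ g \in cbody z.
Proof.
move=> /cleP[]; rewrite index_mkface ?group1 // body_mkface ?group1 // rcoset1 => i4 [g gz g4].
by split=> //; have [w gw] := gen_walk g4; exists g, w.
Qed.

Lemma torus_face_mem (z : P) g w u : (cindex z < 5)%N -> walk a b g w -> g \in cbody z ->
  mset s u (B (cindex z)) = mset s w (B (cindex z)) -> 
  forall h, walk a b h u -> h \in cbody z.
Proof.
move=> z5 gw gz /(tess_eq tess z5 z5)[_ su] h hu.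
have [_ ->] := body_mem gz; rewrite mem_rcoset.
exact: (stab_walk z5 (walkM (walkV exact gw) hu)).
Qed.

Lemma torus_face_bij :
  set_bij [set z : P | (\bot <= z <= x0)%O] (torus_quotient F (v *+ s)%R) torus_face.
Proof.
split.
- move=> z /andP[_ /section_facet[z5 [g [w [gw gz]]]]] /=.
  exists (mset s w (B (cindex z))); last by rewrite -(torus_faceE z5 gw gz).
  by apply/(tess_faces tess); exists (cindex z), w.
- move=> z z'; rewrite !inE /= => /andP[_ /section_facet[z5 [g [w [gw gz]]]]].
  move=> /andP[_ /section_facet[z5' [g' [w' [gw' gz']]]]] e.
  have : torus_face z' (mset s w (B (cindex z))) by rewrite -e; exists g, w.
  rewrite (torus_faceE z5' gw' gz') => -[_ /lattice_scale[t lt ->]]; rewrite translate_mset => et.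
  have [ii _] := tess_eq tess z5' z5 et; rewrite ii in et.
  have gtw := walk_lattice gw' lt.
  have : g \in cbody z' by apply: (torus_face_mem z5' gtw gz' _ gw); rewrite ii.
  by move=> gz2; apply: (body_meet (esym ii) gz gz2).
- move=> O [A /(tess_faces tess)[r [w [r5 ->]]] <-].
  have [g gw] := walk_total a b w; have gG := walk_G gw.
  have r6 : (r < 6)%N by apply: ltnW.
  have gz : g \in cbody (mkface r g) by rewrite body_mkface // rcoset_refl.
  exists (mkface r g) => /=.
    apply/andP; split; first exact: cbot_le.
    apply/cleP; rewrite !index_mkface ?group1 // !body_mkface ?group1 // rcoset1; split=> //.
    by exists g; rewrite ?rcoset_refl ?(walk_H4 gw).
  by rewrite (torus_faceE _ gw gz) index_mkface.
Qed.

(** The order [le] is a parameter so that the argument serves both facets, with inclusion of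
    hexagonal faces, and vertex-figures, with reversed inclusion of triangular ones. *)
Lemma torus_face_le (z y : P) : (z <= x0)%O -> (y <= x0)%O ->
  (z <= y)%O <-> exists A A', [/\ torus_face z A, torus_face y A' & le A A'].
Proof.
move=> zx yx; have [z5 [g [w [gw gz]]]] := section_facet zx.
have [y5 [g' [w' [gw' gy]]]] := section_facet yx; split.
  move=> zy; have [zyi _] := cleP _ _ zy.
  have [h [hz hy h4]] : exists h, [/\ h \in cbody z, h \in cbody y & h \in H 4].
    have [ei|ni] := eqVneq (cindex z) (cindex y).
      by exists g; rewrite gz (walk_H4 gw) -(le_index_eq zy ei); split.
    have [e4|n4] := eqVneq (cindex y) 4.
      have -> : y = x0 by apply: le_index_eq; rewrite ?index_mkface.
      by exists g; rewrite gz body_mkface ?group1 // rcoset1 (walk_H4 gw).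
    have [|h [hz hy]] := cle_between _ zy yx.
      by rewrite index_mkface ?group1 // !ltn_neqAle ni zyi n4 -ltnS.
    by rewrite body_mkface ?group1 // rcoset1 => h4; exists h.
  have [u hu] := gen_walk h4.
  exists (mset s u (B (cindex z))), (mset s u (B (cindex y))); split.
  - by exists h, u.
  - by exists h, u.
  - by apply/(tess_map tess)/(tess_mono tess); rewrite zyi.
move=> [_ [_ [[h [u [hu hz ->]]] [h' [u' [hu' hy ->]]] l]]].
have [zyi [x [ez ey]]] := tess_incidence tess z5 y5 l.
have [k kx] := walk_total a b x; apply/cleP; split=> //; exists k.
  exact: (torus_face_mem z5 hu hz ez kx).
exact: (torus_face_mem y5 hu' hy ey kx).
Qed.

End FacetSections.

Section CosetType.
Import GRing.Theory boolp classical_sets functions.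
Local Open Scope group_scope.
Local Open Scope classical_set_scope.
Local Notation point := Defs.point.

Lemma set_bij_perm (T : finType) (U : Type) (s : {perm T}) (X Y : set T) (M : set U) f :
  (forall z, X z <-> Y (s z)) -> set_bij Y M f -> set_bij X M (f \o s).
Proof.
move=> XY [fY fI fS]; split.
- by move=> z /XY; apply: fY.
- move=> z t; rewrite !inE => /XY zY /XY tY /fI; rewrite !inE => /(_ zY tY).
  exact: perm_inj.
- move=> u /fS[z zY <-]; exists (s^-1 z); last by rewrite /= permKV.
  by apply/XY; rewrite permKV.
Qed.

Variable D : rotary.
Local Notation gT := (rot_type D).
Local Notation a := (ra D).
Local Notation b := (rb D).
Local Notation c := (rc D).
Local Notation G := (cgroup D 0).
Local Notation P := (cface D).
Local Notation x0 := (mkface 4 (1 : gT) : P).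
Hypothesis ip : intersection_property D.
Variable v : point.
Hypothesis exact : exact_walks a b v.
Variable d : gT.
Hypotheses (da : a ^ d = c^-1) (db : b ^ d = b^-1) (dc : c ^ d = a^-1).

(** Any facet is translated to the base facet. A vertex-figure is carried by the duality to that
    facet with its order reversed, and the triangular tessellation is the hexagonal one with levels
    reversed, so the same walks describe it. *)
Lemma coset_of_type : of_type 4 P (torus_quotient hex_face (v *+ 3)%R) (torus_quotient tri_face v).
Proof.
have to1 (x : P) i : cindex x = i -> exists2 g, g \in G & translation g x = mkface i 1.
  move=> xi; have [g gG e] := cfaceP x; exists g^-1; first by rewrite groupV.
  by rewrite e translation_mkface ?groupV ?index_lt // mulgV xi.
have fr (x : P) (n : nat) : face_rank x = n%:Z%R -> cindex x = n.+1.
  rewrite face_rankE height_index => /(canRL (subrK _)).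
  by rewrite -[1%R]/(1%:Z)%R -PoszD addn1 => -[].
split=> x hx.
  have {}hx : cindex x = 4 by apply: fr; rewrite hx.
  have [g gG gx] := to1 x 4 hx; have /GammaP gm := translation_Gamma gG.
  have X z : (\bot <= z <= x)%O <-> (\bot <= translation g z <= x0)%O.
    by rewrite -gx gm !cbot_le.
  exists (torus_face 3 hex_level \o translation g).
    exact: set_bij_perm X (torus_face_bij ip exact hex_tessellation).
  move=> z t /X/andP[_ zx] /X/andP[_ tx]; rewrite -gm.
  have h := torus_face_le exact hex_tessellation zx tx; split.
    by case/h => A [B [fA fB AB]]; exists A, B.
  by move=> [A [B [fA fB AB]]]; apply/h; exists A, B.
have {}hx : cindex x = 1%N by apply: fr; rewrite hx.
have [g gG gx] := to1 x 1%N hx; have /GammaP gm := translation_Gamma gG.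
pose s := translation g * dual_perm da db dc.
have sd z t : (s z <= s t)%O = (t <= z)%O by rewrite !permM dual_perm_duality gm.
have sx : s x = x0.
  rewrite permM gx permE; have [e1 e2] := dual_faceE da db dc (mkface 1 1 : P).
  apply: cface_eq; rewrite ?e1 ?e2 ?index_mkface ?body_mkface ?group1 //.
  by rewrite !rcoset1 (cgroup_conj da db dc).
have X z : (x <= z <= \top)%O <-> (\bot <= s z <= x0)%O.
  by rewrite -sx sd cbot_le ctop_ge andbT.
exists (torus_face 1 tri_level \o s).
  exact: set_bij_perm X (torus_face_bij ip exact tri_tessellation).
move=> z t /X/andP[_ zx] /X/andP[_ tx]; rewrite -sd.
have h := torus_face_le exact tri_tessellation tx zx; split.
  by case/h => A [B [fA fB AB]]; exists B, A.
by move=> [A [B [fA fB AB]]]; apply/h; exists B, A.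
Qed.

End CosetType.

(** * The rotation group of a regular polytope with toroidal facets *)

Section RotationRelations.
Local Open Scope group_scope.
Variables (d : Order.disp_t) (Q : finTBPOrderType d) (Phi : {set Q}).
Hypotheses (Q_polytope : polytope 4 Q) (Q_regular : regular Q) (Phi_flag : flag Phi).
Local Notation rho := (rho Phi).
Local Notation s1 := (sigma Phi 1).
Local Notation s2 := (sigma Phi 2).
Local Notation s3 := (sigma Phi 3).

Let rr i : (i < 4)%N -> rho i * rho i = 1.
Proof. exact: (rho_inv Q_polytope Q_regular Phi_flag). Qed.

Lemma rotation_subgroupE : rotation_subgroup 4 Phi = <<[set s1; s2; s3]>>.
Proof.
congr <<_>>; apply/setP => g; rewrite !inE; apply/imsetP/idP.
  by case=> -[[|[|[|[|//]]]] i4]; rewrite inE //= => _ ->; rewrite eqxx ?orbT.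
case/orP=> [/orP[]|] /eqP->.
- by exists (Ordinal (isT : 1 < 4)%N); rewrite // inE.
- by exists (Ordinal (isT : 2 < 4)%N); rewrite // inE.
- by exists (Ordinal (isT : 3 < 4)%N); rewrite // inE.
Qed.

Lemma sigma12 : s1 * s2 = rho 0 * rho 2.
Proof. by rewrite /sigma /= -mulgA (mulgA (rho 1)) rr // mul1g. Qed.

Lemma sigma123 : s1 * s2 * s3 = rho 0 * rho 3.
Proof. by rewrite sigma12 /sigma /= -mulgA (mulgA (rho 2)) rr // mul1g. Qed.

Lemma sigma123_inv : s1 * s2 * s3 * (s1 * s2 * s3) = 1.
Proof.
have c03 : rho 0 * rho 3 = rho 3 * rho 0 by exact: (rho_comm Q_polytope Q_regular Phi_flag).
by rewrite sigma123 {2}c03 -mulgA (mulgA (rho 3)) rr // mul1g rr.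
Qed.

Let rV i : (i < 4)%N -> (rho i)^-1 = rho i.
Proof. exact: (rhoV Q_polytope Q_regular Phi_flag). Qed.

Lemma sigma_mirror : s1 ^ rho 2 = s1 * (s2 * s2) /\ s2 ^ rho 2 = s2^-1.
Proof.
have c02 : rho 0 * rho 2 = rho 2 * rho 0 by exact: (rho_comm Q_polytope Q_regular Phi_flag).
split; rewrite conjgE /sigma /= rV //.
  by rewrite !mulgA -c02 -(mulgA _ (rho 1) (rho 1)) rr // mulg1.
by rewrite invMg !rV // -(mulgA (rho 1)) rr // mulg1.
Qed.

Lemma sigma_dual (f : {perm Q}) : duality f -> f @: Phi = Phi ->
  [/\ s1 ^ f = s3^-1, s2 ^ f = s2^-1 & s3 ^ f = s1^-1].
Proof.
move=> fd fP; have dr i : (i < 4)%N -> rho i ^ f = rho (3 - i).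
  exact: (duality_rho Q_polytope Q_regular Phi_flag fd fP).
by split; rewrite /sigma /= conjMg !dr // invMg !rV.
Qed.

Lemma sigma23_vertex g : g \in <<[set s2; s3]>> -> g (face Phi 1%N) = face Phi 1%N.
Proof.
have rf i : (0 < i < 4)%N -> rho i (face Phi 1%N) = face Phi 1%N.
  by move=> /andP[i0 i4]; apply: (rho_face Q_polytope Q_regular Phi_flag) => //; rewrite eq_sym eqSS -lt0n.
case/gen_prodgP => n [h hS ->]; elim: n h hS => [|n IHn] h hS; first by rewrite big_ord0 perm1.
rewrite big_ord_recl permM; have /set2P[->|->] := hS ord0; rewrite /sigma permM !rf //.
  exact: IHn.
exact: IHn.
Qed.

End RotationRelations.

(** * Unfolding a facet of Q: exactness of the walks of its rotations *)

Section TorusFacet.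
Import Order.TTheory GRing.Theory boolp classical_sets functions.
Local Open Scope ring_scope.
Local Open Scope classical_set_scope.
Local Notation point := Defs.point.
Variables (d : Order.disp_t) (Q : finTBPOrderType d) (Phi : {set Q}).
Hypotheses (Q_polytope : polytope 4 Q) (Q_regular : regular Q) (Phi_flag : flag Phi).
Variable m : nat.
Hypothesis m_ge2 : (2 <= m)%N.
Hypothesis Q_type : of_type 4 Q (map63 m 0) (map36 m 0).
Local Notation s1 := (sigma Phi 1).
Local Notation s2 := (sigma Phi 2).
Local Notation v := ((m%:Z, 0) : point).
Local Notation B := hex_level.
Local Notation class A := [set translate t A | t in lattice (v *+ 3)].

Lemma m_lattice t : lattice v t -> (m%:Z %| t.1)%Z && (m%:Z %| t.2)%Z.
Proof.
move=> [i [j ->]]; rewrite /rot60 !pointMz /= oppr0 !mul0r addr0 !add0r.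
by rewrite addr0 !dvdz_mulr.
Qed.

Lemma unit_notin_lattice t : t \in [:: (1, 0); (0, 1); - (1, 0); - (0, 1)] -> ~ lattice v t.
Proof.
move=> ht /m_lattice; rewrite /dvdz.
by move: ht; rewrite !inE => /or4P[] /eqP-> /=; rewrite ?dvdn1 ?andbT ?andbF /=; case: m m_ge2 => [|[|]].
Qed.

Lemma class_refl A : class A A.
Proof.
exists 0; first exact: lattice_0.
by apply/seteqP; split=> [_ [x Ax <-]|x Ax]; [rewrite addr0 | exists x; rewrite // addr0].
Qed.

Lemma class_translate t A : lattice v t -> class (translate (t *+ 3) A) = class A.
Proof.
move=> lt; have tt x y X : translate x (translate y X) = translate (x + y) X.
  apply/seteqP; split=> [_ [_ [z Xz <-] <-]|_ [z Xz <-]].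
    by exists z => //; rewrite (addrC x) addrA.
  by exists (z + y); [exists z | rewrite (addrC x) addrA].
have l3 : lattice (v *+ 3) (t *+ 3) by apply/lattice_scale; exists t.
apply/seteqP; split=> _ [x lx <-].
  by exists (x + t *+ 3); rewrite ?tt //; apply: lattice_D.
exists (x - t *+ 3); first by apply: lattice_D => //; apply: lattice_N.
by rewrite tt subrK.
Qed.

Lemma class_eq r r' w w' : (r < 5)%N -> (r' < 5)%N ->
  class (mset 3 w (B r)) = class (mset 3 w' (B r')) ->
  r = r' /\ exists2 t, lattice v t & stab r (mcomp (minv w') (mcomp (0, t) w)).
Proof.
move=> r5 r5' e; have : class (mset 3 w (B r)) (mset 3 w' (B r')) by rewrite e; apply: class_refl.
case=> _ /lattice_scale[t lt ->]; rewrite translate_mset.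
by case/(tess_eq hex_tessellation r5 r5') => -> st; split=> //; exists t.
Qed.

(** Choice inverts the section isomorphism: [q w r] is the face of [x] corresponding to the lattice
    class of the r-th base face moved by [w]. What follows sees the type of Q only through these
    four properties. *)
Lemma torus_facet : exists (x : Q) (q : motion -> nat -> Q), [/\ (x < \top)%O,
  forall w r, (r < 5)%N -> (q w r <= x)%O,
  forall w w' r r', (r < 5)%N -> (r' < 5)%N -> mset 3 w (B r) `<=` mset 3 w' (B r') ->
    (q w r <= q w' r')%O
  & forall w w' r r', (r < 5)%N -> (r' < 5)%N ->
    q w r = q w' r' <-> class (mset 3 w (B r)) = class (mset 3 w' (B r'))].
Proof.
pose x := face Phi 4; have hx : height x = 4 by apply: (height_face Q_polytope).
have rx : face_rank x = 4%:Z - 1 by rewrite face_rankE hx.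
have [typ _] := Q_type; have [f [fF fI fS] fle] := typ x rx.
have ex (wr : motion * nat) : exists z : Q, (wr.2 < 5)%N ->
    (\bot <= z <= x)%O /\ f z = class (mset 3 wr.1 (B wr.2)).
  case: wr => w r /=; have [r5|r5] := boolP (r < 5)%N; last by exists x.
  have [z zx fz] : (f @` [set z : Q | (\bot <= z <= x)%O]) (class (mset 3 w (B r))).
    apply: fS; exists (mset 3 w (B r)) => //.
    by apply/(tess_faces hex_tessellation); exists r, w.
  by exists z => _; split.
have [q qP] := choice ex.
exists x, (fun w r => q (w, r)); split.
- rewrite lt_neqAle lex1 andbT; apply: contraTneq isT => e.
  have : (height x < height (face Phi 5))%N.
    by apply/height_lt/(face_lt Q_polytope).
  by rewrite (face_last Q_polytope Phi_flag) -e ltnn.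
- by move=> w r r5; have [/andP[]] := qP (w, r) r5.
- move=> w w' r r' r5 r5' AB; have [zx ez] := qP (w, r) r5; have [zx' ez'] := qP (w', r') r5'.
  apply/(fle _ _ zx zx'); exists (mset 3 w (B r)), (mset 3 w' (B r')).
  by rewrite ez ez'; split=> //; apply: class_refl.
- move=> w w' r r' r5 r5'; have [zx ez] := qP (w, r) r5; have [zx' ez'] := qP (w', r') r5'.
  split=> [e|e]; first by move: ez; rewrite e ez'.
  by apply: fI; rewrite ?inE //= ez ez'.
Qed.

Variables (x : Q) (q : motion -> nat -> Q).
Hypothesis x_top : (x < \top)%O.
Hypothesis q_le : forall w r, (r < 5)%N -> (q w r <= x)%O.
Hypothesis q_mono : forall w w' r r', (r < 5)%N -> (r' < 5)%N ->
  mset 3 w (B r) `<=` mset 3 w' (B r') -> (q w r <= q w' r')%O.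
Hypothesis q_eq : forall w w' r r', (r < 5)%N -> (r' < 5)%N ->
  q w r = q w' r' <-> class (mset 3 w (B r)) = class (mset 3 w' (B r')).

Definition qstair (W : nat -> motion) (i : nat) : Q := if (i < 5)%N then q (W i) i else \top%O.
Definition qflag (W : nat -> motion) : {set Q} := [set qstair W i | i : 'I_6]%SET.

(** The motion may vary with the level; this allows the intermediate flags, which take faces from
    two different base flags. *)
Definition coherent (W : nat -> motion) : Prop := forall i, (i < 4)%N ->
  mset 3 (W i) (B i) `<=` mset 3 (W i.+1) (B i.+1).

Lemma qflagP W : coherent W ->
  flag (qflag W) /\ forall i, (i < 6)%N -> face (qflag W) i = qstair W i.
Proof.
move=> cW; apply: (stair_flag Q_polytope) => i; rewrite ltnS leq_eqVlt => /predU1P[->|i4].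
  by rewrite /qstair /=; apply: le_lt_trans (q_le _ _) x_top.
have i5 : (i < 5)%N by apply: leqW.
have i5' : (i.+1 < 5)%N by [].
rewrite /qstair i5 i5' lt_neqAle q_mono ?andbT //; last exact: cW.
by apply/eqP => /(q_eq _ _ i5 i5')/(class_eq i5 i5')[/eqP]; rewrite ltn_eqF.
Qed.

Lemma q_same w u r : (r < 5)%N -> stab r u -> q (mcomp w u) r = q w r.
Proof.
by move=> r5 su; apply/q_eq => //; rewrite mset_comp (tess_stab hex_tessellation r5 su).
Qed.

Lemma q_diff w u r : (r < 5)%N ->
  (forall t, lattice v t -> ~ stab r (u.1, u.2 + t)) -> q w r != q (mcomp w u) r.
Proof.
move=> r5 h; apply/eqP => /esym /(q_eq _ _ r5 r5)/(class_eq r5 r5)[_ [t lt]].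
have -> : mcomp (minv w) (mcomp (0, t) (mcomp w u)) = (u.1, u.2 + rotz (- w.1) t).
  rewrite /mcomp /minv /= !add0r addKr; congr pair.
  rewrite rotz0 !rotz_additive -rotzD addNr rotz0 -!addrA; congr (_ + _).
  by rewrite addrCA subrr addr0.
by apply: h; apply: lattice_rotz.
Qed.

Lemma qnadj W W' i : (i < 4)%N -> coherent W -> coherent W' ->
  (forall j, (j < 5)%N -> j != i.+1 -> q (W j) j = q (W' j) j) ->
  q (W i.+1) i.+1 != q (W' i.+1) i.+1 -> nadj 4 i (qflag W) (qflag W').
Proof.
move=> i4 cW cW' same dif; have [fW hW] := qflagP cW; have [fW' hW'] := qflagP cW'.
split=> // j j6; rewrite hW // hW' // /qstair; case: ifP => j5; last first.
  by rewrite eqxx; apply/esym; apply: contraFneq j5 => ->.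
have [->|ji] := eqVneq j i.+1; first exact: negPf.
by rewrite same // eqxx.
Qed.

Lemma coherent_const w : coherent (fun=> w).
Proof.
move=> i i4; apply: msetS; apply: (tess_mono hex_tessellation).
by rewrite leqnSn.
Qed.

Definition base_flag w := qflag (fun=> w).

(** The rotation fixes the hexagon, so it suffices to exchange the edge and then the vertex; the
    intermediate flag takes only its edge from the rotated flag. *)
Lemma base_flag_hexagon w : exists A,
  nadj 4 1 (base_flag w) A /\ nadj 4 0 A (base_flag (mcomp w rot_hexagon)).
Proof.
pose W (i : nat) := if i == 2%N then mcomp w rot_hexagon else w.
have cW : coherent W.
  case=> [|[|[|[|//]]]] _; rewrite /W /=.
  - exact: (@coherent_const w 0%N).
  - rewrite mset_comp; apply: msetS => z; rewrite /hex_level /= inE => /eqP->.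
    by exists (2, -1) => //; rewrite inE.
  - rewrite mset_comp; apply: msetS; rewrite -[X in _ `<=` X](@tess_stab _ _ _ _ hex_tessellation 3 rot_hexagon) //.
    by apply: msetS; apply: (tess_mono hex_tessellation).
  - exact: (@coherent_const w 3).
exists (qflag W); split.
  apply: qnadj => //; first exact: coherent_const.
    by case=> [|[|[|[|[|]]]]].
  by apply: q_diff => // t _ /(_ isT); rewrite !inE => /orP[] /eqP[].
apply: qnadj => //; first exact: coherent_const.
  by case=> [|[|[|[|[|]]]]] // _ _; rewrite /W /= q_same.
by rewrite /W /=; apply: q_diff => // t _ /(_ isT); rewrite !inE => /or3P[] /eqP[].
Qed.

(** The rotation fixes the vertex, so the hexagon is exchanged and then the edge. *)
Lemma base_flag_corner w : exists A,
  nadj 4 2 (base_flag w) A /\ nadj 4 1 A (base_flag (mcomp w rot_corner)).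
Proof.
pose W (i : nat) := if i == 3%N then mcomp w rot_corner else w.
have cW : coherent W.
  case=> [|[|[|[|//]]]] _; rewrite /W /=.
  - exact: (@coherent_const w 0%N).
  - exact: (@coherent_const w 1%N).
  - rewrite mset_comp; apply: msetS => z; rewrite /hex_level /= !inE => /orP[] /eqP->.
      by exists (1, 1).
    by exists (-1, 2).
  - by rewrite /hex_level /= msetT.
exists (qflag W); split.
  apply: qnadj => //; first exact: coherent_const.
    by case=> [|[|[|[|[|]]]]].
  (* The two hexagons at the edge stay distinct in the torus because [m_ge2] keeps unit vectors out
     of the lattice. *)
  apply: q_diff => // t lt /(_ isT) /= h; apply: (@unit_notin_lattice t) => //.
  have -> : t = - (1, 0).
    have /allP/(_ _ h)/eqP/= h0 : all (fun u : motion => u.2 == 0) (stabilizer 3) by [].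
    by apply/eqP; rewrite -addr_eq0 addrC h0.
  by rewrite !inE eqxx ?orbT.
apply: qnadj => //; first exact: coherent_const.
  by case=> [|[|[|[|[|]]]]] // _ _; rewrite /W /= q_same.
by rewrite /W /=; apply: q_diff => // t _ /(_ isT); rewrite !inE => /orP[] /eqP[].
Qed.

Variable h : {perm Q}.
Hypotheses (hG : h \in Gamma Q) (h_base : (h @: Phi)%SET = base_flag mone).

(** Connects the two readings of a word: its value moves the flag of [h] as its motion moves the
    base flag of the tessellation, by [sigma_step] along the two-step paths above. *)
Lemma walk_base_flag g w : walk s1 s2 g w -> g \in Gamma Q /\ ((g * h)%g @: Phi)%SET = base_flag w.
Proof.
elim=> [|g' u _ [gG IH]|g' u _ [gG IH]].
- by rewrite group1 mul1g.
- have s1G := sigma_Gamma Q_polytope Q_regular Phi_flag (isT : 0 < 1 < 4)%N.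
  have ghG : (g' * h)%g \in Gamma Q by rewrite groupM.
  have [A [a1 a2]] := base_flag_hexagon u; rewrite groupM //; split=> //; rewrite -mulgA.
  by rewrite -IH in a1; exact: (sigma_step Q_polytope Q_regular Phi_flag (i:=1%N) isT ghG a1 a2).
- have s2G := sigma_Gamma Q_polytope Q_regular Phi_flag (isT : 0 < 2 < 4)%N.
  have ghG : (g' * h)%g \in Gamma Q by rewrite groupM.
  have [A [a1 a2]] := base_flag_corner u; rewrite groupM //; split=> //; rewrite -mulgA.
  by rewrite -IH in a1; exact: (sigma_step Q_polytope Q_regular Phi_flag (i:=2%N) isT ghG a1 a2).
Qed.

Lemma q_mone_eq w r : (r < 5)%N -> q w r = q mone r ->
  exists2 t, lattice v t & stab r (w.1, w.2 + t).
Proof.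
move=> r5 /(q_eq _ _ r5 r5)/(class_eq r5 r5)[_ [t lt]].
have -> : mcomp (minv mone) (mcomp (0, t) w) = (w.1, w.2 + t).
  by rewrite /mcomp /minv /= oppr0 !add0r !rotz0 oppr0 addr0.
by exists t.
Qed.

Lemma vertex_stab g w : walk s1 s2 g w -> g (face Phi 1%N) = face Phi 1%N ->
  exists2 t, lattice v t & (w.1, w.2 + t) \in stabilizer 1.
Proof.
move=> gw gf; have [gG e] := walk_base_flag gw.
have [_ hq] := qflagP (@coherent_const w); have [_ hq1] := qflagP (@coherent_const mone).
have := hq 1%N isT; rewrite -/(base_flag w) -e (Gamma_face Q_polytope) ?groupM // permM gf.
rewrite -(Gamma_face Q_polytope) // h_base hq1 // /qstair /= => /esym.
by case/q_mone_eq => // t lt st; exists t => //; apply: st.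
Qed.

(** Over the identity, the face of index 3 forces the translation part into the lattice, and the
    face of index 1 excludes a nontrivial rotation, which would put a unit vector into it. The
    converse is freeness of the action on flags. *)
Lemma sigma_exact_walks_aux : exact_walks s1 s2 v.
Proof.
move=> g w gw; have [gG e] := walk_base_flag gw.
have [fw hq] := qflagP (@coherent_const w); have [f1 hq1] := qflagP (@coherent_const mone).
split=> [g1|[w1 w2]].
  have qq r : (r < 5)%N -> q w r = q mone r.
    move=> r5; have r6 : (r < 6)%N by apply: leqW.
    have := hq r r6; rewrite -/(base_flag w) -e g1 mul1g h_base hq1 //.
    by rewrite /qstair r5.
  have [t lt /(_ isT) h3] := q_mone_eq (isT : 3 < 5)%N (qq 3 isT).
  have [t' lt' /(_ isT) h1] := q_mone_eq (isT : 1 < 5)%N (qq 1%N isT).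
  have wt : w.2 + t = 0.
    have /allP/(_ _ h3)/eqP // : all (fun u : motion => u.2 == 0) (stabilizer 3) by [].
  have lw : lattice v w.2.
    by rewrite -[w.2](addrK t) wt add0r; apply: lattice_N.
  split=> //; have lwt : lattice v (w.2 + t') by apply: lattice_D.
  move: h1; rewrite !inE => /or3P[] /eqP e3; have := congr1 fst e3; have /= wt' := congr1 snd e3 => //.
    by case: (@unit_notin_lattice (w.2 + t')); rewrite // wt' !inE eqxx.
  by case: (@unit_notin_lattice (w.2 + t')); rewrite // wt' !inE eqxx ?orbT.
have e1 : base_flag w = base_flag mone.
  apply: (flag_eq Q_polytope fw f1) => i i6; rewrite hq // hq1 // /qstair; case: ifP => // i5.
  apply/q_eq => //; have -> : w = mcomp (0, w.2) mone by rewrite mcomp1 -w1 -surjective_pairing.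
  by rewrite -translate_mset class_translate.
suff: (g * h)%g = h by move/(canRL (mulgK h)); rewrite mulgV.
by apply: (Gamma_eq Q_polytope Phi_flag); rewrite ?groupM // e e1 h_base.
Qed.

End TorusFacet.

Section FacetWalks.
Local Notation point := Defs.point.
Variables (d : Order.disp_t) (Q : finTBPOrderType d) (Phi : {set Q}).
Hypotheses (Q_polytope : polytope 4 Q) (Q_regular : regular Q) (Phi_flag : flag Phi).
Variable m : nat.
Hypothesis m_ge2 : (2 <= m)%N.
Hypothesis Q_type : of_type 4 Q (map63 m 0) (map36 m 0).

Lemma sigma_exact_walks : exact_walks (sigma Phi 1) (sigma Phi 2) (m%:Z, 0)%R /\
  forall g w, walk (sigma Phi 1) (sigma Phi 2) g w -> g (face Phi 1) = face Phi 1 ->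
    exists2 t, lattice (m%:Z, 0)%R t & (w.1, w.2 + t)%R \in stabilizer 1.
Proof.
have [x [q [x_top q_le q_mono q_eq]]] := torus_facet Q_polytope Phi_flag Q_type.
have [fb _] := qflagP Q_polytope x_top q_le q_mono q_eq (@coherent_const mone).
(* The base flag of the torus need not be [Phi]; regularity supplies an automorphism between
   them. *)
have [h hG hb] := regular_ex Q_regular Phi_flag fb.
split; first exact (sigma_exact_walks_aux Q_polytope Q_regular Phi_flag m_ge2 x_top q_le q_mono q_eq hG hb).
exact (vertex_stab Q_polytope Q_regular Phi_flag m_ge2 x_top q_le q_mono q_eq hG hb).
Qed.

End FacetWalks.

(** * The group L2 over a prime field *)

Section TwoByTwo.
Import GRing.Theory.
Local Open Scope ring_scope.
Variable F : finFieldType.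
Implicit Types (x y z t : F).

(** [SL2] over an arbitrary finite field. At ['F_p] the two are convertible, which lets the final
    statement speak of [L2 p]. *)
Definition SLF : {set {'GL_2[F]}} := [set u | \det (GLval u) == 1].

Lemma SLF_group_set : group_set SLF.
Proof.
apply/group_setP; split=> [|u v]; first by rewrite inE GL_1E det1.
by rewrite !inE GL_ME det_mulmx => /eqP-> /eqP->; rewrite mulr1.
Qed.

Canonical SLF_group := Group SLF_group_set.

Definition LF : {set coset_of 'Z(SLF)%g} := (SLF / 'Z(SLF))%g.

Definition mx2 x y z t : 'M[F]_2 :=
  \matrix_(i, j) (if i == 0 then if j == 0 then x else y else if j == 0 then z else t).

Lemma mx2E (A : 'M[F]_2) : A = mx2 (A 0 0) (A 0 1) (A 1 0) (A 1 1).
Proof.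
apply/matrixP => i j; rewrite mxE.
by case: i j => [[|[|//]] hi] [[|[|//]] hj] /=; congr (A _ _); apply: val_inj.
Qed.

Lemma mx2_mul x y z t x' y' z' t' :
  mx2 x y z t *m mx2 x' y' z' t' =
  mx2 (x * x' + y * z') (x * y' + y * t') (z * x' + t * z') (z * y' + t * t').
Proof.
apply/matrixP => i j; rewrite !mxE big_ord_recl big_ord1 !mxE /=.
by case: (i == 0); case: (j == 0).
Qed.

Lemma mx2_det x y z t : \det (mx2 x y z t) = x * t - y * z.
Proof.
rewrite (expand_det_row _ 0) big_ord_recl big_ord1 /cofactor !det_mx11 !mxE /=.
by rewrite /bump /= expr0 expr1 mul1r mulN1r mulrN.
Qed.

Lemma mx2_1 : 1 = mx2 1 0 0 1.
Proof.
by apply/matrixP => i j; rewrite !mxE; case: i j => [[|[|//]] ?] [[|[|//]] ?].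
Qed.

Lemma mx2_inj x y z t x' y' z' t' : mx2 x y z t = mx2 x' y' z' t' ->
  [/\ x = x', y = y', z = z' & t = t'].
Proof.
move=> e; split.
- by move/matrixP/(_ 0 0): e; rewrite !mxE.
- by move/matrixP/(_ 0 1): e; rewrite !mxE.
- by move/matrixP/(_ 1 0): e; rewrite !mxE.
- by move/matrixP/(_ 1 1): e; rewrite !mxE.
Qed.

Definition gl2 x y z t : {'GL_2[F]} := insubd (1%g : {'GL_2[F]}) (mx2 x y z t).

Lemma gl2_val x y z t : x * t - y * z != 0 -> GLval (gl2 x y z t) = mx2 x y z t.
Proof.
move=> h; have u : mx2 x y z t \in unitmx by rewrite unitmxE mx2_det unitfE.
by rewrite -[GLval _]/(val _) insubdK.
Qed.

Lemma GLval_inj : injective (@GLval 2 F).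
Proof. exact: val_inj. Qed.

Lemma gl2M x y z t x' y' z' t' : x * t - y * z != 0 -> x' * t' - y' * z' != 0 ->
  (gl2 x y z t * gl2 x' y' z' t')%g =
  gl2 (x * x' + y * z') (x * y' + y * t') (z * x' + t * z') (z * y' + t * t').
Proof.
move=> h h'; have nz : (x * x' + y * z') * (z * y' + t * t') -
    (x * y' + y * t') * (z * x' + t * z') != 0.
  have -> : (x * x' + y * z') * (z * y' + t * t') - (x * y' + y * t') * (z * x' + t * z') =
    (x * t - y * z) * (x' * t' - y' * z') by ring.
  exact: mulf_neq0.
apply: GLval_inj; rewrite (gl2_val nz) -mx2_mul -(gl2_val h) -(gl2_val h').
exact: GL_MxE.
Qed.

Lemma gl2_SL2 x y z t : x * t - y * z = 1 -> gl2 x y z t \in SLF.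
Proof.
move=> h; have nz : x * t - y * z != 0 by rewrite h oner_eq0.
by rewrite inE (gl2_val nz) mx2_det h.
Qed.

Lemma SL2P (u : {'GL_2[F]}) : u \in SLF ->
  exists x y z t, x * t - y * z = 1 /\ u = gl2 x y z t.
Proof.
rewrite inE => /eqP; rewrite [GLval u]mx2E mx2_det => h.
exists (GLval u 0 0), (GLval u 0 1), (GLval u 1 0), (GLval u 1 1); split=> //.
have nz : GLval u 0 0 * GLval u 1 1 - GLval u 0 1 * GLval u 1 0 != 0 by rewrite h oner_eq0.
by apply: GLval_inj; rewrite (gl2_val nz) -mx2E.
Qed.

Lemma gl2_inj x y z t x' y' z' t' : x * t - y * z != 0 -> x' * t' - y' * z' != 0 ->
  gl2 x y z t = gl2 x' y' z' t' -> [/\ x = x', y = y', z = z' & t = t'].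
Proof.
move=> h h' /(congr1 (@GLval 2 F)); rewrite (gl2_val h) (gl2_val h').
exact: mx2_inj.
Qed.

Lemma gl2_1 : gl2 1 0 0 1 = 1%g.
Proof.
have nz : (1 : F) * 1 - 0 * 0 != 0 by rewrite mulr0 subr0 mulr1 oner_eq0.
by apply: GLval_inj; rewrite (gl2_val nz) -mx2_1.
Qed.

Lemma gl2V x y z t : x * t - y * z = 1 -> (gl2 x y z t)^-1%g = gl2 t (- y) (- z) x.
Proof.
move=> h; have h' : t * x - - y * - z = 1 by rewrite -h; ring.
have nz : x * t - y * z != 0 by rewrite h oner_eq0.
have nz' : t * x - - y * - z != 0 by rewrite h' oner_eq0.
apply/eqP; rewrite eq_invg_mul (gl2M nz nz') -gl2_1; apply/eqP.
by congr gl2; rewrite -?h; ring.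
Qed.

(** Commuting with two elementary transvections already forces a scalar matrix. *)
Lemma center_SL2P x y z t : x * t - y * z = 1 ->
  reflect [/\ y = 0, z = 0 & x = t] (gl2 x y z t \in 'Z(SLF)%g).
Proof.
move=> h; have nz := oner_neq0 F; apply: (iffP (centerP _ _)).
  move=> [_ comm].
  have u1 : (1 : F) * 1 - 1 * 0 = 1 by ring.
  have l1 : (1 : F) * 1 - 0 * 1 = 1 by ring.
  have cu := comm _ (gl2_SL2 u1); have cl := comm _ (gl2_SL2 l1).
  have d1 : x * 1 + y * 0 = x by ring.
  rewrite /commute !gl2M ?h ?u1 ?l1 // in cu cl.
  have dd x1 y1 z1 t1 x2 y2 z2 t2 : x1 * t1 - y1 * z1 = 1 -> x2 * t2 - y2 * z2 = 1 ->
    (x1 * x2 + y1 * z2) * (z1 * y2 + t1 * t2) - (x1 * y2 + y1 * t2) * (z1 * x2 + t1 * z2) != 0 :> F.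
    move=> h1 h2; have -> : (x1 * x2 + y1 * z2) * (z1 * y2 + t1 * t2) - (x1 * y2 + y1 * t2) * (z1 * x2 + t1 * z2) =
      (x1 * t1 - y1 * z1) * (x2 * t2 - y2 * z2) by ring.
    by rewrite h1 h2 mulr1.
  have [e1 e2 _ _] := gl2_inj (dd _ _ _ _ _ _ _ _ h u1) (dd _ _ _ _ _ _ _ _ u1 h) cu.
  have [f1 _ _ _] := gl2_inj (dd _ _ _ _ _ _ _ _ h l1) (dd _ _ _ _ _ _ _ _ l1 h) cl.
  have z0 : z = 0 by apply: (addrI x); move: e1; rewrite !mulr1 !mul1r !mulr0 !addr0 => <-.
  have y0 : y = 0 by apply: (addrI x); move: f1; rewrite !mulr1 !mul1r !mul0r !addr0.
  split=> //; apply: (addIr y).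
  by move: e2; rewrite !mulr1 !mul1r => ->; rewrite addrC.
move=> [y0 z0 xt]; split; first exact: gl2_SL2.
move=> _ /SL2P[x' [y' [z' [t' [h' ->]]]]]; rewrite /commute !gl2M ?h ?h' //.
by rewrite y0 z0 xt; congr gl2; ring.
Qed.

Definition pgl x y z t : coset_of 'Z(SLF)%g := coset 'Z(SLF)%g (gl2 x y z t).

Lemma eq_pgl x y z t x' y' z' t' :
  x = x' -> y = y' -> z = z' -> t = t' -> pgl x y z t = pgl x' y' z' t'.
Proof. by move=> -> -> -> ->. Qed.

Lemma SL2_norm : (SLF \subset 'N('Z(SLF)))%g.
Proof. exact: (normal_norm (center_normal (SLF_group))). Qed.

Lemma pgl_L2 x y z t : x * t - y * z = 1 -> pgl x y z t \in LF.
Proof. by move=> h; apply: mem_quotient; apply: gl2_SL2. Qed.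

Lemma L2P g : g \in LF -> exists x y z t, x * t - y * z = 1 /\ g = pgl x y z t.
Proof.
case/morphimP => u _ /SL2P[x [y [z [t [h ->]]]]] ->.
by exists x, y, z, t.
Qed.

Lemma pglM x y z t x' y' z' t' : x * t - y * z = 1 -> x' * t' - y' * z' = 1 ->
  (pgl x y z t * pgl x' y' z' t')%g =
  pgl (x * x' + y * z') (x * y' + y * t') (z * x' + t * z') (z * y' + t * t').
Proof.
move=> h h'; rewrite /pgl -morphM ?(subsetP SL2_norm) ?gl2_SL2 //.
by rewrite gl2M ?h ?h' ?oner_eq0.
Qed.

Lemma pglV x y z t : x * t - y * z = 1 -> (pgl x y z t)^-1%g = pgl t (- y) (- z) x.
Proof. by move=> h; rewrite /pgl -morphV ?(subsetP SL2_norm) ?gl2_SL2 // gl2V. Qed.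

Lemma pgl_eq1 x y z t : x * t - y * z = 1 ->
  pgl x y z t = 1%g <-> [/\ y = 0, z = 0 & x = t].
Proof.
move=> h; have nu := subsetP SL2_norm _ (gl2_SL2 h); split.
  by move/(coset_idr nu)/(center_SL2P h).
by move/(center_SL2P h)/coset_id.
Qed.

Definition upper x := pgl 1 x 0 1.
Definition lower x := pgl 1 0 x 1.

Lemma det_upper x : 1 * 1 - x * 0 = 1 :> F. Proof. by ring. Qed.
Lemma det_lower x : 1 * 1 - 0 * x = 1 :> F. Proof. by ring. Qed.

Lemma upperD x y : (upper x * upper y)%g = upper (x + y).
Proof. by rewrite /upper (pglM (det_upper x) (det_upper y)); apply: eq_pgl; ring. Qed.

Lemma lowerD x y : (lower x * lower y)%g = lower (x + y).
Proof. by rewrite /lower (pglM (det_lower x) (det_lower y)); apply: eq_pgl; ring. Qed.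

Hypothesis F_prime : forall x : F, exists n : nat, x = n%:R.

(** In a prime field every element is a natural multiple of [x], so the powers of one nontrivial
    transvection exhaust its root subgroup. *)
Lemma upper_closed (K : {group coset_of 'Z(SLF)%g}) x y : x != 0 -> upper x \in K -> upper y \in K.
Proof.
move=> x0 xK; have u0 : upper 0 = 1%g by apply/pgl_eq1; rewrite ?det_upper.
suff h n : upper (x *+ n) \in K by rewrite -[y](mulfVK x0); have [n ->] := F_prime (y / x); rewrite mulr_natl.
by elim: n => [|n IHn]; rewrite ?mulr0n ?u0 ?group1 // mulrS -upperD groupM.
Qed.

Lemma lower_closed (K : {group coset_of 'Z(SLF)%g}) x y : x != 0 -> lower x \in K -> lower y \in K.
Proof.
move=> x0 xK; have u0 : lower 0 = 1%g by apply/pgl_eq1; rewrite ?det_lower.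
suff h n : lower (x *+ n) \in K by rewrite -[y](mulfVK x0); have [n ->] := F_prime (y / x); rewrite mulr_natl.
by elim: n => [|n IHn]; rewrite ?mulr0n ?u0 ?group1 // mulrS -lowerD groupM.
Qed.

(** A matrix with nonzero lower left entry factors as upper, lower, upper transvection; otherwise
    multiplication by [lower 1] makes that entry nonzero. *)
Lemma L2_transvections (K : {group coset_of 'Z(SLF)%g}) x y : x != 0 -> y != 0 ->
  upper x \in K -> lower y \in K -> LF \subset K.
Proof.
move=> x0 y0 xK yK; have UK s := upper_closed s x0 xK; have LK s := lower_closed s y0 yK.
have main a b c d : c != 0 -> a * d - b * c = 1 -> pgl a b c d \in K.
  move=> c0 h.
  pose s := (a - 1) / c; pose s' := (d - 1) / c.
  have -> : pgl a b c d = (upper s * lower c * upper s')%g.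
    have h1 : (1 * 1 + s * c) * (0 * 0 + 1 * 1) - (1 * 0 + s * 1) * (0 * 1 + 1 * c) = 1 by ring.
    rewrite /upper /lower (pglM (det_upper s) (det_lower c)) (pglM h1 (det_upper s')).
    have -> : b = (a * d - 1) / c by rewrite -h; field.
    by rewrite /s /s'; apply: eq_pgl; field.
  by rewrite !groupM.
apply/subsetP => _ /L2P[a [b [c [d [h ->]]]]].
have [c0|c0] := eqVneq c 0; last exact: main.
have d0 : d != 0.
  by apply: contra_eq_neq h => ->; rewrite c0 !mulr0 subr0 eq_sym oner_eq0.
rewrite -(groupMr _ (LK 1)) /lower (pglM h (det_lower 1)) main //.
  by rewrite c0 mul0r mulr1 add0r.
by rewrite -[RHS]h; ring.
Qed.

End TwoByTwo.

(** * Simplicity and trivial centre of L2 *)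

Section LFSimple.
Import GRing.Theory.
Local Open Scope ring_scope.
Variable F : finFieldType.
Implicit Types (x y z t : F).
Hypothesis F_prime : forall x : F, exists n : nat, x = n%:R.
Local Notation SLF := (SLF F).
Local Notation LF := (LF F).

Lemma conj_pgl x y z t x' y' z' t' : x * t - y * z = 1 -> x' * t' - y' * z' = 1 ->
  (pgl x y z t ^ pgl x' y' z' t')%g =
  pgl (t' * (x * x' + y * z') - y' * (z * x' + t * z')) (t' * (x * y' + y * t') - y' * (z * y' + t * t'))
      (x' * (z * x' + t * z') - z' * (x * x' + y * z')) (x' * (z * y' + t * t') - z' * (x * y' + y * t')).
Proof.
move=> h h'; have h1 : (x * x' + y * z') * (z * y' + t * t') - (x * y' + y * t') * (z * x' + t * z') = 1.
  by rewrite -[RHS]mulr1 -{1}h -h'; ring.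
have h2 : t' * x' - - y' * - z' = 1 by rewrite -h'; ring.
rewrite conjgE (pglV h') (pglM h h') (pglM h2 h1).
by apply: eq_pgl; ring.
Qed.

Lemma comm_pgl x y z t x' y' z' t' : x * t - y * z = 1 -> x' * t' - y' * z' = 1 ->
  ((pgl x y z t)^-1 * pgl x' y' z' t')%g =
  pgl (t * x' - y * z') (t * y' - y * t') (x * z' - z * x') (x * t' - z * y').
Proof.
move=> h h'; have h2 : t * x - - y * - z = 1 by rewrite -h; ring.
by rewrite (pglV h) (pglM h2 h'); apply: eq_pgl; ring.
Qed.

(* A non-trivial normal subgroup contains a non-trivial upper transvection,
   obtained from commutators with diagonal and unipotent elements. *)
Lemma LF_simple (alpha : F) (M : {group coset_of 'Z(SLF)%g}) : alpha != 0 -> alpha ^+ 4 != 1 ->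
  M \subset LF -> (LF \subset 'N(M))%g -> M :!=: 1%g -> M :=: LF.
Proof.
move=> a0 a4 sM nM /trivgPn[g0 g0M g0_neq1].
have MJ g h : g \in M -> h \in LF -> (g ^ h)%g \in M.
  by move=> gM hL; rewrite memJ_norm // (subsetP nM).
have Jdet : 0 * 0 - 1 * -1 = 1 :> F by ring.
have key s : s != 0 -> upper s \in M -> M :=: LF.
  move=> s0 sMem; apply/eqP; rewrite eqEsubset sM.
  have s0' : - s != 0 by rewrite oppr_eq0.
  apply: (L2_transvections F_prime s0 s0') => //.
  pose J : coset_of 'Z(SLF)%g := pgl 0 1 (-1) 0; have -> : lower (- s) = (upper s ^ J)%g.
    by rewrite /upper /J (conj_pgl (det_upper s) Jdet); apply: eq_pgl; ring.
  exact: MJ (pgl_L2 Jdet).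
(* The commutator of a triangular element with [upper 1] is a transvection, nontrivial as soon as
   [a ^+ 2 != 1]. *)
have tri a b : a != 0 -> a ^+ 2 != 1 -> pgl a b 0 a^-1 \in M -> M :=: LF.
  move=> a0' a2 aM; have h : a * a^-1 - b * 0 = 1 by field.
  apply: (key (1 - a^-1 ^+ 2)).
    rewrite subr_eq0 eq_sym; apply: contra_neq a2 => e.
    have : a ^+ 2 * a^-1 ^+ 2 = 1 by field.
    by rewrite e mulr1.
  pose A : coset_of 'Z(SLF)%g := pgl a b 0 a^-1; pose U : coset_of 'Z(SLF)%g := upper 1.
  suff -> : upper (1 - a^-1 ^+ 2) = (A^-1 * A ^ U)%g.
    by rewrite groupM ?groupV // MJ // pgl_L2 // det_upper.
  rewrite /upper /A /U (conj_pgl h (det_upper 1)) (comm_pgl h); last by field.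
  by apply: eq_pgl; field.
(* Conjugation by [upper (x / z)] clears the upper left entry. The commutator with the diagonal
   element of [alpha] is then triangular with diagonal entry [alpha ^+ 2], which is why
   [alpha ^+ 4 != 1] is asked. *)
have low x y z t : z != 0 -> x * t - y * z = 1 -> pgl x y z t \in M -> M :=: LF.
  move=> z0 h gM; pose s := x / z.
  have h' : 0 * (x + t) - - z^-1 * z = 1 by field.
  have gM' : pgl 0 (- z^-1) z (x + t) \in M.
    suff -> : pgl 0 (- z^-1) z (x + t) = (pgl x y z t ^ upper s)%g.
      by rewrite MJ // pgl_L2 // det_upper.
    have ey : y = (x * t - 1) / z by rewrite -h; field.
    by rewrite /upper (conj_pgl h (det_upper s)) /s ey; apply: eq_pgl; field.
  have dd : alpha * alpha^-1 - 0 * 0 = 1 by field.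
  apply: (@tri (alpha ^+ 2) ((x + t) / z * (1 - alpha^-1 ^+ 2))).
  - by rewrite expf_neq0.
  - by rewrite -exprM.
  pose A : coset_of 'Z(SLF)%g := pgl 0 (- z^-1) z (x + t); pose T : coset_of 'Z(SLF)%g := pgl alpha 0 0 alpha^-1.
  suff -> : pgl (alpha ^+ 2) ((x + t) / z * (1 - alpha^-1 ^+ 2)) 0 (alpha ^+ 2)^-1 = (A^-1 * A ^ T)%g.
    by rewrite groupM ?groupV // MJ // pgl_L2.
  rewrite /A /T (conj_pgl h' dd) (comm_pgl h'); last by field; rewrite a0 z0.
  by apply: eq_pgl; field; rewrite ?a0 ?z0.
have [x [y [z [t [h eg]]]]] := L2P (subsetP sM _ g0M); rewrite eg in g0M g0_neq1.
have [z0|z0] := eqVneq z 0; last exact: (low x y z t).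
have [y0|y0] := eqVneq y 0; last first.
  have y0' : - y != 0 by rewrite oppr_eq0.
  have h' : t * x - - z * - y = 1 by rewrite -[RHS]h; ring.
  apply: (low t (- z) (- y) x) => //.
  pose J : coset_of 'Z(SLF)%g := pgl 0 1 (-1) 0.
  suff -> : pgl t (- z) (- y) x = (pgl x y z t ^ J)%g by rewrite MJ // pgl_L2.
  by rewrite /J (conj_pgl h Jdet); apply: eq_pgl; ring.
have xt : x != t by apply: contraNneq g0_neq1 => xt; apply/eqP/(pgl_eq1 h); split.
rewrite y0 z0 in g0M; rewrite y0 z0 mulr0 subr0 in h.
have x0 : x != 0 by apply: contra_eq_neq h => ->; rewrite mul0r eq_sym oner_eq0.
have et : t = x^-1 by rewrite -[t](mulKf x0) h mulr1.
apply: (@tri x 0) => //; last by rewrite -et.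
apply: contra_neq xt; rewrite et => e; have : x ^+ 2 * x^-1 = x by field.
by rewrite e mul1r.
Qed.

(** The commutators with [upper 1] and [lower 1] have the squares of the off-diagonal entries among
    their own entries, so these vanish; another entry then makes the diagonal scalar. *)
Lemma LF_center_trivial (g : coset_of 'Z(SLF)%g) :
  g \in LF -> (forall h, h \in LF -> (g * h = h * g)%g) -> g = 1%g.
Proof.
move=> /L2P[a [b [c [d [h ->]]]]] comm.
have cc g1 : g1 \in LF -> ((pgl a b c d)^-1 * pgl a b c d ^ g1)%g = 1%g.
  by move=> yL; rewrite conjgE comm // mulKg mulVg.
have := cc _ (pgl_L2 (det_upper 1)); have := cc _ (pgl_L2 (det_lower 1)).
have h1 : (1 * (a * 1 + b * 0) - 1 * (c * 1 + d * 0)) * (1 * (c * 1 + d * 1) - 0 * (a * 1 + b * 1)) -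
  (1 * (a * 1 + b * 1) - 1 * (c * 1 + d * 1)) * (1 * (c * 1 + d * 0) - 0 * (a * 1 + b * 0)) = 1.
  by rewrite -[RHS]h; ring.
have h2 : (1 * (a * 1 + b * 1) - 0 * (c * 1 + d * 1)) * (1 * (c * 0 + d * 1) - 1 * (a * 0 + b * 1)) -
  (1 * (a * 0 + b * 1) - 0 * (c * 0 + d * 1)) * (1 * (c * 1 + d * 1) - 1 * (a * 1 + b * 1)) = 1.
  by rewrite -[RHS]h; ring.
rewrite (conj_pgl h (det_upper 1)) (comm_pgl h h1) (conj_pgl h (det_lower 1)) (comm_pgl h h2).
have d1 x y z t x' y' z' t' : x * t - y * z = 1 -> x' * t' - y' * z' = 1 ->
    (t * x' - y * z') * (x * t' - z * y') - (t * y' - y * t') * (x * z' - z * x') = 1 :> F.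
  by move=> e e'; rewrite -[RHS]mulr1 -{1}e -e'; ring.
move=> /(pgl_eq1 (d1 _ _ _ _ _ _ _ _ h h2))[y2 _ _] /(pgl_eq1 (d1 _ _ _ _ _ _ _ _ h h1))[y1 z1 _].
have c0 : c = 0 by apply/eqP; rewrite -sqrf_eq0; apply/eqP; rewrite -[RHS]z1; ring.
have b0 : b = 0 by apply/eqP; rewrite -sqrf_eq0; apply/eqP; rewrite -[RHS]y2; ring.
rewrite b0 c0 mulr0 subr0 in h *.
have d0 : d != 0 by apply: contra_eq_neq h => ->; rewrite mulr0 eq_sym oner_eq0.
apply/pgl_eq1; first by rewrite mulr0 subr0.
split=> //; apply/eqP; rewrite -subr_eq0 -(mulrI_eq0 _ (mulfI d0)); apply/eqP.
by rewrite -[RHS]y1 b0 c0; ring.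
Qed.

End LFSimple.

Section Mirror.
Import GRing.Theory.
Local Open Scope ring_scope.

(* Conjugation by the reflection (x, y) |-> (1 - x - y, y), which fixes the
   base vertex and edge and swaps the two hexagons at that edge. *)
Definition mirror (w : motion) : motion :=
  (- w.1, (1, 0) - rotz (- w.1) (1, 0) + (- (w.2.1 + w.2.2), w.2.2)).

Lemma mirror_hexagon w :
  mirror (mcomp w rot_hexagon) = mcomp (mcomp (mcomp (mirror w) rot_corner) rot_corner) rot_hexagon.
Proof.
case: w => k [x y]; rewrite /mirror /mcomp /= rotz_0 !add0r /=; move: k; apply: Z6_case.
all: by congr pair; [apply: val_inj | congr pair => /=; lia].
Qed.

Lemma mirror_corner w :
  mirror (mcomp w rot_corner) = mcomp (mcomp (mirror w) rot_corner) rot_corner.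
Proof.
case: w => k [x y]; rewrite /mirror /mcomp /=; move: k; apply: Z6_case.
all: by congr pair; [apply: val_inj | congr pair => /=; lia].
Qed.

Lemma walk_mirror (gT hT : finGroupType) (a b : gT) (a' b' : hT) (f : gT -> hT) g w :
  (f 1 = 1 -> {in <<[set a; b]>>, forall h, f (a * h) = a' * (b' * (b' * f h))} ->
  {in <<[set a; b]>>, forall h, f (b * h) = b' * (b' * f h)} ->
  walk a b g w -> walk a' b' (f g) (mirror w))%g.
Proof.
move=> f1 fa fb; elim=> [|h u hu IH|h u hu IH].
- by rewrite f1; (have -> : mirror mone = mone by congr pair; apply: val_inj); constructor.
- by rewrite (fa _ (walk_gen hu)) mirror_hexagon; apply: WalkHexagon; do 2!apply: WalkCorner.
- by rewrite (fb _ (walk_gen hu)) mirror_corner; do 2!apply: WalkCorner.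
Qed.

End Mirror.

(** * The generating triple of L2 and its walks *)

Section TriangularWalks.
Import GRing.Theory.
Local Open Scope ring_scope.
Variable F : finFieldType.
Hypothesis F_prime : forall x : F, exists n : nat, x = n%:R.
Variable alpha : F.
Hypotheses (alpha4 : alpha ^+ 4 = alpha ^+ 2 - 1).
Hypotheses (two_neq0 : (2 : F) != 0) (three_neq0 : (3 : F) != 0).
Local Notation gT := (coset_of 'Z(SLF F)%g).

Lemma alpha_neq0 : alpha != 0.
Proof.
apply/eqP => a0; have := alpha4; rewrite a0 !expr0n /= sub0r => /eqP.
by rewrite eq_sym oppr_eq0 oner_eq0.
Qed.

(** [alpha] is a root of the twelfth cyclotomic polynomial X^4 - X^2 + 1, so this is a primitive
    sixth root of unity. The inverse accounts for group elements multiplying in the order opposite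
    to motions. *)
Definition zeta : F := alpha^-1 ^+ 2.

Lemma zeta2 : zeta ^+ 2 = zeta - 1.
Proof.
have a0 := alpha_neq0; rewrite /zeta; apply: (mulfI (expf_neq0 4 a0)).
have -> : alpha ^+ 4 * alpha^-1 ^+ 2 ^+ 2 = 1 by field.
have -> : alpha ^+ 4 * (alpha^-1 ^+ 2 - 1) = alpha ^+ 2 - alpha ^+ 4 by field.
by rewrite alpha4; ring.
Qed.

Lemma zeta_sub2_neq0 : zeta - 2 != 0.
Proof.
apply/eqP => e; have := zeta2; rewrite -[zeta](subrK 2) e add0r => /eqP.
by rewrite -subr_eq0 (_ : _ - _ = 3) ?(negPf three_neq0) //; ring.
Qed.

Lemma zeta_neq0 : zeta != 0.
Proof. by rewrite expf_neq0 // invr_eq0 alpha_neq0. Qed.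

Lemma zeta_unity (k : 'Z_6) : zeta ^+ k = 1 -> k = 0.
Proof.
have z3 : zeta ^+ 3 = -1 by rewrite exprS zeta2 mulrBr -expr2 zeta2; ring.
have z0 := zeta_neq0; have c := zeta2.
have z4 : zeta ^+ 4 = - zeta by rewrite exprSr z3 mulN1r.
have z5 : zeta ^+ 5 = 1 - zeta by rewrite (exprD _ 3 2) z3 c; ring.
move: k; apply: Z6_case => // e; exfalso.
- have {}e : zeta ^+ 1 = 1 := e; rewrite expr1 in e; rewrite e in c; move: c => /eqP.
  by rewrite expr1n subrr oner_eq0.
- have {}e : zeta ^+ 2 = 1 := e; rewrite c in e; move: zeta_sub2_neq0.
  have -> : zeta - 2 = (zeta - 1) - 1 by ring.
  by rewrite e subrr eqxx.
- have {}e : zeta ^+ 3 = 1 := e; move: two_neq0; have -> : (2 : F) = 1 - (-1) by ring.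
  by rewrite -z3 e subrr eqxx.
- have {}e : zeta ^+ 4 = 1 := e; rewrite z4 in e.
  have ez : zeta = -1 by rewrite -e opprK.
  move: three_neq0; have -> : (3 : F) = zeta ^+ 2 - (zeta - 1) by rewrite ez; ring.
  by rewrite c subrr eqxx.
- have {}e : zeta ^+ 5 = 1 := e; rewrite z5 in e; move: z0.
  have -> : zeta = 1 - (1 - zeta) by ring.
  by rewrite e subrr eqxx.
Qed.

(** The ring map from the Eisenstein integers to [F] that sends rotation by 60 degrees to
    multiplication by [zeta]. *)
Definition red (t : Defs.point) : F := t.1%:~R + t.2%:~R * zeta.

Lemma redD t u : red (t + u) = red t + red u.
Proof. by rewrite /red /= !rmorphD /=; ring. Qed.

Lemma red_rotz (k : 'Z_6) t : red (rotz k t) = zeta ^+ k * red t.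
Proof.
have r60 u : red (rot60 u) = zeta * red u.
  transitivity (u.1%:~R * zeta + u.2%:~R * zeta ^+ 2 : F); last by rewrite /red; ring.
  by rewrite zeta2 /red /= rmorphN rmorphD /=; ring.
rewrite /rotz; elim: (nat_of_ord k) => [|n IHn]; first by rewrite mul1r.
by rewrite iterS r60 IHn exprS mulrA.
Qed.

Lemma zeta_exp_mod n : zeta ^+ (n %% 6) = zeta ^+ n.
Proof.
rewrite [in RHS](divn_eq n 6) exprD mulnC exprM.
have -> : zeta ^+ 6 = 1.
  have z3 : zeta ^+ 3 = -1 by rewrite exprS zeta2 mulrBr -expr2 zeta2; ring.
  by rewrite (exprM _ 3 2) z3 sqrrN expr1n.
by rewrite expr1n mul1r.
Qed.

Lemma zetaD (k l : 'Z_6) : zeta ^+ (k + l)%R = zeta ^+ k * zeta ^+ l.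
Proof. by rewrite /= zeta_exp_mod exprD. Qed.

Definition lam : F := alpha * (zeta - 2).
(** Chosen so that [lam * mu = alpha ^+ 2]; then [s1 * s2 * s3] has trace
    [alpha ^+ 4 + 1 + alpha ^- 4], the vanishing sum of the three cube roots of unity. *)
Definition mu : F := alpha / (zeta - 2).
Definition s1 : gT := pgl alpha lam 0 alpha^-1.
Definition s2 : gT := pgl (alpha ^+ 2) 0 0 (alpha ^- 2).
Definition s3 : gT := pgl alpha 0 mu alpha^-1.

Lemma det_s1 : alpha * alpha^-1 - lam * 0 = 1.
Proof. by rewrite mulr0 subr0 mulfV ?alpha_neq0. Qed.
Lemma det_s2 : alpha ^+ 2 * alpha ^- 2 - 0 * 0 = 1.
Proof. by rewrite mulr0 subr0 mulfV ?expf_neq0 ?alpha_neq0. Qed.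
Lemma det_s3 : alpha * alpha^-1 - 0 * mu = 1.
Proof. by rewrite mul0r subr0 mulfV ?alpha_neq0. Qed.

(** In the coordinate z = 1 + zeta - 3y, centred at the triangle centre that [s2] fixes, the inverse
    of the motion y |-> zeta^k y + red t becomes z |-> zeta^-k (z + shift (k, t)). *)
Definition shift (w : motion) : F := (zeta ^+ w.1 - 1) * (1 + zeta) + 3 * red w.2.

Lemma s_walk g w : walk s1 s2 g w ->
  exists x, [/\ x != 0, x ^+ 2 * zeta ^+ w.1 = 1 & g = pgl x (x * shift w) 0 x^-1].
Proof.
have a0 := alpha_neq0.
have zh u : zeta ^+ (mcomp u rot_hexagon).1 = zeta ^+ u.1 * zeta by exact: zetaD.
have zc u : zeta ^+ (mcomp u rot_corner).1 = zeta ^+ u.1 * zeta ^+ 2 by exact: zetaD.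
elim=> [|h u _ [x [x0 xz ->]]|h u _ [x [x0 xz ->]]].
- exists 1; rewrite oner_neq0 expr1n mul1r; split=> //.
  rewrite invr1; apply/esym/pgl_eq1; rewrite ?mulr0 ?subr0 ?mulr1 //; split=> //.
  by rewrite mul1r /shift /red /= subrr (_ : 0%:~R = 0) //; ring.
- have xd : x * x^-1 - x * shift u * 0 = 1 by rewrite mulr0 subr0 mulfV.
  exists (alpha * x); split; first by rewrite mulf_neq0.
  + rewrite zh exprMn [zeta ^+ u.1 * zeta]mulrC mulrACA xz mulr1.
    by rewrite /zeta; field.
  + rewrite /s1 (pglM det_s1 xd); apply: eq_pgl.
    * by rewrite mulr0 addr0.
    2: by rewrite mul0r mulr0 addr0.
    2: by rewrite mul0r add0r [RHS]invfM.
    rewrite /shift zh (_ : (mcomp u rot_hexagon).2 = u.2) /lam; last by rewrite /= rotz_0 add0r.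
    have -> : x^-1 = x * zeta ^+ u.1 by apply: (mulfI x0); rewrite mulrA -expr2 xz mulfV.
    have e : (zeta - 2) = (zeta - 1) * (1 + zeta) by transitivity (zeta ^+ 2 - 1); [rewrite zeta2; ring | ring].
    by rewrite e; ring.
- have xd : x * x^-1 - x * shift u * 0 = 1 by rewrite mulr0 subr0 mulfV.
  exists (alpha ^+ 2 * x); split; first by rewrite mulf_neq0 // expf_neq0.
  + rewrite zc exprMn [zeta ^+ u.1 * _]mulrC mulrACA xz mulr1.
    by rewrite /zeta; field.
  + rewrite /s2 (pglM det_s2 xd); apply: eq_pgl.
    * by rewrite mulr0 addr0.
    2: by rewrite mul0r mulr0 addr0.
    2: by rewrite mul0r add0r [RHS]invfM.
    rewrite /shift zc (_ : (mcomp u rot_corner).2 = rotz u.1 (1, 0) + u.2) // redD red_rotz.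
    have -> : red (1, 0) = 1 by rewrite /red /= mul0r addr0.
    have e : (zeta ^+ 2 - 1) * (1 + zeta) + 3 = 0.
      rewrite zeta2; transitivity (zeta ^+ 2 - zeta + 1); first by ring.
      by rewrite zeta2; ring.
    rewrite mul0r addr0 mulrA; congr (_ * _); rewrite -[LHS]addr0 -(mulr0 (zeta ^+ u.1)) -e.
    by ring.
Qed.

Lemma s_walk_eq1 g w : walk s1 s2 g w -> (g = 1%g <-> w.1 = 0 /\ red w.2 = 0).
Proof.
case/s_walk => x [x0 xz ->]; have xd : x * x^-1 - x * shift w * 0 = 1 by rewrite mulr0 subr0 mulfV.
rewrite (pgl_eq1 xd); split.
  case=> /eqP; rewrite mulf_eq0 (negPf x0) /= => /eqP sh _ xV.
  have x2 : x ^+ 2 = 1 by rewrite expr2 {1}xV mulVf.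
  have w0 : w.1 = 0 by apply: zeta_unity; rewrite -xz x2 mul1r.
  split=> //; apply/eqP; move: sh; rewrite /shift w0 subrr mul0r add0r => /eqP.
  by rewrite mulf_eq0 (negPf three_neq0).
move=> [w0 r0]; rewrite /shift w0 r0 subrr mul0r mulr0 addr0 mulr0; split=> //.
by apply: (mulfI x0); rewrite mulfV // -expr2 -xz w0 mulr1.
Qed.

Lemma s_relations : [/\ s1 \in LF F, s2 \in LF F & s3 \in LF F].
Proof.
by split; apply: pgl_L2; [apply: det_s1 | apply: det_s2 | apply: det_s3].
Qed.

Lemma lam_neq0 : lam != 0.
Proof. by rewrite mulf_neq0 ?alpha_neq0 ?zeta_sub2_neq0. Qed.

Lemma mu_neq0 : mu != 0.
Proof. by rewrite mulf_neq0 ?invr_eq0 ?alpha_neq0 ?zeta_sub2_neq0. Qed.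

(** A matrix of determinant 1 and trace 0 has square -1, which is trivial modulo the centre. *)
Lemma s123_inv : (s1 * s2 * s3 * (s1 * s2 * s3))%g = 1%g.
Proof.
have a0 := alpha_neq0.
have a6 : alpha ^+ 6 = -1.
  transitivity (alpha ^+ 4 * alpha ^+ 2); first by rewrite -exprD.
  rewrite alpha4; transitivity (alpha ^+ 4 - alpha ^+ 2); first by ring.
  by rewrite alpha4; ring.
have e12 : (s1 * s2)%g = pgl (alpha ^+ 3) (lam * alpha ^- 2) 0 (alpha^-1 ^+ 3).
  by rewrite /s1 /s2 (pglM det_s1 det_s2); apply: eq_pgl; field.
have d12 : alpha ^+ 3 * alpha^-1 ^+ 3 - lam * alpha ^- 2 * 0 = 1 by field.
rewrite e12 /s3 (pglM d12 det_s3).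
set x := alpha ^+ 3 * alpha + _; set y := _ + lam * alpha ^- 2 * alpha^-1.
set z := 0 * alpha + _; set t := 0 * 0 + _.
have lm : lam * mu = alpha ^+ 2 by rewrite /lam /mu; have h := zeta_sub2_neq0; field.
have tr : x + t = 0.
  rewrite /x /t; have -> : lam * alpha ^- 2 * mu = lam * mu * alpha ^- 2 by ring.
  rewrite lm; apply: (mulfI (expf_neq0 4 a0)); rewrite mulr0.
  transitivity (alpha ^+ 6 * alpha ^+ 2 + alpha ^+ 4 + 1); first by field.
  by rewrite a6 alpha4; ring.
have dt : x * t - y * z = 1.
  rewrite /x /y /z /t; have := d12; have := det_s3; move=> _ _.
  by field.
rewrite (pglM dt dt); apply/pgl_eq1.
  by rewrite -[RHS]mulr1 -{1}dt -dt; ring.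
have et : t = - x by apply/eqP; rewrite -addr_eq0 addrC tr.
by rewrite et; split; ring.
Qed.

(** Antidiagonal, so conjugation exchanges the two triangular groups. Its determinant is [lam * mu],
    so it is taken in GL2 and shown separately to normalize the centre of SL2. *)
Definition dual_gl : {'GL_2[F]} := gl2 0 lam (- mu) 0.

Lemma dual_gl_det : 0 * 0 - lam * - mu != 0.
Proof. by rewrite mulr0 sub0r mulrN opprK mulf_neq0 ?lam_neq0 ?mu_neq0. Qed.

Lemma dual_gl_conj x y z t : x * t - y * z = 1 ->
  (gl2 x y z t ^ dual_gl)%g = gl2 t (- (z * lam / mu)) (- (y * mu / lam)) x.
Proof.
have l0 := lam_neq0; have m0 := mu_neq0; move=> h.
have h' : t * x - - (z * lam / mu) * - (y * mu / lam) = 1 by rewrite -[RHS]h; field; rewrite l0.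
have nz : x * t - y * z != 0 by rewrite h oner_eq0.
have nz' : t * x - - (z * lam / mu) * - (y * mu / lam) != 0 by rewrite h' oner_eq0.
apply: (mulgI dual_gl); rewrite -conjgC /dual_gl (gl2M nz dual_gl_det) (gl2M dual_gl_det nz').
by congr gl2; field.
Qed.

Lemma dual_gl_norm : (dual_gl \in 'N('Z(SLF F)))%g.
Proof.
rewrite inE; apply/subsetP => _ /imsetP[u uZ ->].
have [x [y [z [t [h eu]]]]] := SL2P (subsetP (center_sub _) _ uZ); rewrite eu in uZ *.
have [y0 z0 xt] := center_SL2P h uZ; rewrite (dual_gl_conj h) y0 z0 !mul0r oppr0 -xt.
by move: uZ; rewrite y0 z0 -xt.
Qed.

Definition dual_pgl : gT := coset 'Z(SLF F)%g dual_gl.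

Lemma dual_pgl_conj x y z t : x * t - y * z = 1 ->
  (pgl x y z t ^ dual_pgl)%g = pgl t (- (z * lam / mu)) (- (y * mu / lam)) x.
Proof.
move=> h; rewrite /dual_pgl /pgl -morphJ ?dual_gl_conj ?dual_gl_norm //.
exact: (subsetP (SL2_norm F) _ (gl2_SL2 h)).
Qed.

Lemma dual_s : [/\ s1 ^ dual_pgl = s3^-1, s2 ^ dual_pgl = s2^-1 & s3 ^ dual_pgl = s1^-1]%g.
Proof.
have l0 := lam_neq0; have m0 := mu_neq0.
split; rewrite /s1 /s2 /s3 (dual_pgl_conj det_s1, dual_pgl_conj det_s2, dual_pgl_conj det_s3).
- by rewrite (pglV det_s3); apply: eq_pgl => //; field.
- by rewrite (pglV det_s2); apply: eq_pgl => //; field.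
- by rewrite (pglV det_s1); apply: eq_pgl => //; field.
Qed.

Lemma s23_lower g : (g \in <<[set s2; s3]>>)%g -> exists x z, x != 0 /\ g = pgl x 0 z x^-1.
Proof.
have a0 := alpha_neq0.
case/gen_prodgP => n [f fS ->]; elim: n f fS => [|n IHn] f fS.
  rewrite big_ord0; exists 1, 0; rewrite oner_neq0 invr1; split=> //.
  by apply/esym/pgl_eq1; rewrite ?mulr1 ?mulr0 ?subr0.
rewrite big_ord_recl; have [x [z [x0 ->]]] := IHn (fun i => f (lift ord0 i)) (fun i => fS _).
have xd : x * x^-1 - 0 * z = 1 by rewrite mul0r subr0 mulfV.
have /set2P[->|->] := fS ord0.
  exists (alpha ^+ 2 * x), (alpha ^- 2 * z); split; first by rewrite mulf_neq0 ?expf_neq0.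
  by rewrite /s2 (pglM det_s2 xd); apply: eq_pgl; field; rewrite ?x0 ?a0.
exists (alpha * x), (mu * x + alpha^-1 * z); split; first by rewrite mulf_neq0.
by rewrite /s3 (pglM det_s3 xd); apply: eq_pgl; field; rewrite ?x0 ?a0.
Qed.

(** An element that is both upper and lower triangular is diagonal; a trivial rotation part makes
    its entries square to 1, so it is central. *)
Lemma s_walk_lower g w : walk s1 s2 g w -> w.1 = 0 -> (g \in <<[set s2; s3]>>)%g -> g = 1%g.
Proof.
case/s_walk => x [x0 xz ->] w0 /s23_lower[x' [z' [x0' e]]].
have xd : x * x^-1 - x * shift w * 0 = 1 by rewrite mulr0 subr0 mulfV.
have xd' : x' * x'^-1 - 0 * z' = 1 by rewrite mul0r subr0 mulfV.
have e1 : ((pgl x' 0 z' x'^-1%R)^-1 * pgl x (x * shift w)%R 0 x^-1%R)%g = 1%g by rewrite e mulVg.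
have x2 : x ^+ 2 = 1 by rewrite -xz w0 mulr1.
rewrite (comm_pgl xd' xd) in e1; move/pgl_eq1: e1 => /(_ _)/wrap[].
  by rewrite -[RHS]mulr1 -{1}xd -xd'; ring.
move=> [/eqP]; rewrite mul0r subr0 mulf_eq0 invr_eq0 (negPf x0') /= => /eqP y0 _ _.
apply/pgl_eq1 => //; split=> //.
by apply: (mulfI x0); rewrite mulfV // -expr2.
Qed.

(** The commutators of [s1] and of [s3] with [s2] are nontrivial transvections, upper and lower
    respectively. *)
Lemma s_generate : (<<[set s1; s2; s3]>> = LF F)%g.
Proof.
have [s1L s2L s3L] := s_relations; have a0 := alpha_neq0.
apply/eqP; rewrite eqEsubset; apply/andP; split.
  rewrite gen_subG; apply/subsetP => g; rewrite !inE => /orP[/orP[]|] /eqP-> //.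
have [g1 g2 g3] : [/\ s1 \in <<[set s1; s2; s3]>>, s2 \in <<[set s1; s2; s3]>> & s3 \in <<[set s1; s2; s3]>>]%g.
  by split; rewrite mem_gen // !inE eqxx ?orbT.
have z2 : zeta ^+ 2 - 1 != 0.
  rewrite zeta2; have -> : zeta - 1 - 1 = zeta - 2 by ring.
  exact: zeta_sub2_neq0.
have u0 : lam * alpha^-1 * (zeta ^+ 2 - 1) != 0.
  by apply: mulf_neq0 => //; apply: mulf_neq0; rewrite ?invr_eq0 ?lam_neq0.
have l0 : mu * alpha * (alpha ^+ 4 - 1) != 0.
  apply: mulf_neq0; first by apply: mulf_neq0; rewrite ?mu_neq0.
  apply: contraNneq z2 => e.
  have -> : zeta ^+ 2 - 1 = - (alpha ^+ 4 - 1) * alpha ^- 4 by rewrite /zeta; field.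
  by rewrite e oppr0 mul0r.
apply: (@L2_transvections F F_prime <<[set s1; s2; s3]>>%G _ _ u0 l0).
  suff -> : upper (lam * alpha^-1 * (zeta ^+ 2 - 1)) = (s1^-1 * s1 ^ s2)%g.
    by rewrite groupM ?groupV // groupJ.
  rewrite /s1 /s2 (conj_pgl det_s1 det_s2) (comm_pgl det_s1); last by field.
  by rewrite /zeta /upper; apply: eq_pgl; field.
suff -> : lower (mu * alpha * (alpha ^+ 4 - 1)) = (s3^-1 * s3 ^ s2)%g.
  by rewrite groupM ?groupV // groupJ.
rewrite /s3 /s2 (conj_pgl det_s3 det_s2) (comm_pgl det_s3); last by field.
by rewrite /lower; apply: eq_pgl; field.
Qed.

End TriangularWalks.

(** * The order of L2 *)

Section CardL2.
Import GRing.Theory.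
Local Open Scope ring_scope.
Variable F : finFieldType.

Lemma card_det_fiber (x : F) : x != 0 -> #|[set u : {'GL_2[F]} | \det (GLval u) == x]| = #|SLF F|.
Proof.
move=> x0; have d0 : x * 1 - 0 * 0 != 0 by rewrite mulr1 mul0r subr0.
pose d := gl2 x 0 0 1; have dd : \det (GLval d) = x by rewrite gl2_val // mx2_det mulr1 mul0r subr0.
rewrite -[RHS](card_lcoset _ d); apply: eq_card => u; rewrite mem_lcoset !inE.
rewrite GL_ME det_mulmx GL_VE det_inv dd; apply/eqP/eqP => [->|e]; first by rewrite mulVf.
by rewrite -[LHS](mulVKf x0) e mulr1.
Qed.

Lemma card_SL2 : #|SLF F| = (#|F| * (#|F| ^ 2 - 1))%N.
Proof.
have F1 : (1 < #|F|)%N by apply/card_gt1P; exists 0, 1; rewrite !inE eq_sym oner_neq0.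
have e : (#|F|.-1 * #|SLF F| = #|F| * #|F|.-1 ^ 2 * #|F|.+1)%N.
  rewrite -card_GL_2 -[RHS]sum1_card (partition_big (fun u : {'GL_2[F]} => \det (GLval u)) predT) //=.
  rewrite (bigD1 0) //= big_pred0 => [|u]; last first.
    by have := GL_unitmx u; rewrite unitmxE unitfE => /negPf->; rewrite andbF.
  rewrite add0n (eq_bigr (fun=> #|SLF F|)) => [|x x0].
    by rewrite sum_nat_const cardC1.
  by rewrite -(card_det_fiber x0) -sum1_card; apply: eq_bigl => u; rewrite !inE.
apply/eqP; rewrite -(eqn_pmul2l (_ : 0 < #|F|.-1)%N) ?e; last by rewrite -ltnS prednK // ltnW.
by apply/eqP; case: #|F| F1 => [|[|n]] // _; rewrite /=; nia.
Qed.

(** The centre of SL2 has order at most 2. The factor 2 on the right will be matched by the index of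
    the rotation subgroup. *)
Lemma card_LF_dvdn : (#|F| * (#|F| ^ 2 - 1) %| 2 * #|LF F|)%N.
Proof.
have Z2 : (#|'Z(SLF F)%g| <= 2)%N.
  suff sub : ('Z(SLF F) \subset [set 1; gl2 (-1) 0 0 (-1)])%g.
    by apply: leq_trans (subset_leq_card sub) _; rewrite cards2; case: (_ != _).
  apply/fintype.subsetP => u uZ; have uS : u \in SLF F by move: u uZ; apply/fintype.subsetP/center_sub.
  have [x [y [z [t [d1 e]]]]] := SL2P uS; move: uZ; rewrite e => /(center_SL2P d1)[y0 z0 xt].
  have /eqP : t ^+ 2 = 1 by rewrite -d1 y0 z0 xt mul0r subr0.
  rewrite y0 z0 xt !inE sqrf_eq1 => /orP[] /eqP->; first by rewrite gl2_1 eqxx.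
  by rewrite eqxx orbT.
have [k ek] : exists k, (2 = k * #|'Z(SLF F)%g|)%N.
  have := cardG_gt0 'Z(SLF F)%g; move: Z2; case: #|_| => [|[|[|]]] // _ _; [by exists 2%N | by exists 1%N].
rewrite -card_SL2 -(Lagrange (center_sub (SLF F))) /LF card_quotient ?SL2_norm //.
by rewrite [X in (_ %| X * _)%N]ek -mulnA dvdn_mull.
Qed.

End CardL2.

(** * The lattice of a prime *)

Section PrimeLattice.
Import GRing.Theory Num.Theory.
Local Open Scope ring_scope.
Variables p b c m : nat.
Hypotheses (p_prime : prime p) (p_mod12 : p = 1 %[mod 12]).
Hypotheses (b_gt0 : (0 < b)%N) (c_gt0 : (0 < c)%N) (p_eq : p = (b ^ 2 + b * c + c ^ 2)%N).

Lemma Fp_nat_eq0 n : (n%:R == 0 :> 'F_p) = (p %| n)%N.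
Proof. by rewrite (dvdn_pcharf (pchar_Fp p_prime)). Qed.

Lemma Fp_int_eq0 (n : int) : (n%:~R == 0 :> 'F_p) = (p%:Z %| n)%Z.
Proof.
rewrite dvdzE; case: n => n; first by rewrite -Fp_nat_eq0.
by rewrite NegzE mulrNz oppr_eq0 -Fp_nat_eq0 abszN.
Qed.

Lemma Fp_nat_surj (x : 'F_p) : exists n : nat, x = n%:R.
Proof. by exists x; rewrite natr_Zp. Qed.

Lemma p_ge13 : (13 <= p)%N.
Proof.
have := prime_gt1 p_prime; move: p_mod12; rewrite -[(1 %% 12)%N]/1%N => e p1.
have := divn_eq p 12; rewrite e; case: (p %/ 12)%N => [|k]; lia.
Qed.

Lemma c_neq0 : (c%:R : 'F_p) != 0.
Proof. by rewrite Fp_nat_eq0 gtnNdvd // p_eq; nia. Qed.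

Lemma b_coprime : coprime p b.
Proof. by rewrite prime_coprime // gtnNdvd // p_eq; nia. Qed.

Lemma two_Fp : (2 : 'F_p) != 0.
Proof. by rewrite Fp_nat_eq0 gtnNdvd //; have := p_ge13; lia. Qed.

Lemma three_Fp : (3 : 'F_p) != 0.
Proof. by rewrite Fp_nat_eq0 gtnNdvd //; have := p_ge13; lia. Qed.

(** Write p - 1 = 4(k+1). The polynomial X^(2(k+1)) - 1 has too few roots to contain all nonzero
    elements, so some x has x^(2(k+1)) = -1, and x^(k+1) is the wanted root. *)
Lemma sqrt_minus1 : exists i : 'F_p, i ^+ 2 = -1.
Proof.
have [k ek] : exists k, p = (4 * k.+1).+1.
  have := divn_eq p 12; rewrite p_mod12 -[(1 %% 12)%N]/1%N; have := p_ge13.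
  case: (p %/ 12)%N => [|k]; first lia.
  by move=> _ e; exists (3 * k.+1).-1; lia.
have [/allP all1|/allPn[x]] := boolP (all ((2 * k.+1).-unity_root) (enum [pred x : 'F_p | x != 0])).
  have := @max_unity_roots _ (2 * k.+1)%N (enum [pred x : 'F_p | x != 0]) isT.
  rewrite enum_uniq -cardE cardC1 card_Fp // => /(_ _ isT) h.
  have : ((p.-1) <= 2 * k.+1)%N by apply: h; apply/allP.
  by rewrite {1}ek /=; lia.
rewrite mem_enum inE unity_rootE => x0 x1; exists (x ^+ k.+1); rewrite -exprM mulnC.
have xp : x ^+ (2 * k.+1 * 2) = 1.
  apply: (mulfI x0); rewrite mulr1 -exprS -[RHS]finfield.expf_card card_Fp //.
  by congr (_ ^+ _); rewrite {1}ek; lia.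
by move/eqP: xp; rewrite exprM sqrf_eq1 (negPf x1) => /eqP.
Qed.

(** For z = -b/c the norm equation gives z^2 = z - 1, hence z^4 = -z and (i z^2)^2 = z. Thus i z^2
    is a square root of z, and [alpha] is its inverse. *)
Lemma sqrt_zeta : exists alpha : 'F_p, alpha ^+ 4 = alpha ^+ 2 - 1 /\ zeta alpha * c%:R = - b%:R.
Proof.
have [i i2] := sqrt_minus1; have c0 := c_neq0.
pose z : 'F_p := - b%:R / c%:R.
have z2 : z ^+ 2 = z - 1.
  have e : (b%:R ^+ 2 + b%:R * c%:R + c%:R ^+ 2 : 'F_p) = 0.
    by rewrite -!natrX -natrM -!natrD; apply/eqP; rewrite Fp_nat_eq0 -p_eq.
  apply/eqP; rewrite -subr_eq0 /z.
  have -> : (- b%:R / c%:R) ^+ 2 - (- b%:R / c%:R - 1) =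
    (b%:R ^+ 2 + b%:R * c%:R + c%:R ^+ 2) / c%:R ^+ 2 :> 'F_p by field.
  by rewrite e mul0r.
have z3 : z ^+ 3 = -1 by ring: z2.
have z4 : (i * z ^+ 2) ^+ 2 = z.
  by rewrite exprMn i2 -exprM (exprD z 3 1) z3 expr1 mulrA mulrNN !mul1r.
have zV : z^-1 = 1 - z.
  have z0 : z != 0 by apply/eqP => z0; move/eqP: z3; rewrite z0 expr0n /= eq_sym oppr_eq0 oner_eq0.
  by apply: (mulfI z0); rewrite divff //; ring: z2.
have a2 : (i * z ^+ 2)^-1 ^+ 2 = 1 - z by rewrite exprVn z4 zV.
exists (i * z ^+ 2)^-1; split; last by rewrite /zeta invrK z4 /z divfK.
by rewrite (exprM _ 2 2) a2; ring: z2.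
Qed.

Variable alpha : 'F_p.
Hypothesis zeta_alpha : zeta alpha * c%:R = - b%:R.

Lemma red_eq0 t : red alpha t = 0 <-> (p%:Z %| b%:Z * t.2 - c%:Z * t.1)%Z.
Proof.
have c0 := c_neq0.
have e : red alpha t * c%:R = - (b%:Z * t.2 - c%:Z * t.1)%:~R.
  by rewrite /red mulrDl -mulrA zeta_alpha rmorphB /= !rmorphM /= -!pmulrn; ring.
rewrite -Fp_int_eq0 -oppr_eq0 -e mulf_eq0 (negPf c0) orbF; exact: (rwP eqP).
Qed.

(** The kernel of [red] is the ideal generated by b + c zeta. Multiplying t by the conjugate b + c -
    c zeta gives p times the wanted coordinates: p divides the second by hypothesis, and the first
    after a factor b is cancelled. *)
Lemma red_lattice t : red alpha t = 0 <-> lattice (b%:Z, c%:Z) t.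
Proof.
have pE : p%:Z = b%:Z ^+ 2 + b%:Z * c%:Z + c%:Z ^+ 2 by rewrite {1}p_eq; lia.
have p0 : p%:Z != 0 by have := prime_gt0 p_prime; lia.
rewrite red_eq0; split=> [/dvdzP[j ej]|[i [j ->]]]; last first.
  rewrite /rot60 !pointMz /=; apply/dvdzP; exists j; rewrite pE; ring.
have E2 : b%:Z * t.2 - c%:Z * t.1 - j * (b%:Z ^+ 2 + b%:Z * c%:Z + c%:Z ^+ 2) = 0.
  by rewrite ej -pE subrr.
have /dvdzP[i ei] : (p%:Z %| t.1 * (b%:Z + c%:Z) + t.2 * c%:Z)%Z.
  rewrite -(Gauss_dvdzr (m := p%:Z) (n := b%:Z)); last first.
    by have := b_coprime; rewrite /coprimez /gcdz /coprime /= => /eqP->.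
  apply/dvdzP; exists (t.1 + c%:Z * j); apply/eqP; rewrite -subr_eq0 pE; apply/eqP.
  by rewrite -[RHS](mulr0 c%:Z) -E2; ring.
have E1 : t.1 * (b%:Z + c%:Z) + t.2 * c%:Z - i * (b%:Z ^+ 2 + b%:Z * c%:Z + c%:Z ^+ 2) = 0.
  by rewrite ei -pE subrr.
exists i, j; rewrite /rot60 !pointMz; apply: injective_projections => /=.
  apply: (mulfI p0); apply/eqP; rewrite -subr_eq0 pE; apply/eqP.
  transitivity (b%:Z * (t.1 * (b%:Z + c%:Z) + t.2 * c%:Z - i * (b%:Z ^+ 2 + b%:Z * c%:Z + c%:Z ^+ 2)) -
    c%:Z * (b%:Z * t.2 - c%:Z * t.1 - j * (b%:Z ^+ 2 + b%:Z * c%:Z + c%:Z ^+ 2))); first by ring.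
  by rewrite E1 E2 !mulr0 subr0.
apply: (mulfI p0); apply/eqP; rewrite -subr_eq0 pE; apply/eqP.
transitivity (c%:Z * (t.1 * (b%:Z + c%:Z) + t.2 * c%:Z - i * (b%:Z ^+ 2 + b%:Z * c%:Z + c%:Z ^+ 2)) +
  (b%:Z + c%:Z) * (b%:Z * t.2 - c%:Z * t.1 - j * (b%:Z ^+ 2 + b%:Z * c%:Z + c%:Z ^+ 2))); first by ring.
by rewrite E1 E2 !mulr0 addr0.
Qed.

(** Otherwise p would divide (2b + c) c, whose factors are positive and smaller than p. This is the
    chirality of the torus map of (b,c). *)
Lemma red_mirror : red alpha (- (b%:Z + c%:Z), c%:Z) <> 0.
Proof.
rewrite red_eq0 /= => h.
have : (p %| (2 * b + c) * c)%N.
  have e : b%:Z * c%:Z - c%:Z * - (b%:Z + c%:Z) = ((2 * b + c) * c)%N%:Z.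
    by rewrite !(PoszM, PoszD); ring.
  by rewrite e dvdzE in h.
rewrite Euclid_dvdM // => /orP[] /dvdn_leq; last first.
  by move=> /(_ c_gt0); rewrite p_eq; nia.
move=> /(_ (ltn_addl _ c_gt0)) h2; have := p_ge13; rewrite p_eq in h2 *; nia.
Qed.

Lemma m_latticeE t : lattice (m%:Z, 0) t <-> exists z : Defs.point, t = z *+ m.
Proof.
have e (x y : int) : ((m%:Z, 0) : Defs.point) *~ x + rot60 (m%:Z, 0) *~ y = (x, y) *+ m.
  by rewrite /rot60 pmulrn !pointMz; apply: injective_projections => /=; ring.
by split=> [[i [j ->]]|[[x y] ->]]; [exists (i, j) | exists x, y].
Qed.

Definition mix_vector : Defs.point :=
  if (p %| m)%N then (m%:Z, 0) else ((m * b)%:Z, (m * c)%:Z).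

Lemma redMn t n : red alpha (t *+ n) = red alpha t *+ n.
Proof.
case: t => x y; rewrite pmulrn pointMz /red /= !rmorphM /= -!pmulrn; ring.
Qed.

(** On a vector m z the value of [red] is m times that on z. If p divides m it always vanishes;
    otherwise m is invertible modulo p, and z must lie in the lattice of (b,c). *)
Lemma mix_lattice t : lattice mix_vector t <-> red alpha t = 0 /\ lattice (m%:Z, 0) t.
Proof.
rewrite /mix_vector; case: ifPn => pm.
  split=> [lt|[]//]; split=> //; have [z ->] := (m_latticeE t).1 lt.
  by rewrite redMn -mulr_natr; apply/eqP; rewrite mulf_eq0 Fp_nat_eq0 pm orbT.
have -> : ((m * b)%:Z, (m * c)%:Z) = ((b%:Z, c%:Z) : Defs.point) *+ m.
  by rewrite pmulrn pointMz !PoszM ![m%:Z * _]mulrC.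
rewrite lattice_scale; split=> [[z lz ->]|[r0 /m_latticeE[z ez]]].
  by split; [rewrite redMn (red_lattice z).2 // mul0rn | apply/m_latticeE; exists z].
exists z => //; apply/red_lattice/eqP; move/eqP: r0; rewrite ez redMn -mulr_natr mulf_eq0 Fp_nat_eq0.
by rewrite (negPf pm) orbF.
Qed.

End PrimeLattice.

(** * Mixing with a simple group *)

Section Mix.
Local Open Scope group_scope.
Variables (gT hT : finGroupType) (L : {group gT}) (R : {group hT}).
Variables (a b c : gT) (a' b' c' : hT).
Hypotheses (genL : <<[set a; b; c]>> = L) (genR : <<[set a'; b'; c']>> = R).
Hypothesis simpleL : forall M : {group gT},
  M \subset L -> L \subset 'N(M) -> M :!=: 1 -> M :=: L.
Hypothesis no_conj : forall x, a ^ x = a * (b * b) -> b ^ x = b^-1 -> False.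
Hypothesis mirrorR :
  (exists2 y, y \in R & a' ^ y = a' * (b' * b') /\ b' ^ y = b'^-1) \/ ~~ (#|L| %| #|R|).
Local Notation G := <<[set (a, a'); (b, b'); (c, c')]>>.

Let gG : [/\ (a, a') \in G, (b, b') \in G & (c, c') \in G].
Proof. by split; apply: mem_gen; rewrite !inE eqxx ?orbT. Qed.

Lemma mix_sub : G \subset setX L R.
Proof.
rewrite gen_subG; apply/subsetP => x; rewrite !inE -genL -genR => /orP[/orP[]|] /eqP->.
- by rewrite !mem_gen // !inE eqxx.
- by rewrite !mem_gen // !inE eqxx orbT.
- by rewrite !mem_gen // !inE eqxx !orbT.
Qed.

Lemma mix_fst x : x \in L -> exists y, (x, y) \in G.
Proof.
move=> xL; have : x \in [morphism of fst] @* G.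
  move: x xL; apply/subsetP; rewrite -genL gen_subG; apply/subsetP => x; rewrite !inE.
  have [ga gb gc] := gG.
  case/orP=> [/orP[]|] /eqP->.
  - by apply/morphimP; exists (a, a'); rewrite ?inE.
  - by apply/morphimP; exists (b, b'); rewrite ?inE.
  - by apply/morphimP; exists (c, c'); rewrite ?inE.
by case/morphimP => -[x' y] _ h /= ->; exists y.
Qed.

Lemma mix_snd y : y \in R -> exists x, (x, y) \in G.
Proof.
move=> yR; have : y \in [morphism of snd] @* G.
  move: y yR; apply/subsetP; rewrite -genR gen_subG; apply/subsetP => y; rewrite !inE.
  have [ga gb gc] := gG.
  case/orP=> [/orP[]|] /eqP->.
  - by apply/morphimP; exists (a, a'); rewrite ?inE.
  - by apply/morphimP; exists (b, b'); rewrite ?inE.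
  - by apply/morphimP; exists (c, c'); rewrite ?inE.
by case/morphimP => -[x y'] _ h /= ->; exists x.
Qed.

(** The kernel of Goursat's lemma: if it is trivial, the mix is the graph of a homomorphism from [R]
    onto [L]. *)
Definition mix_ker : {set gT} := [set x | (x, 1) \in G].

Lemma mix_ker_group_set : group_set mix_ker.
Proof.
apply/group_setP; split=> [|x y]; rewrite !inE; first exact: group1.
by move=> hx hy; have := groupM hx hy; rewrite (_ : (x, 1) * (y, 1) = (x * y, 1 * 1)) // mulg1.
Qed.
Canonical mix_ker_group := Group mix_ker_group_set.

(** The kernel is normal in the simple group [L]. Were it trivial, [R] would map onto [L] matching
    the generators: either |L| divides |R|, or the mirror in [R] goes to an element conjugating [a]
    and [b] as [no_conj] forbids. *)
Lemma mix_ker_full : mix_ker = L.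
Proof.
have subL : mix_ker \subset L.
  by apply/subsetP => x; rewrite inE => /(subsetP mix_sub); rewrite inE => /andP[].
have [triv|] := boolP (mix_ker == 1); last first.
  apply: (simpleL subL); apply/subsetP => x xL; rewrite inE; apply/subsetP => _ /imsetP[z zK ->].
  have [y xy] := mix_fst xL; rewrite inE in zK; rewrite inE.
  by have := groupJ zK xy; rewrite (_ : (z, 1) ^ (x, y) = (z ^ x, 1 ^ y)) // conj1g.
have K1 x : (x, 1) \in G -> x = 1.
  by move=> h; apply/set1P; rewrite -[[set 1]]/(1 : {set gT}) -(eqP triv) inE.
case: mirrorR => [[y yR [ea eb]]|/negP[]].
  have [x xy] := mix_snd yR; have [ga gb _] := gG.
  case: (@no_conj x).
    apply/eqP; rewrite eq_mulgV1; apply/eqP/K1.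
    have : (a, a') ^ (x, y) * ((a, a') * ((b, b') * (b, b')))^-1 \in G.
      by rewrite groupM ?groupV ?groupJ // !groupM.
    rewrite (_ : _ * _ = (a ^ x * (a * (b * b))^-1, a' ^ y * (a' * (b' * b'))^-1)) //.
    by rewrite ea mulgV.
  apply/eqP; rewrite eq_mulgV1; apply/eqP/K1.
  have : (b, b') ^ (x, y) * ((b, b')^-1)^-1 \in G by rewrite groupM ?groupV ?groupJ.
  rewrite (_ : _ * _ = (b ^ x * b^-1^-1, b' ^ y * b'^-1^-1)) //.
  by rewrite eb mulgV.
have cR : #|R| = #|G|.
  have inj2 : 'injm (restrm (subsetT G) [morphism of snd]).
    apply/injmP => -[x1 y1] [x2 y2] h1 h2 e; have {}e : y1 = y2 := e; subst y1; congr pair.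
    apply/eqP; rewrite eq_mulgV1; apply/eqP/K1.
    have : (x1, y2) * (x2, y2)^-1 \in G by rewrite groupM ?groupV.
    by rewrite (_ : _ * _ = (x1 * x2^-1, y2 * y2^-1)) // mulgV.
  rewrite -(card_injm inj2 (subxx _)); apply: eq_card => y; apply/idP/morphimP.
    by move=> /mix_snd[x xy]; exists (x, y).
  by case=> -[x y'] h _ /= ->; move: h => /(subsetP mix_sub); rewrite inE => /andP[].
have -> : L = ([morphism of fst] @* G)%G.
  apply/group_inj/setP => x; apply/idP/morphimP.
    by move=> /mix_fst[y xy]; exists (x, y); rewrite ?inE.
  by case=> -[x' y] _ h /= ->; move: h => /(subsetP mix_sub); rewrite inE => /andP[].
by rewrite cR dvdn_morphim.
Qed.

Lemma mix_full : G = setX L R.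
Proof.
apply/eqP; rewrite eqEsubset mix_sub /=; apply/subsetP => -[x y]; rewrite inE /= => /andP[xL yR].
have [x' xy] := mix_snd yR.
have x'L : x' \in L by move: xy => /(subsetP mix_sub); rewrite inE => /andP[].
have : x * x'^-1 \in mix_ker by rewrite mix_ker_full groupM ?groupV.
rewrite inE => h; have := groupM h xy.
by rewrite (_ : _ * _ = (x * x'^-1 * x', 1 * y)) // mulgKV mul1g.
Qed.

Hypothesis centerL : forall g, g \in L -> (forall h, h \in L -> g * h = h * g) -> g = 1.

(** The first component f of [theta] maps the direct product onto [L], so the image of the normal
    subgroup 1 x R is trivial, as wanted, or all of [L]. In the latter case the image of L x 1
    centralizes [L], so f factors through [R], and [mirrorR] gives a contradiction. *)
Lemma mix_mirror_fst (theta : gT * hT -> gT * hT) :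
    {in G, forall x, theta x \in G} -> {in G &, {morph theta : x y / x * y}} ->
    theta ((a, a') * (b, b')) = (a, a') * (b, b') ->
    theta (b, b') = (b, b')^-1 -> theta (c, c') = (c, c')^-1 ->
  forall y, y \in R -> (theta (1, y)).1 = 1.
Proof.
move=> tG tM tab tb tc; have [ga gb gc] := gG.
have fM : {in G &, {morph (fun x => (theta x).1) : x y / x * y}}.
  by move=> x y xG yG /=; rewrite tM.
pose f := Morphism fM.
have ta : theta (a, a') = (a, a') * ((b, b') * (b, b')).
  by apply: (mulIg (theta (b, b'))); rewrite -tM // tab tb -!mulgA mulgV mulg1.
have fL x : x \in G -> f x \in L.
  by move=> /tG/(subsetP mix_sub); rewrite inE => /andP[].
have fG : f @* G = L.
  apply/eqP; rewrite eqEsubset; apply/andP; split.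
    by apply/subsetP => _ /morphimP[x xG _ ->]; apply: fL.
  have fb : b \in f @* G.
    by rewrite -groupV; apply/morphimP; exists (b, b') => //=; rewrite tb.
  rewrite -genL gen_subG; apply/subsetP => x; rewrite !inE => /orP[/orP[]|] /eqP->//.
    have fab : a * b \in f @* G.
      by apply/morphimP; exists ((a, a') * (b, b')); rewrite ?groupM //= tab.
    by have := groupM fab (groupVr fb); rewrite mulgK.
  by rewrite -groupV; apply/morphimP; exists (c, c') => //=; rewrite tc.
have KG : setX 1 R <| G.
  rewrite mix_full; apply/andP; split.
    by apply/subsetP => -[x y]; rewrite !inE => /andP[/eqP-> ->]; rewrite group1.
  apply/subsetP => -[x y]; rewrite !inE => /andP[_ yR]; apply/subsetP => _ /imsetP[[u v] /setXP[/set1P-> vR] ->].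
  by rewrite (_ : _ ^ _ = (1 ^ x, v ^ y)) // inE /= conj1g set11 groupJ.
have KGs := normal_sub KG.
have inK y : y \in R -> (1, y) \in setX 1 R by move=> yR; rewrite !inE eqxx.
have M_norm := morphim_normal f KG; rewrite fG in M_norm.
have [triv|nontriv] := boolP (f @* setX 1 R == 1).
  move=> y yR; apply/set1P; rewrite -[[set 1]]/(1 : {set gT}) -(eqP triv).
  apply/morphimP; exists (1, y); rewrite ?inK //.
  by apply: (subsetP KGs); apply: inK.
have onto := simpleL (normal_sub M_norm) (normal_norm M_norm) nontriv.
have inL x : x \in L -> (x, 1) \in G by rewrite mix_full inE /= group1 andbT.
have inR y : y \in R -> (1, y) \in G by rewrite mix_full inE /= group1.
have psi x : x \in L -> exists2 y, y \in R & (theta (1, y)).1 = x.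
  by rewrite -onto => /morphimP[[u v] _ /setXP[/set1P-> vR] ->]; exists v.
have phi1 x : x \in L -> f (x, 1) = 1.
  move=> xL; apply: centerL; first by apply: fL; apply: inL.
  move=> z /psi[y yR <-]; rewrite -[(theta _).1]/(f (1, y)) -!morphM ?inL ?inR //.
  rewrite (_ : (x, 1) * (1, y) = (x * 1, 1 * y)) // (_ : (1, y) * (x, 1) = (1 * x, y * 1)) //.
  by rewrite !mulg1 !mul1g.
have fE x y : x \in L -> y \in R -> f (x, y) = f (1, y).
  move=> xL yR; have -> : (x, y) = (x, 1) * (1, y).
    by rewrite (_ : (x, 1) * (1, y) = (x * 1, 1 * y)) // mulg1 mul1g.
  by rewrite morphM ?inL ?inR // phi1 // mul1g.
have GLR g : g \in G -> f g = f (1, g.2).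
  by case: g => x y /(subsetP mix_sub); rewrite inE => /andP[/= xL yR]; apply: fE.
case: mirrorR => [[y yR [ea eb]]|/negP[]]; last first.
  rewrite -onto; apply: dvdn_trans (dvdn_morphim f (setX_group 1 R)) _.
  by rewrite /= cardsX cards1 mul1n.
have fJ g : g \in G -> f (g ^ (1, y)) = f g ^ f (1, y) by move=> gG'; rewrite morphJ ?inR.
have fa : f (a, a') = a * (b * b) by rewrite /= ta.
have fb : f (b, b') = b^-1 by rewrite /= tb.
have Ja : f (a, a') ^ f (1, y) = a.
  rewrite -fJ // GLR ?groupJ ?inR // (_ : (_ ^ _).2 = a' ^ y) // ea.
  rewrite -[a' * (b' * b')]/((a, a') * ((b, b') * (b, b'))).2 -GLR ?groupM // !morphM ?groupM //.
  by rewrite fa fb -!mulgA mulKVg mulgV mulg1.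
have Jb : f (b, b') ^ f (1, y) = b.
  rewrite -fJ // GLR ?groupJ ?inR // (_ : (_ ^ _).2 = b' ^ y) // eb.
  by rewrite -[b'^-1]/((b, b')^-1).2 -GLR ?groupV // morphV // fb invgK.
(* [f (1, y)] conjugates the mirrored pair back to [a] and [b], so its inverse performs the
   forbidden conjugation. *)
case: (@no_conj (f (1, y))^-1).
  by rewrite -{1}Ja conjgK fa.
by rewrite -{1}Jb conjgK fb.
Qed.

End Mix.

Section ExactRotary.
Local Open Scope group_scope.
Variables (gT : finGroupType) (a b c d : gT) (v : Defs.point).
Hypothesis exact_ab : exact_walks a b v.
Hypotheses (unit1 : ~ lattice v (1, 0)%R) (unit2 : ~ lattice v (0, 1)%R).
Hypotheses (da : a ^ d = c^-1) (db : b ^ d = b^-1) (dc : c ^ d = a^-1).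

Lemma exact_walks_ab : a * b * (a * b) = 1.
Proof.
have w := WalkHexagon (walk_corner a b); apply/(exact_ab (walkM w w)).
split; first by apply/eqP.
have -> : (mcomp (mcomp rot_corner rot_hexagon) (mcomp rot_corner rot_hexagon)).2 = 0%R by apply/eqP.
exact: lattice_0.
Qed.

Lemma exact_walks_bc : b * c * (b * c) = 1.
Proof.
have h : (a * b) ^ d = (b * c)^-1 by rewrite conjMg da db invMg.
by apply: invg_inj; rewrite invMg -h -conjMg exact_walks_ab conj1g invg1.
Qed.

Lemma stabilizer1_walk u : u \in stabilizer 1 -> exists2 h, h \in <[b]> & walk a b h u.
Proof.
rewrite !inE => /or3P[] /eqP->.
- by exists 1; [exact: group1 | exact: Walk1].
- by exists b; [exact: cycle_id | exact: walk_corner].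
exists (b * b); first by rewrite groupM ?cycle_id.
have -> : (4, (0, 1))%R = mcomp rot_corner rot_corner by apply/eqP.
exact: walkM (walk_corner a b) (walk_corner a b).
Qed.

Lemma walk_stabilizer1 x : x \in <[b]> -> exists2 u, u \in stabilizer 1 & walk a b x u.
Proof.
case/cycleP=> i ->; rewrite -(expg_mod i (exact_corner3 exact_ab)).
have : (i %% 3 < 3)%N by rewrite ltn_mod.
case: (i %% 3)%N => [|[|[|//]]] _.
- by exists mone; [rewrite !inE eqxx | exact: Walk1].
- by exists rot_corner; [rewrite !inE eqxx orbT | exact: walk_corner].
exists (mcomp rot_corner rot_corner); first by [].
by rewrite expgS expg1; exact: walkM (walk_corner a b) (walk_corner a b).
Qed.

Lemma walk_hexagonX i : exists k, walk a b (a ^+ i) (k, 0)%R.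
Proof.
have e : (iter i (mcomp rot_hexagon) mone).2 = 0%R.
  by elim: i => //= i IH; rewrite IH rotz_0 GRing.addr0.
exists (iter i (mcomp rot_hexagon) mone).1.
by rewrite -e -surjective_pairing; apply: walk_iter (walk_hexagon a b).
Qed.

(** A power of [a] is a rotation about 0, whereas a nontrivial power of [b] has a unit vector as
    translation part, which the lattice does not contain. *)
Lemma cycle_ab_trivial : <[a]> :&: <[b]> = 1.
Proof.
apply/trivgP/fintype.subsetP => x /setIP[/cycleP[i ->] /walk_stabilizer1[u us wu]].
have [k wk] := walk_hexagonX i; have [+ lu] := (walk_fun exact_ab wk wu).1 (erefl _).
rewrite inE; move: us lu; rewrite GRing.subr0 !inE => /or3P[] /eqP-> //= _ k0.
by apply/eqP/(exact_ab wk); split; [| exact: lattice_0].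
Qed.

Lemma exact_walks_neq1 : [/\ a != 1, b != 1 & c != 1].
Proof.
have a1 : a != 1 by apply/eqP => /(exact_ab (walk_hexagon a b))[/eqP].
split=> //; first by apply/eqP => /(exact_ab (walk_corner a b))[/eqP].
apply: contraNneq a1 => c1; rewrite -invg_eq1 -dc c1 conj1g //.
Qed.

Hypothesis abc : a * b * c * (a * b * c) = 1.
Hypothesis meet : <<[set b; c]>> :&: <<[set a; b]>> \subset <[b]>.

(** Conjugation by [d] carries the intersection of [<[a]>] and [<[b]>] to that of [<[c]>] and
    [<[b]>], so only one of them needs the walks. *)
Lemma exact_intersection :
  intersection_property (Rotary exact_walks_ab exact_walks_bc abc).
Proof.
have [a1 b1 c1] := exact_walks_neq1; rewrite /intersection_property /= meet a1 b1 c1 cycle_ab_trivial eqxx.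
have := congr1 (fun A : {set gT} => A :^ d) cycle_ab_trivial.
by rewrite conjIg -!cycleJ da db !cycleV conjs1g setIC => ->; rewrite eqxx.
Qed.

End ExactRotary.

Lemma walk_pair (gT hT : finGroupType) (a b : gT) (a' b' : hT) (g : gT * hT) w :
  walk (a, a') (b, b') g w -> walk a b g.1 w /\ walk a' b' g.2 w.
Proof.
elim=> [|h u _ [h1 h2]|h u _ [h1 h2]]; first by split; exact: Walk1.
  by split; exact: WalkHexagon.
by split; exact: WalkCorner.
Qed.

Lemma gen_pair (gT hT : finGroupType) (b c : gT) (b' c' : hT) h :
  h \in <<[set (b, b'); (c, c')]>>%g -> h.1 \in <<[set b; c]>>%g /\ h.2 \in <<[set b'; c']>>%g.
Proof.
have sub : (<<[set (b, b'); (c, c')]>> \subset setX <<[set b; c]>> <<[set b'; c']>>)%g.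
  by rewrite gen_subG; apply/fintype.subsetP => z /set2P[] ->; rewrite inE /= !mem_gen ?set21 ?set22.
by move/(fintype.subsetP sub); rewrite inE => /andP.
Qed.

Lemma mirror_translation t : mirror (0, t)%R = (0, (- (t.1 + t.2), t.2))%R.
Proof. by rewrite /mirror /= GRing.oppr0 rotz0 GRing.subrr GRing.add0r. Qed.

(** * The mix of the triple in L2(p) with the rotations of Q *)

Section MixedRotations.
Local Open Scope group_scope.
Variables (p b c m : nat) (dQ : Order.disp_t) (Q : finTBPOrderType dQ) (Phi : {set Q}).
Hypotheses (p_prime : prime p) (p_mod12 : p = 1 %[mod 12]).
Hypotheses (b_gt0 : (0 < b)%N) (c_gt0 : (0 < c)%N) (p_eq : p = (b ^ 2 + b * c + c ^ 2)%N).
Hypotheses (Q_polytope : polytope 4 Q) (Q_regular : regular Q) (Phi_flag : flag Phi).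
Hypothesis Q_order : ~~ (p * (p ^ 2 - 1) %| #|Gamma Q|)%N.
Variable alpha : 'F_p.
Hypothesis alpha4 : (alpha ^+ 4 = alpha ^+ 2 - 1)%R.
Hypothesis zeta_alpha : (zeta alpha * c%:R = - b%:R)%R.

Local Notation x1 := (s1 alpha).
Local Notation x2 := (s2 alpha).
Local Notation x3 := (s3 alpha).
Local Notation y1 := (sigma Phi 1).
Local Notation y2 := (sigma Phi 2).
Local Notation y3 := (sigma Phi 3).
Local Notation t1 := ((x1, y1) : coset_of 'Z(SLF 'F_p) * {perm Q}).
Local Notation t2 := ((x2, y2) : coset_of 'Z(SLF 'F_p) * {perm Q}).
Local Notation t3 := ((x3, y3) : coset_of 'Z(SLF 'F_p) * {perm Q}).
Local Notation LG := (SLF 'F_p / 'Z(SLF 'F_p))%G.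
Local Notation RG := <<[set y1; y2; y3]>>%G.
Local Notation bc := ((Posz b, Posz c) : Defs.point).

Let two0 := two_Fp p_prime p_mod12 b_gt0 c_gt0 p_eq.
Let three0 := three_Fp p_prime p_mod12 b_gt0 c_gt0 p_eq.

Lemma s_exact_walks : exact_walks x1 x2 bc.
Proof.
move=> g w gw; have h := s_walk_eq1 alpha4 two0 three0 gw.
by rewrite -(red_lattice p_prime p_mod12 b_gt0 c_gt0 p_eq zeta_alpha).
Qed.

Lemma bc_lattice : lattice bc bc.
Proof. by exists 1%R, 0%R; rewrite mulr1z mulr0z GRing.addr0. Qed.

Lemma s_mirror_neq1 : ~ walk x1 x2 1 (mirror (0, bc)%R).
Proof.
rewrite mirror_translation => /(s_walk_eq1 alpha4 two0 three0)[+ _] => /(_ erefl)[_].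
exact: (red_mirror p_prime p_mod12 b_gt0 c_gt0 p_eq zeta_alpha).
Qed.

Lemma s2V : x2^-1 = x2 * x2.
Proof.
apply/eqP; rewrite eq_invg_mul; apply/eqP.
by have := exact_corner3 s_exact_walks; rewrite !expgS expg0 mulg1.
Qed.

(** The translation by (b,c) has value 1. A conjugation acting as the reflection would give value 1
    to the mirrored translation too, although that one leaves the lattice. *)
Lemma s_no_conj x : x1 ^ x = x1 * (x2 * x2) -> x2 ^ x = x2^-1 -> False.
Proof.
move=> e1 e2; have [g gw] := walk_total x1 x2 (0, bc)%R; apply: s_mirror_neq1.
have g1 : g = 1 by apply/(s_exact_walks gw); split=> //; exact: bc_lattice.
have := @walk_mirror _ _ x1 x2 x1 x2 (conjg^~ x) g _ (conj1g x) _ _ gw.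
rewrite g1 conj1g; apply=> h _; first by rewrite conjMg e1 -!mulgA.
by rewrite conjMg e2 s2V -!mulgA.
Qed.

(** If the rotations have index 2, divisibility by |L2(p)| would make p(p^2-1) divide the order of
    [Gamma Q]. Otherwise [rho 2] is itself a product of rotations and serves as mirror. *)
Lemma rotation_mirror :
  (exists2 y, y \in RG & y1 ^ y = y1 * (y2 * y2) /\ y2 ^ y = y2^-1) \/ ~~ (#|LG| %| #|RG|)%N.
Proof.
case: (card_Gamma_rotation Q_polytope Q_regular Phi_flag isT) => e.
  left; exists (rho Phi 2); last exact: (sigma_mirror Q_polytope Q_regular Phi_flag).
  have : rho Phi 2 \in Gamma Q by apply: (rho_Gamma Q_polytope Q_regular Phi_flag).
  by rewrite e /= -/(rotation_subgroup 4 Phi) rotation_subgroupE.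
right; apply: contra Q_order => h; rewrite e rotation_subgroupE.
have := card_LF_dvdn 'F_p; rewrite card_Fp // => /dvdn_trans; apply.
by rewrite dvdn_pmul2l.
Qed.

Lemma alpha4_neq1 : (alpha ^+ 4 != 1)%R.
Proof.
apply/eqP => e; move: three0; have a2 : (alpha ^+ 2 = 2)%R.
  by apply/eqP; rewrite -GRing.subr_eq -alpha4 e.
have -> : (3 : 'F_p)%R = ((alpha ^+ 2) ^+ 2 - 1)%R by rewrite a2; ring.
by rewrite -GRing.exprM e GRing.subrr eqxx.
Qed.

Let simpleL M := @LF_simple _ (@Fp_nat_surj p) alpha M (alpha_neq0 alpha4) alpha4_neq1.
Let genL : <<[set x1; x2; x3]>> = LG := s_generate (@Fp_nat_surj p) alpha4 three0.
Let genR : <<[set y1; y2; y3]>> = RG := erefl _.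

Lemma mix_generate : <<[set t1; t2; t3]>> = setX (LF 'F_p) (rotation_subgroup 4 Phi).
Proof.
rewrite rotation_subgroupE.
exact: (mix_full genL genR simpleL s_no_conj rotation_mirror).
Qed.

(** The translation by (b,c) has a value (1, y) in the mix, and its image under [theta] has first
    component 1 by [mix_mirror_fst]. That component is also the value in L2(p) of the mirrored
    translation, which is not 1. *)
Lemma mix_no_mirror (theta : coset_of 'Z(SLF 'F_p) * {perm Q} -> coset_of 'Z(SLF 'F_p) * {perm Q}) :
    {in <<[set t1; t2; t3]>>, forall x, theta x \in <<[set t1; t2; t3]>>} ->
    {in <<[set t1; t2; t3]>> &, {morph theta : x y / x * y}} ->
    theta (t1 * t2) = t1 * t2 -> theta t2 = t2^-1 -> theta t3 = t3^-1 -> False.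
Proof.
move=> tG tM tab tb tc.
have triv := mix_mirror_fst genL genR simpleL s_no_conj rotation_mirror
  (fun g => @LF_center_trivial _ g) tG tM tab tb tc.
have [g gw] := walk_total t1 t2 (0, bc)%R; have [gw1 gw2] := walk_pair gw.
have g1 : g.1 = 1 by apply/(s_exact_walks gw1); split=> //; exact: bc_lattice.
have subG : <<[set t1; t2]>> \subset <<[set t1; t2; t3]>> by apply/genS/subsetUl.
have g2 : g.2 \in RG.
  by apply: (fintype.subsetP (genS (subsetUl [set y1; y2] [set y3]))); apply: walk_gen gw2.
have t1G : t1 \in <<[set t1; t2; t3]>> by apply: mem_gen; rewrite !inE eqxx.
have t2G : t2 \in <<[set t1; t2; t3]>> by apply: mem_gen; rewrite !inE eqxx orbT.
have ta : theta t1 = t1 * (t2 * t2).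
  by apply: (mulIg (theta t2)); rewrite -tM // tab tb -!mulgA mulgV mulg1.
apply: s_mirror_neq1.
have fg : (theta g).1 = 1 by rewrite [g]surjective_pairing g1; apply: triv.
have := @walk_mirror _ _ t1 t2 x1 x2 (fun h => (theta h).1) g _ (triv 1 (group1 _)) _ _ gw.
rewrite fg; apply=> h hG; have {}hG := fintype.subsetP subG h hG.
  by rewrite tM // ta -[LHS]/(x1 * (x2 * x2) * (theta h).1) -!mulgA.
by rewrite tM // tb -[LHS]/(x2^-1 * (theta h).1) s2V -!mulgA.
Qed.

Hypotheses (m_ge2 : (2 <= m)%N) (Q_type : of_type 4 Q (map63 m 0) (map36 m 0)).

Let mixP := mix_lattice m p_prime p_mod12 b_gt0 c_gt0 p_eq zeta_alpha.

Lemma mix_exact_walks : exact_walks t1 t2 (mix_vector p b c m).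
Proof.
have [ex _] := sigma_exact_walks Q_polytope Q_regular Phi_flag m_ge2 Q_type.
move=> g w gw; have [gw1 gw2] := walk_pair gw.
have h1 := s_walk_eq1 alpha4 two0 three0 gw1; have h2 := ex _ _ gw2.
split=> [g1|[k l]].
  have [k r] := h1.1 (congr1 fst g1); have [_ l] := h2.1 (congr1 snd g1).
  by split=> //; apply/mixP.
have [r l'] := (mixP _).1 l.
by apply: injective_projections; [apply/h1 | apply/h2].
Qed.

Lemma mix_unit_notin : ~ lattice (mix_vector p b c m) (1, 0)%R /\ ~ lattice (mix_vector p b c m) (0, 1)%R.
Proof.
by split=> /mixP[_]; apply: (unit_notin_lattice m_ge2); rewrite !inE eqxx ?orbT.
Qed.

(** The second component fixes the base vertex of Q, so modulo the lattice of (m,0) the motion is a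
    power of the corner rotation. Dividing by the matching power of [t2] leaves a translation: its
    value in Q is 1, and its matrix is both upper and lower triangular, hence trivial. *)
Lemma mix_meet : <<[set t2; t3]>> :&: <<[set t1; t2]>> \subset <[t2]>.
Proof.
apply/fintype.subsetP => g /setIP[g23 /gen_walk[w gw]].
have [ex vs] := sigma_exact_walks Q_polytope Q_regular Phi_flag m_ge2 Q_type.
have [_ gw2] := walk_pair gw; have [_ g2] := gen_pair g23.
have [t lt st] := vs _ _ gw2 (sigma23_vertex Q_polytope Q_regular Phi_flag g2).
have [h hb hw] := stabilizer1_walk t1 t2 st.
have hw' := walkM gw (walkV mix_exact_walks hw).
have ew : mcomp w (minv (w.1, w.2 + t)%R) = (0, - t)%R.
  rewrite /mcomp /minv /= GRing.subrr; congr pair.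
  rewrite rotzN -rotzD GRing.subrr rotz0 GRing.opprD GRing.addrC GRing.addrA GRing.subrr GRing.add0r //.
rewrite ew in hw'; have [k1 k2] := walk_pair hw'.
have h23 : h \in <<[set t2; t3]>>.
  by move: h hb {hw hw' k1 k2}; apply/fintype.subsetP; rewrite cycle_subG mem_gen // set21.
have [l1 _] := gen_pair (groupM (groupVr h23) g23).
suff e : h^-1 * g = 1 by rewrite -[g](mulKVg h) e mulg1.
apply: injective_projections.
  exact: (s_walk_lower alpha4 k1 erefl l1).
by apply/(ex _ _ k2); split=> //; apply: lattice_N.
Qed.

Lemma mix_abc : t1 * t2 * t3 * (t1 * t2 * t3) = 1.
Proof.
apply: injective_projections; first exact: (s123_inv alpha4 three0).
exact: (sigma123_inv Q_polytope Q_regular Phi_flag).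
Qed.

End MixedRotations.

Theorem theorem8p3 (p b c m : nat) (dQ : Order.disp_t)
    (Q : finTBPOrderType dQ) (Phi : {set Q})
    (p_prime : prime p) (p_mod12 : p = 1 %[mod 12])
    (b_gt0 : 0 < b) (c_gt0 : 0 < c) (p_eq : p = b ^ 2 + b * c + c ^ 2)
    (m_ge2 : 2 <= m) (m_mod3 : ~~ (3 %| m))
    (Q_polytope : polytope 4 Q) (Q_regular : regular Q)
    (Q_self_dual : self_dual Q)
    (Q_type : of_type 4 Q (map63 m 0) (map36 m 0))
    (Q_order : ~~ (p * (p ^ 2 - 1) %| #|Gamma Q|))
    (Phi_flag : flag Phi) :
  exists (d : Order.disp_t) (P : finTBPOrderType d),
    [/\ polytope 4 P, chiral P, properly_self_dual P,
        Gamma P \isog setX (L2 p) (rotation_subgroup 4 Phi)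
      & if p %| m then of_type 4 P (map63 m 0) (map36 m 0)
        else of_type 4 P (map63 (m * b) (m * c)) (map36 (m * b) (m * c))].
Proof.
have [alpha [alpha4 zeta_alpha]] := sqrt_zeta p_prime p_mod12 b_gt0 c_gt0 p_eq.
have three0 := three_Fp p_prime p_mod12 b_gt0 c_gt0 p_eq.
(* Normalized to fix [Phi], the duality conjugates the [sigma Phi i] exactly as [dual_pgl]
   conjugates the matrices, so the pair acts on the mixed generators. *)
have [f fd fP] := flag_fixing_duality Q_polytope Q_regular Phi_flag Q_self_dual.
have [d1 d2 d3] := dual_s alpha4 three0.
have [f1 f2 f3] := sigma_dual Q_polytope Q_regular Phi_flag fd fP.
pose gT : finGroupType := (coset_of 'Z(SLF 'F_p)%g * {perm Q})%type.
pose t1 : gT := (s1 alpha, sigma Phi 1); pose t2 : gT := (s2 alpha, sigma Phi 2).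
pose t3 : gT := (s3 alpha, sigma Phi 3); pose d : gT := (dual_pgl alpha, f).
have da : (t1 ^ d = t3^-1)%g by apply: injective_projections; [exact: d1 | exact: f1].
have db : (t2 ^ d = t2^-1)%g by apply: injective_projections; [exact: d2 | exact: f2].
have dc : (t3 ^ d = t1^-1)%g by apply: injective_projections; [exact: d3 | exact: f3].
have ex : exact_walks t1 t2 (mix_vector p b c m).
  exact: (mix_exact_walks p_prime p_mod12 b_gt0 c_gt0 p_eq Q_polytope Q_regular Phi_flag alpha4 zeta_alpha m_ge2 Q_type).
have abc := mix_abc p_prime p_mod12 b_gt0 c_gt0 p_eq Q_polytope Q_regular Phi_flag alpha4.
have [u1 u2] := mix_unit_notin p_prime p_mod12 b_gt0 c_gt0 p_eq zeta_alpha m_ge2.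
have meet := mix_meet p_prime p_mod12 b_gt0 c_gt0 p_eq Q_polytope Q_regular Phi_flag alpha4 zeta_alpha m_ge2 Q_type.
have ip := exact_intersection ex u1 u2 da db dc abc meet.
set D := Rotary _ _ _ in ip.
have nm : no_mirror D.
  move=> theta; exact: (mix_no_mirror p_prime p_mod12 b_gt0 c_gt0 p_eq Q_polytope Q_regular Phi_flag Q_order alpha4 zeta_alpha).
have gen : cgroup D 0 = setX (L2 p) (rotation_subgroup 4 Phi) :> {set gT}.
  exact: (mix_generate p_prime p_mod12 b_gt0 c_gt0 p_eq Q_polytope Q_regular Phi_flag Q_order alpha4 zeta_alpha).
exists coset_display, (cface D); split.
- exact: (coset_polytope ip).
- exact: (coset_chiral ip nm).
- exact: (coset_properly_self_dual ip nm da db dc).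
- by have := coset_Gamma_isog ip nm; rewrite gen.
by have := coset_of_type ip ex da db dc; rewrite /mix_vector; case: ifP.
Qed.
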